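(* Let $(\mathcal M,\mathcal N,\mathcal D)$ be a Cartan triple and set $\mathcal G:=\mathcal{GN}(\mathcal M,\mathcal D)$ and $\mathcal P:=\mathcal{GN}(\mathcal N,\mathcal D)$. Then $\mathcal G$ and $\mathcal P$ are inverse semigroups with $\mathcal P\subseteq\mathcal G$ and $\mathcal E(\mathcal P)=\mathcal E(\mathcal G)=\operatorname{proj}(\mathcal D)$, the set of projections of $\mathcal D$. Moreover: (a) $\mathcal P$ is an $\mathcal N$-Clifford inverse monoid. (b) $\mathcal P$ is the set of elements of $\mathcal G$ that are Munn-related to an idempotent. (c) If $\mathcal S$ is the quotient of $\mathcal G$ by the Munn congruence, then $\mathcal S$ is a Cartan inverse monoid.
   Context: Von Neumann subalgebras are understood to contain the unit of the ambient algebra. For a von Neumann algebra $\mathcal M$ and a von Neumann subalgebra $\mathcal L\subseteq\mathcal M$, put $\mathcal{GN}(\mathcal M,\mathcal L)=\{v\in\mathcal M: v\text{ is a partial isometry and } v^*\mathcal Lv\cup v\mathcal Lv^*\subseteq\mathcal L\}$; $\mathcal L$ is regular in $\mathcal M$ if the linear span of $\mathcal{GN}(\mathcal M,\mathcal L)$ is weak-$*$ dense in $\mathcal M$. A Cartan triple $(\mathcal M,\mathcal N,\mathcal D)$ consists of von Neumann algebras such that (1) $\mathcal D$ is an abelian and regular von Neumann subalgebra of $\mathcal M$; (2) $\mathcal N$ is the relative commutant of $\mathcal D$ in $\mathcal M$; (3) there exists a faithful normal conditional expectation $E:\mathcal M\to\mathcal N$. For a von Neumann algebra $\mathcal N$,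 an $\mathcal N$-Clifford inverse monoid is an inverse monoid of the form $\mathcal{GN}(\mathcal N,\mathcal D)$ with $\mathcal D$ a von Neumann subalgebra of the center $\mathcal Z(\mathcal N)$. For an inverse semigroup $\mathcal G$ (inverse $v\mapsto v^\dagger$, idempotents $\mathcal E(\mathcal G)$; for partial isometries $v^\dagger=v^*$), the Munn congruence is $R_M=\{(v_1,v_2): v_1ev_1^\dagger=v_2ev_2^\dagger\ \forall e\in\mathcal E(\mathcal G)\}$. The natural partial order is $s\le t$ iff $s=te$ for some idempotent $e$; elements $s,t$ are orthogonal if $s^\dagger t=st^\dagger=0$. An inverse semigroup is fundamental if the only elements commuting with all idempotents are the idempotents. An inverse monoid $\mathcal S$ with $0$ is a Boolean inverse monoid if $\mathcal E(\mathcal S)$ is a Boolean algebra, $(\mathcal S,\le)$ is a meet semilattice, and orthogonal pairs have joins; it is a complete Boolean inverse monoid if moreover every pairwise orthogonal family has a join in $\mathcal S$ (in particular $\mathcal E(\mathcal S)$ is a complete Boolean algebra). A Cartan inverse monoid is a fundamental complete Boolean inverse monoid $\mathcal S$ such that the character (Stone) space $\widehat{\mathcal E(\mathcal S)}$ of the complete Boolean lattice $\mathcal E(\mathcal S)$ is hyperstonean. *)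

(* Defs.v *)
From HB Require Import structures.
From mathcomp Require Import all_boot all_order all_algebra.
From mathcomp Require Import sesquilinear complex.
From mathcomp Require Import all_classical all_reals all_analysis.

Set Implicit Arguments.
Unset Strict Implicit.
Unset Printing Implicit Defensive.

Import Order.TTheory GRing.Theory Num.Theory.
Import numFieldNormedType.Exports.

Local Open Scope classical_set_scope.
Local Open Scope complex_scope.
Local Open Scope ring_scope.

Section Order.
Context {T : Type}.
Implicit Types (A B : set T) (le : T -> T -> Prop).

Definition is_lub A le B x :=
  [/\ A x, forall b, B b -> le b x
    & forall y, A y -> (forall b, B b -> le b y) -> le x y].

Definition is_glb A le B x := is_lub A (fun s t => le t s) B x.

Definition partial_order A le :=
  [/\ forall a, A a -> le a a,
      forall a b, A a -> A b -> le a b -> le b a -> a = b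
    & forall a b c, A a -> A b -> A c -> le a b -> le b c -> le a c].

Definition meet_semilattice A le :=
  partial_order A le /\
  forall a b, A a -> A b -> exists m, is_glb A le [set a; b] m.

(* The one-element algebra, in which bottom and top coincide, is allowed. *)
Definition boolean_algebra A le :=
  [/\ meet_semilattice A le,
      forall a b, A a -> A b -> exists j, is_lub A le [set a; b] j,
      forall a b c j m m1 m2, A a -> A b -> A c ->
        is_lub A le [set b; c] j -> is_glb A le [set a; j] m ->
        is_glb A le [set a; b] m1 -> is_glb A le [set a; c] m2 ->
        is_lub A le [set m1; m2] m
    & exists bot top,
        [/\ is_lub A le set0 bot, is_glb A le set0 top
          & forall a, A a -> exists c,
              [/\ A c, is_glb A le [set a; c] bot
                & is_lub A le [set a; c] top]]].

Definition boolean_character A le : set {ptws set_type A -> bool} :=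
  [set chi | [/\
    forall a b m : set_type A,
      is_glb A le [set set_val a; set_val b] (set_val m) ->
      chi m = chi a && chi b,
    forall a b j : set_type A,
      is_lub A le [set set_val a; set_val b] (set_val j) ->
      chi j = chi a || chi b,
    forall o : set_type A, is_lub A le set0 (set_val o) -> chi o = false
  & forall i : set_type A, is_glb A le set0 (set_val i) -> chi i = true]].

Definition stone_space A le : topologicalType :=
  set_type (@boolean_character A le).

End Order.

(* The library's measurable spaces are pointed; [based x0] supplies a base
   point, which plays no other role. *)
Definition based (X : Type) (x0 : X) : Type := X.

Section Based.
Variables (X : choiceType) (x0 : X).
HB.instance Definition _ := Choice.copy (based x0) X.
HB.instance Definition _ := isPointed.Build (based x0) x0.
End Based.

Definition borel (X : topologicalType) (x0 : X) :=
  g_sigma_algebraType (@open X : set (set (based x0))).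

Section Hyperstonean.
Context (R : realType).

(* A finite Borel measure on a compact space which is inner regular. *)
Definition radon (X : topologicalType) (x0 : X)
    (mu : {finite_measure set (borel x0) -> \bar R}) :=
  forall B : set (borel x0), measurable B ->
    mu B = ereal_sup [set mu K | K in
             [set K : set (borel x0) | @compact X K /\ K `<=` B]].

(* Order continuity: mu (sup f_i) = sup (mu f_i) for every increasing net f_i
   having a supremum in C(X, R), a net being presented by its set F of values. *)
Definition normal_measure (X : topologicalType) (x0 : X)
    (mu : {finite_measure set (borel x0) -> \bar R}) :=
  forall (F : set (X -> R)) (g : X -> R),
    F !=set0 ->
    F `<=` [set f | continuous f] ->
    (forall f1 f2, F f1 -> F f2 -> exists2 f3, F f3 &
       forall x, f1 x <= f3 x /\ f2 x <= f3 x) ->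
    is_lub [set f | continuous f] (fun f1 f2 => forall x, f1 x <= f2 x) F g ->
    (\int[mu]_x (g x)%:E)%E =
    ereal_sup [set (\int[mu]_x (f x)%:E)%E | f in F].

Definition stonean (X : topologicalType) :=
  [/\ compact [set: X], hausdorff_space X
    & forall U : set X, open U -> open (closure U)].

Definition hyperstonean (X : topologicalType) :=
  stonean X /\
  forall (f : X -> R) (x0 : X),
    continuous f -> (forall x, 0 <= f x) -> f x0 <> 0 ->
    exists mu : {finite_measure set (borel x0) -> \bar R},
      [/\ radon mu, normal_measure mu & (\int[mu]_x (f x)%:E)%E <> 0%E].

End Hyperstonean.

Record star_magma (T : Type) := StarMagma {
  carrier : set T;
  smul : T -> T -> T;
  sinv : T -> T }.

Section InverseSemigroup.
Context {T : Type} (S : star_magma T).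
Local Notation "s ** t" := (smul S s t) (at level 40, left associativity).
Local Notation "s ^!" := (sinv S s).

Definition inverse_semigroup :=
  [/\ forall s t, carrier S s -> carrier S t -> carrier S (s ** t),
      forall s t u, carrier S s -> carrier S t -> carrier S u ->
        s ** (t ** u) = s ** t ** u,
      forall s, carrier S s ->
        [/\ carrier S s^!, s ** s^! ** s = s & s^! ** s ** s^! = s^!]
    & forall s t, carrier S s -> carrier S t ->
        s ** t ** s = s -> t ** s ** t = t -> t = s^!].

Definition is_unit u :=
  carrier S u /\ forall s, carrier S s -> u ** s = s /\ s ** u = s.

Definition is_zero z :=
  carrier S z /\ forall s, carrier S s -> z ** s = z /\ s ** z = z.

Definition inverse_monoid := inverse_semigroup /\ exists u, is_unit u.

Definition idempotents : set T := [set e | carrier S e /\ e ** e = e].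

Definition natural_le s t := exists2 e, idempotents e & s = t ** e.

Definition orthogonal z s t := s^! ** t = z /\ s ** t^! = z.

Definition munn v1 v2 :=
  forall e, idempotents e -> v1 ** e ** v1^! = v2 ** e ** v2^!.

Definition fundamental :=
  forall s, carrier S s ->
    (forall e, idempotents e -> s ** e = e ** s) -> idempotents s.

Definition has_join (A : set T) :=
  exists j, is_lub (carrier S) natural_le A j.

Definition boolean_inverse_monoid := inverse_monoid /\
  exists2 z, is_zero z &
  [/\ boolean_algebra idempotents natural_le,
      meet_semilattice (carrier S) natural_le
    & forall s t, carrier S s -> carrier S t -> orthogonal z s t ->
        has_join [set s; t]].

Definition complete_boolean_inverse_monoid := boolean_inverse_monoid /\
  forall z, is_zero z -> forall A : set T, A `<=` carrier S ->
    (forall s t, A s -> A t -> s <> t -> orthogonal z s t) -> has_join A.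

Definition cartan_inverse_monoid (R : realType) :=
  [/\ complete_boolean_inverse_monoid, fundamental
    & hyperstonean R (stone_space idempotents natural_le)].

(* The quotient by a congruence r, realized on the set of classes. The product of
   two classes is the saturation of their elementwise product: when r is a
   congruence this is the class of a ** b for any representatives a and b. *)
Definition quotient (r : T -> T -> Prop) : star_magma (set T) :=
  StarMagma
    [set [set w | carrier S w /\ r v w] | v in carrier S]
    (fun A B => [set w | carrier S w /\
       exists a b, [/\ A a, B b & r (a ** b) w]])
    (fun A => [set w | carrier S w /\ exists2 a, A a & r (a^!) w]).

End InverseSemigroup.

Section VonNeumann.
Context (R : realType) (H : completeNormedModType R[i])
  (ip : {dot H for (@Num.conj R[i])}).
Implicit Types (v x y p : H -> H) (M N D L : set (H -> H)).

Definition bounded_operator x := linear x /\ continuous x.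

(* Every bounded operator has exactly one adjoint; 0 is a dummy value. *)
Definition adj x : H -> H :=
  xget (0 : H -> H) [set y | forall xi eta, ip (x xi) eta = ip xi (y eta)].

Definition commutant M : set (H -> H) :=
  [set y | bounded_operator y /\ forall x, M x -> x \o y = y \o x].

(* By the last clause M is automatically a subalgebra containing the identity
   of H, so that von Neumann algebras on H that are nested share their unit. *)
Definition von_neumann_algebra M :=
  [/\ M `<=` bounded_operator, forall x, M x -> M (adj x)
    & commutant (commutant M) = M].

Definition von_neumann_subalgebra M L := von_neumann_algebra L /\ L `<=` M.

Definition center N := N `&` commutant N.

Definition projection p := p \o p = p /\ adj p = p.

Definition partial_isometry v := projection (adj v \o v).

Definition GN M L : set (H -> H) :=
  [set v | [/\ M v, partial_isometry v
    & forall x, L x -> L (adj v \o x \o v) /\ L (v \o x \o adj v)]].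

Definition square_summable (xi : nat -> H) :=
  cvgn (series (fun n => `|xi n| ^+ 2) : nat -> R[i]^o).

(* The weak-* topology on B(H), as the dual of the trace class operators, is the
   initial topology for the functionals x |-> \sum_n <x xi_n, eta_n> with xi and
   eta square summable; that of a von Neumann algebra on H is induced by it. *)
Definition predual : Type :=
  [set f : (nat -> H) * (nat -> H) |
     square_summable f.1 /\ square_summable f.2].

Definition predual_eval (x : H -> H) : {ptws predual -> R[i]^o} :=
  fun f => limn (series (fun n =>
    ip (x ((set_val f).1 n)) ((set_val f).2 n)) : nat -> R[i]^o).

Definition weak_star := initial_topology predual_eval.

Definition linear_span (A : set (H -> H)) : set (H -> H) :=
  [set x | exists n (c : 'I_n -> R[i]) (a : 'I_n -> H -> H),
     (forall k, A (a k)) /\ x = \sum_(k < n) c k *: a k].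

Definition regular M L :=
  M `<=` closure (linear_span (GN M L) : set weak_star).

Definition positive_operator x := forall xi, 0 <= ip (x xi) xi.

Definition conditional_expectation M N (E : (H -> H) -> (H -> H)) :=
  [/\ forall x, M x -> N (E x),
      forall c x y, M x -> M y -> E (c *: x + y) = c *: E x + E y,
      forall x, M x -> positive_operator x -> positive_operator (E x),
      forall x, N x -> E x = x
    & forall a x b, N a -> M x -> N b -> E (a \o x \o b) = a \o E x \o b].

Definition faithful M (E : (H -> H) -> (H -> H)) :=
  forall x, M x -> E (adj x \o x) = 0 -> x = 0.

Definition normal M (E : (H -> H) -> (H -> H)) :=
  {within (M : set weak_star), continuous (E : weak_star -> weak_star)}.

Definition abelian D := forall x y, D x -> D y -> x \o y = y \o x.

Definition cartan_triple M N D :=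
  [/\ [/\ von_neumann_algebra M, von_neumann_algebra N
        & von_neumann_subalgebra M D],
      abelian D /\ regular M D,
      N = M `&` commutant D
    & exists E, [/\ conditional_expectation M N E, faithful M E & normal M E]].

Definition GN_semigroup M L : star_magma (H -> H) :=
  StarMagma (GN M L) (fun x y => x \o y) adj.

Definition clifford_inverse_monoid N P := inverse_monoid P /\
  exists2 L, von_neumann_subalgebra (center N) L & P = GN_semigroup N L.

End VonNeumann.

(* Main.v *)
Require Import Defs.
From HB Require Import structures.
From mathcomp Require Import all_boot all_order all_algebra.
From mathcomp Require Import sesquilinear complex.
From mathcomp Require Import all_classical all_reals all_analysis.
From mathcomp Require Import measurable_realfun ring lra.

Import Order.TTheory GRing.Theory Num.Theory.
Import numFieldNormedType.Exports.

Local Open Scope classical_set_scope.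
Local Open Scope complex_scope.
Local Open Scope ring_scope.

(** The elements of [G := GN(M, D)] are partial isometries whose initial and final
    projections lie in the abelian algebra [D]. Products and adjoints of
    normalizers are normalizers, the idempotents among them are the projections of
    [D], and these commute; so [G] is an inverse semigroup with idempotents
    [proj(D)], and the same holds for [P := GN(N, D)].

    For (b), in any inverse semigroup an element [v] is Munn-related to an
    idempotent exactly when it commutes with all idempotents ([munn_idemP]). An
    operator that commutes with the projections of [D] commutes with [D]
    ([commutes_with_abelian]), because a self-adjoint element of [D] is a norm limit
    of combinations of projections. This is proved without spectral measures: the
    square root of a positive operator, obtained by iterating [y := (a + y^2) / 2],
    provides the projection of [D] on which a self-adjoint [a] is positive
    ([sign_projection]), and subtracting [(2 e - 1) / 2] for this projection [e]
    halves the bound on [a]. Hence the elements of [G] that are Munn-related to an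
    idempotent are those in the relative commutant [N] of [D].

    For (c), the quotient [S] of [G] by the Munn congruence has the same idempotents
    as [G] up to isomorphism ([quotient_idem_lift], [quotient_idem_inj]), and an
    element of [S] is determined by its action on them, so [S] is fundamental. The
    projections of [D] form a complete Boolean algebra: a supremum projects onto the
    complement of an intersection of kernels. Completeness gives meets in [S], since
    the idempotents on which [s] and [t] agree have a largest one
    ([fundamental_meet]). Orthogonal joins exist in [G], as strong sums of
    orthogonal families of partial isometries ([GN_orthogonal_join]), and they
    descend to [S] ([quotient_orthogonal_joins]).

    It remains to see that the Stone space of [proj(D)] is hyperstonean. It is
    stonean because the Boolean algebra is complete. Every vector [x] gives the order
    continuous weight [p |-> <p x, x>] on projections, and every nonzero projection
    has positive weight for some [x]. Such a weight, read on clopen sets, generates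
    an outer measure; order continuity makes it countably subadditive and makes open
    sets measurable, so it restricts to a normal Radon measure on the Stone space
    ([weight_measure_normal], [hyperstonean_stone_space]). *)

(** * Inverse semigroups *)

Section InverseSemigroupTheory.
Context {T : Type} {S : star_magma T}.
Implicit Types (s t u e f g : T).
Local Notation "s ** t" := (smul S s t) (at level 40, left associativity).
Local Notation "s ^!" := (sinv S s).
Local Notation C := (carrier S).
Local Notation E := (idempotents S).

Lemma idem_carrier e : E e -> C e. Proof. by case. Qed.
Lemma idem_mulK e : E e -> e ** e = e. Proof. by case. Qed.

(** Two inverses [s^!] and [t] of [s] satisfy [s s^! = s t] and [s^! s = t s],
    because these idempotents absorb one another and commute; hence
    [t = t s t = s^! s s^! = s^!]. *)
Lemma inverse_semigroup_of_commuting_idempotents :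
  (forall s t, C s -> C t -> C (s ** t)) ->
  (forall s t u, C s -> C t -> C u -> s ** (t ** u) = s ** t ** u) ->
  (forall s, C s -> [/\ C s^!, s ** s^! ** s = s & s^! ** s ** s^! = s^!]) ->
  (forall e f, E e -> E f -> e ** f = f ** e) ->
  inverse_semigroup S.
Proof.
move=> mC mA mV comm; split=> // s t Cs Ct sts tst.
have [Cs' sVs VsV] := mV _ Cs.
have idem a b : C a -> C b -> a ** b ** a = a -> E (a ** b).
  by move=> Ca Cb abab; split; [exact: mC|rewrite mA ?abab//; exact: mC].
have c1 := comm _ _ (idem _ _ Cs Ct sts) (idem _ _ Cs Cs' sVs).
have c2 := comm _ _ (idem _ _ Ct Cs tst) (idem _ _ Cs' Cs VsV).
have st : s ** s^! = s ** t.
  rewrite -{1}sts -mA//; last exact: mC.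
  by rewrite c1 !mA ?sVs//; do ?exact: mC.
have ts : s^! ** s = t ** s.
  rewrite -{2}sts !mA//; do ?exact: mC.
  by rewrite -mA// -?c2 ?mA//; do ?exact: mC; rewrite -(mA t s) // -(mA t) ?sVs//;
     do ?exact: mC.
by rewrite -VsV -mA// st mA//  ts tst.
Qed.

Hypothesis invS : inverse_semigroup S.

Lemma smulC s t : C s -> C t -> C (s ** t).
Proof. by case: invS => + _ _ _; apply. Qed.

Lemma sinvC s : C s -> C s^!.
Proof. by case: invS => _ _ + _ Cs => /(_ _ Cs)[]. Qed.

Local Ltac incarrier :=
  repeat first [assumption | apply: smulC | apply: sinvC | apply: idem_carrier].
Local Hint Extern 0 (carrier _ _) => solve [incarrier] : core.

Lemma smulA s t u : C s -> C t -> C u -> s ** (t ** u) = s ** t ** u.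
Proof. by case: invS => _ + _ _; apply. Qed.

Lemma smulVK s : C s -> s ** s^! ** s = s.
Proof. by case: invS => _ _ + _ Cs => /(_ _ Cs)[]. Qed.

Lemma sinvVK s : C s -> s^! ** s ** s^! = s^!.
Proof. by case: invS => _ _ + _ Cs => /(_ _ Cs)[]. Qed.

Lemma sinv_uniq s t : C s -> C t -> s ** t ** s = s -> t ** s ** t = t -> t = s^!.
Proof. by case: invS => _ _ _; apply. Qed.

Lemma sinvK s : C s -> s^!^! = s.
Proof. by move=> Cs; rewrite -(sinv_uniq s^! s)// ?smulVK// sinvVK. Qed.

Lemma idem_inv e : E e -> e^! = e.
Proof. by move=> [Ce ee]; rewrite -(sinv_uniq e e)// ?ee. Qed.

Lemma idem_dom s : C s -> E (s^! ** s).
Proof. by move=> Cs; split=> //; rewrite smulA// sinvVK. Qed.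

Lemma idem_ran s : C s -> E (s ** s^!).
Proof. by move=> Cs; split=> //; rewrite smulA// smulVK. Qed.

Lemma smulAr s t u : C s -> C t -> C u -> s ** t ** u = s ** (t ** u).
Proof. by move=> *; rewrite smulA. Qed.

Lemma smulVKA s x : C s -> C x -> s ** (s^! ** (s ** x)) = s ** x.
Proof. by move=> Cs Cx; rewrite !smulA// smulVK. Qed.

Lemma sinvVKA s x : C s -> C x -> s^! ** (s ** (s^! ** x)) = s^! ** x.
Proof. by move=> Cs Cx; rewrite !smulA// sinvVK. Qed.

Lemma idem_mulKA e x : E e -> C x -> e ** (e ** x) = e ** x.
Proof. by move=> [Ce ee] Cx; rewrite smulA// ee. Qed.

(** The inverse [x] of [e f] equals [f x e] by uniqueness, which makes [x]
    idempotent; an idempotent is its own inverse, so [x = e f]. *)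
Lemma idem_mul e f : E e -> E f -> E (e ** f).
Proof.
move=> Ee Ef; have Cef : C (e ** f) by [].
pose x := (e ** f)^!; have Cx : C x by rewrite /x.
have xefx : x ** (e ** (f ** x)) = x by rewrite -[RHS]sinvVK// -/x !smulAr.
have efxef : e ** (f ** (x ** (e ** f))) = e ** f by rewrite -[RHS]smulVK// -/x !smulAr.
have xefxA y : C y -> x ** (e ** (f ** (x ** y))) = x ** y.
  by move=> Cy; rewrite -{3}xefx !smulAr.
have fxe : f ** (x ** e) = x.
  by apply: sinv_uniq => //; rewrite !smulAr// !idem_mulKA// ?xefxA.
have xx : (f ** (x ** e)) ** (f ** (x ** e)) = x by rewrite !smulAr// xefxA.
rewrite fxe in xx.
suff -> : e ** f = x by [].
by rewrite -[RHS]idem_inv// /x sinvK.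
Qed.

Lemma idem_comm e f : E e -> E f -> e ** f = f ** e.
Proof.
move=> Ee Ef.
have [_ efef] := idem_mul e f Ee Ef; have [_ fefe] := idem_mul f e Ef Ee.
rewrite -[LHS]idem_inv; last exact: idem_mul.
symmetry; apply: sinv_uniq => //; rewrite !smulAr// !idem_mulKA//.
  by rewrite -[RHS]efef smulAr.
by rewrite -[RHS]fefe smulAr.
Qed.

Lemma idem_mulCA e f x : E e -> E f -> C x -> e ** (f ** x) = f ** (e ** x).
Proof. by move=> Ee Ef Cx; rewrite !smulA// (idem_comm e). Qed.

Lemma smulVKr s : C s -> s ** (s^! ** s) = s.
Proof. by move=> Cs; rewrite smulA// smulVK. Qed.

Lemma sinvVKr s : C s -> s^! ** (s ** s^!) = s^!.
Proof. by move=> Cs; rewrite smulA// sinvVK. Qed.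

Lemma sinvM s t : C s -> C t -> (s ** t)^! = t^! ** s^!.
Proof.
move=> Cs Ct; have Es := idem_dom s Cs; have Et := idem_ran t Ct.
symmetry; apply: sinv_uniq => //; rewrite !smulAr//.
  rewrite (smulA t)// (smulA s^! s)// (idem_mulCA (t ** t^!))// !smulAr// smulVKA//.
  by rewrite smulVKr.
rewrite (smulA s^! s)// (smulA t t^!)// (idem_mulCA (s^! ** s))// !smulAr// sinvVKA//.
by rewrite sinvVKr.
Qed.

(** The Munn representation sends [s] to the map [e |-> s e s^!] on idempotents. *)
Definition munn_map s e := s ** e ** s^!.

Lemma conj_idem s e : C s -> E e -> E (munn_map s e).
Proof.
move=> Cs Ee; split; rewrite /munn_map//; rewrite !smulAr//.
have Es := idem_dom s Cs.
by rewrite (smulA s^! s)// (idem_mulCA e)// (idem_mulKA e)// !smulAr// smulVKA.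
Qed.

Lemma conjM s t e : C s -> C t -> E e -> munn_map (s ** t) e = munn_map s (munn_map t e).
Proof. by move=> Cs Ct Ee; rewrite /munn_map sinvM// !smulAr. Qed.

Lemma conj_mul s e f : C s -> E e -> E f -> munn_map s (e ** f) = munn_map s e ** munn_map s f.
Proof.
move=> Cs Ee Ef; have Es := idem_dom s Cs; rewrite /munn_map !smulAr//.
by rewrite (smulA s^! s)// (idem_mulCA e (s^! ** s))// !smulAr// smulVKA.
Qed.

Lemma conj_inv s e : C s -> E e -> munn_map s^! (munn_map s e) = s^! ** s ** e.
Proof.
move=> Cs Ee; have Es := idem_dom s Cs; rewrite /munn_map sinvK// !smulAr//.
by rewrite (idem_comm e)// !smulAr// (sinvVKA s).
Qed.

Lemma conj_invr s e : C s -> E e -> munn_map s (munn_map s^! e) = s ** s^! ** e.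
Proof. by move=> Cs Ee; rewrite -{1}(sinvK s)// conj_inv// sinvK. Qed.

Lemma conj_of_idem e f : E e -> E f -> munn_map e f = e ** f.
Proof.
by move=> Ee Ef; rewrite /munn_map idem_inv// smulAr// (idem_comm f)// idem_mulKA.
Qed.

Lemma smul_idem s e : C s -> E e -> s ** e = munn_map s e ** s.
Proof.
move=> Cs Ee; rewrite /munn_map !smulAr// (idem_comm e)//; last exact: idem_dom.
by rewrite !smulAr// smulVKA.
Qed.

(** If [v] acts on idempotents as [e] does, then [e v = v], and moving an
    idempotent [f] across [v] gives [v f = (v f v^!) v = f e v = f v]. *)
Lemma munn_idemP v : C v ->
  (exists2 e, E e & Defs.munn S v e) <-> forall f, E f -> v ** f = f ** v.
Proof.
move=> Cv; have Er := idem_ran v Cv; split=> [[e Ee ve] f Ef|comm].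
  have vE g : E g -> munn_map v g = e ** g by move=> Eg; rewrite -conj_of_idem//; exact: ve.
  (* the range projection of [v] lies below [e] *)
  have ev : e ** v = v.
    have Ed := idem_dom v Cv.
    have rE : v ** v^! = e ** (v^! ** v).
      by rewrite -(vE _ Ed) /munn_map !smulAr// smulVKA.
    by rewrite -{1}(smulVK v)// rE smulA// idem_mulKA// -rE smulVK.
  by rewrite smul_idem// vE// (idem_comm e)// smulAr// ev.
exists (v ** v^!) => // f Ef; rewrite -[RHS]/(munn_map (v ** v^!) f) conj_of_idem//.
by rewrite comm// smulAr// (idem_comm f).
Qed.

(** ** The natural partial order *)

Lemma idem_leP e f : E e -> E f -> natural_le S e f <-> f ** e = e.
Proof.
move=> Ee Ef; split=> [[g Eg ->]|fe]; first by rewrite idem_mulKA.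
by exists e.
Qed.

Lemma natural_leP s t : C s -> C t -> natural_le S s t <-> s = t ** (s^! ** s).
Proof.
move=> Cs Ct; split=> [[e Ee ->]|st]; last by exists (s^! ** s) => //; exact: idem_dom.
have Et := idem_dom t Ct.
by rewrite sinvM// idem_inv// !smulAr// (smulA t^! t)// (idem_mulCA e (t^! ** t))//
  (idem_mulK e)// !smulAr// smulVKA.
Qed.

Lemma natural_le_partial_order : partial_order C (natural_le S).
Proof.
split=> [a Ca|a b Ca Cb [e Ee ab] [f Ef ba]|a b c Ca Cb Cc [e Ee ->] [f Ef ->]].
- by exists (a^! ** a); [exact: idem_dom|rewrite smulA// smulVK].
- have afe : a = a ** (f ** e) by rewrite -smulAr// -ba.
  by rewrite [RHS]ba [in RHS]afe !smulAr// (idem_comm e)// (idem_mulKA f).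
- by exists (f ** e); [exact: idem_mul|rewrite smulAr].
Qed.

Lemma idem_sub_partial_order : partial_order E (natural_le S).
Proof.
case: natural_le_partial_order => r a t; split.
- by move=> x [/r].
- by move=> x y [Cx _] [Cy _]; exact: a.
- by move=> x y z [Cx _] [Cy _] [Cz _]; exact: t.
Qed.

(** ** Complemented idempotents *)

(** The Boolean structure of the idempotents is carried by a complement [co]
    satisfying the one law [co_le], from which suprema and relative
    pseudocomplements are derived. *)
Section Complemented.
Variables (one zero : T) (co : T -> T).
Hypotheses (unit1 : is_unit S one) (zero0 : is_zero S zero).
Hypothesis co_idem : forall e, E e -> E (co e).
Hypothesis coK : forall e, E e -> co (co e) = e.
Hypothesis co_le : forall e f, E e -> E f -> f ** e = zero <-> f ** co e = f.

Lemma idem_one : E one.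
Proof. by case: unit1 => C1 u1; split=> //; case: (u1 _ C1). Qed.

Lemma idem_zero : E zero.
Proof. by case: zero0 => C1 u1; split=> //; case: (u1 _ C1). Qed.

Definition join e f := co (co e ** co f).
Definition impl e f := co (e ** co f).

Lemma join_idem e f : E e -> E f -> E (join e f).
Proof. by move=> Ee Ef; apply/co_idem/idem_mul; exact: co_idem. Qed.

Lemma impl_idem e f : E e -> E f -> E (impl e f).
Proof. by move=> Ee Ef; apply/co_idem/idem_mul => //; exact: co_idem. Qed.

Lemma co_leN e f : E e -> E f -> f ** co e = zero <-> f ** e = f.
Proof. by move=> Ee Ef; have := co_le (co e) f; rewrite coK//; apply=> //; exact: co_idem. Qed.

Lemma implP x e f : E x -> E e -> E f -> x ** impl e f = x <-> f ** (x ** e) = x ** e.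
Proof.
move=> Ex Ee Ef; have Exe := idem_mul x e Ex Ee; have Ec := co_idem f Ef.
rewrite (idem_comm f)// -(co_leN f)// smulAr//.
by rewrite /impl; apply: iff_sym; apply: co_le => //; exact: idem_mul.
Qed.

Lemma joinP e f g : E e -> E f -> E g ->
  g ** join e f = join e f <-> g ** e = e /\ g ** f = f.
Proof.
move=> Ee Ef Eg; have Ej := join_idem e f Ee Ef.
have [Ece Ecf Ecg] : [/\ E (co e), E (co f) & E (co g)] by split; exact: co_idem.
have Ecc := idem_mul _ _ Ece Ecf.
have le_co a b : E a -> E b -> a ** b = b <-> co a ** co b = co a.
  move=> Ea Eb; rewrite (idem_comm a)// -co_leN// (idem_comm b)//; last exact: co_idem.
  by apply: co_le => //; exact: co_idem.
rewrite !le_co// /join coK//; split=> [h|[h1 h2]].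
  rewrite -h; split; rewrite !smulAr//.
    by rewrite (idem_comm (co f))// (idem_mulKA (co e)).
  by rewrite (idem_mulK (co f)).
by rewrite smulA// h1 h2.
Qed.

Lemma idem_glb a b : E a -> E b -> is_glb E (natural_le S) [set a; b] (a ** b).
Proof.
move=> Ea Eb; have Eab := idem_mul a b Ea Eb; split=> // [c|y Ey yab].
  by case=> ->; apply/idem_leP => //; rewrite 1?idem_mulKA// (idem_comm a)// idem_mulKA.
have /idem_leP-/(_ Ey Ea) ya := yab a (or_introl erefl).
have /idem_leP-/(_ Ey Eb) yb := yab b (or_intror erefl).
by apply/idem_leP => //; rewrite smulAr// yb.
Qed.

Lemma idem_lub a b : E a -> E b -> is_lub E (natural_le S) [set a; b] (join a b).
Proof.
move=> Ea Eb; have Ej := join_idem a b Ea Eb.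
have [ja jb] := (joinP a b (join a b) Ea Eb Ej).1 (idem_mulK _ Ej).
split=> // [c|y Ey yab]; first by case=> ->; apply/idem_leP.
by apply/idem_leP => //; apply/joinP => //; split; apply/idem_leP => //;
  apply: yab; [left|right].
Qed.

Lemma lub_uniq A B x y : A `<=` C ->
  is_lub A (natural_le S) B x -> is_lub A (natural_le S) B y -> x = y.
Proof.
move=> AC [Ax x1 x2] [Ay y1 y2]; case: natural_le_partial_order => _ anti _.
by apply: anti; [exact: AC|exact: AC|exact: x2|exact: y2].
Qed.

Lemma glb_uniq A B x y : A `<=` C ->
  is_glb A (natural_le S) B x -> is_glb A (natural_le S) B y -> x = y.
Proof.
move=> AC [Ax x1 x2] [Ay y1 y2]; case: natural_le_partial_order => _ anti _.
by apply: anti; [exact: AC|exact: AC|exact: y2|exact: x2].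
Qed.

Let subE : E `<=` C. Proof. by move=> e []. Qed.

(** Multiplication by [f] is left adjoint to [impl f], so it preserves suprema. *)
Lemma idem_sup_mul X e f : X `<=` E -> E f -> is_lub E (natural_le S) X e ->
  is_lub E (natural_le S) [set x ** f | x in X] (e ** f).
Proof.
move=> XE Ef [Ee ub lub]; split; first exact: idem_mul.
  move=> _ [x Xx <-]; have Ex := XE x Xx.
  apply/idem_leP; [exact: idem_mul|exact: idem_mul|].
  have /idem_leP-/(_ Ex Ee) ex := ub x Xx.
  by rewrite smulAr// (idem_mulCA f)// (idem_mulK f)// smulA// ex.
move=> y Ey yub; apply/idem_leP => //; first exact: idem_mul.
apply/implP => //; rewrite idem_comm//; last exact: impl_idem.
apply/idem_leP => //; first exact: impl_idem.
apply: lub; first exact: impl_idem.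
move=> x Xx; have Ex := XE x Xx; apply/idem_leP => //; first exact: impl_idem.
rewrite -idem_comm//; last exact: impl_idem.
by apply/implP => //; apply/idem_leP => //; [exact: idem_mul|apply: yub; exists x].
Qed.

Lemma conj_le s e f : C s -> E e -> E f ->
  natural_le S e f -> natural_le S (munn_map s e) (munn_map s f).
Proof.
move=> Cs Ee Ef /(idem_leP _ _ Ee Ef) fe; apply/idem_leP; try exact: conj_idem.
by rewrite -conj_mul// fe.
Qed.

(** [munn_map s] and [munn_map s^!] are mutually inverse order isomorphisms between
    the idempotents below [s^! s] and those below [s s^!]. *)
Lemma conj_sup s X e : C s -> X `<=` E -> is_lub E (natural_le S) X e ->
  is_lub E (natural_le S) [set munn_map s x | x in X] (munn_map s e).
Proof.
move=> Cs XE lube; have [Ee ub lub] := lube; have Es := idem_dom s Cs.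
split; first exact: conj_idem.
  by move=> _ [x Xx <-]; apply: conj_le => //; [exact: XE|exact: ub].
move=> y Ey yub.
have [_ _ lub'] := idem_sup_mul X e (s^! ** s) XE Es lube.
have conj_dom x : E x -> munn_map s x = munn_map s (x ** (s^! ** s)).
  by move=> Ex; rewrite /munn_map !smulAr// sinvVKr.
have /idem_leP : natural_le S (e ** (s^! ** s)) (munn_map s^! y).
  apply: lub'; first exact: conj_idem.
  move=> _ [x Xx <-]; have Ex := XE x Xx; rewrite idem_comm// -conj_inv//.
  by apply: conj_le => //; [exact: conj_idem|apply: yub; exists x].
move=> /(_ (idem_mul _ _ Ee Es) (conj_idem _ _ (sinvC s Cs) Ey)) le1.
apply/idem_leP => //; first exact: conj_idem.
have Er := idem_ran s Cs.
rewrite conj_dom// -le1 conj_mul//; [|exact: conj_idem|exact: idem_mul].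
have Ec : E (munn_map s (e ** (s^! ** s))) by apply: conj_idem => //; exact: idem_mul.
by rewrite conj_invr// (idem_comm _ y)// smulAr// idem_mulKA.
Qed.

(** Fundamentality, as faithfulness of the Munn representation. *)
Hypothesis munn_eq : forall s t, C s -> C t -> munn S s t -> s = t.

(** Munn maps preserve suprema, so [s ** e] and [t ** e] have the same Munn map. *)
Lemma eq_on_sup s t X e : C s -> C t -> X `<=` E -> is_lub E (natural_le S) X e ->
  (forall x, X x -> s ** x = t ** x) -> s ** e = t ** e.
Proof.
move=> Cs Ct XE lube st; have [Ee _ _] := lube.
apply: munn_eq => // f Ef; rewrite -[LHS]/(munn_map (s ** e) f) -[RHS]/(munn_map (t ** e) f).
have Xf : [set x ** f | x in X] `<=` E.
  by move=> _ [x Xx <-]; apply: idem_mul => //; exact: XE.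
have lubf := idem_sup_mul X e f XE Ef lube.
have conjE u x : C u -> E x -> munn_map (u ** x) f = munn_map u (x ** f).
  by move=> Cu Ex; rewrite conjM// (conj_of_idem x).
rewrite !conjE//.
apply: (lub_uniq E _ _ _ subE (conj_sup s _ _ Cs Xf lubf)).
suff -> : [set munn_map s x | x in [set x ** f | x in X]] =
          [set munn_map t x | x in [set x ** f | x in X]] by exact: conj_sup.
rewrite !image_comp; apply: eq_imagel => x Xx /=; have Ex := XE x Xx.
by rewrite -!conjE// st.
Qed.

Hypothesis completeE : forall X, X `<=` E -> exists e, is_lub E (natural_le S) X e.

(** The meet of [s] and [t] is [s ** e], where [e] is the largest idempotent
    on which they agree; it exists because agreement passes to suprema. *)
Lemma fundamental_meet : meet_semilattice C (natural_le S).
Proof.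
split; first exact: natural_le_partial_order.
move=> s t Cs Ct.
pose X := [set x | E x /\ s ** x = t ** x].
have XE : X `<=` E by move=> x [].
have [e lube] := completeE X XE; have [Ee ub _] := lube.
have ste : s ** e = t ** e by apply: (eq_on_sup s t X) => // x [].
exists (s ** e); split=> //; first by move=> b [->|->]; exists e.
move=> l Cl lst; have El := idem_dom l Cl.
have /natural_leP-/(_ Cl Cs) ls := lst s (or_introl erefl).
have /natural_leP-/(_ Cl Ct) lt := lst t (or_intror erefl).
have /idem_leP-/(_ El Ee) el : natural_le S (l^! ** l) e.
  by apply: ub; split=> //; rewrite -ls -lt.
by apply/natural_leP => //; rewrite smulAr// el.
Qed.

Lemma idem_boolean_algebra : boolean_algebra E (natural_le S).
Proof.
split.
- split; first exact: idem_sub_partial_order.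
  by move=> a b Ea Eb; exists (a ** b); exact: idem_glb.
- by move=> a b Ea Eb; exists (join a b); exact: idem_lub.
- move=> a b c j m m1 m2 Ea Eb Ec.
  move=> lubj glbm glb1 glb2; have [Ej _ _] := lubj.
  rewrite (glb_uniq E _ _ _ subE glbm (idem_glb a j Ea Ej)).
  rewrite (glb_uniq E _ _ _ subE glb1 (idem_glb a b Ea Eb)).
  rewrite (glb_uniq E _ _ _ subE glb2 (idem_glb a c Ea Ec)).
  rewrite (_ : [set a ** b; a ** c] = [set x ** a | x in [set b; c]]); last first.
    by rewrite image_setU !image_set1 !(idem_comm a).
  rewrite (idem_comm a)//; apply: idem_sup_mul => //.
  by move=> x [->|->].
- have E1 := idem_one; have E0 := idem_zero.
  have [C1 u1] := unit1; have [C0 z0] := zero0.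
  exists zero, one; split.
  + split=> // y Ey _; apply/idem_leP => //.
    by case: (z0 y _) => //.
  + split=> // y Ey _; apply/idem_leP => //.
    by case: (u1 y _).
  + move=> a Ea; have Eca := co_idem a Ea; exists (co a); split=> //.
      rewrite (_ : zero = a ** co a); first exact: idem_glb.
      by symmetry; rewrite co_le// ?coK// idem_mulK.
    rewrite (_ : one = join a (co a)); first exact: idem_lub.
    have Ecc := co_idem _ Eca.
    rewrite /join (_ : co a ** co (co a) = zero); last first.
      by apply/co_leN => //; exact: idem_mulK.
    have Ec0 := co_idem _ E0; have [oc _] := u1 (co zero) (idem_carrier _ Ec0).
    have [_ oz] := z0 one C1.
    by rewrite -oc; symmetry; apply/co_le.
Qed.

End Complemented.

End InverseSemigroupTheory.

(** * The quotient by the Munn congruence *)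

Section MunnQuotient.
Context {T : Type} {G : star_magma T}.
Implicit Types (s t u e f g v w : T).
Local Notation "s ** t" := (smul G s t) (at level 40, left associativity).
Local Notation "s ^!" := (sinv G s).
Local Notation C := (carrier G).
Local Notation E := (idempotents G).
Local Notation conj := (@munn_map T G).
Local Notation munn := (munn G).
Hypothesis invG : inverse_semigroup G.

Local Ltac incarrier :=
  repeat first [assumption | apply: (smulC invG) | apply: (sinvC invG) | apply: idem_carrier].
Local Hint Extern 0 (carrier _ _) => solve [incarrier] : core.

Lemma munn_sym v w : munn v w -> munn w v.
Proof. by move=> h e Ee; rewrite h. Qed.

Lemma munn_trans u v w : munn u v -> munn v w -> munn u w.
Proof. by move=> h k e Ee; rewrite h// k. Qed.

Lemma munnM v v' w w' : C v -> C v' -> C w -> C w' ->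
  munn v v' -> munn w w' -> munn (v ** w) (v' ** w').
Proof.
move=> Cv Cv' Cw Cw' vv ww e Ee.
rewrite -[LHS]/(conj (v ** w) e) -[RHS]/(conj (v' ** w') e) !(conjM invG)//.
have Ece := conj_idem invG w e Cw Ee.
have -> : conj w' e = conj w e by symmetry; exact: ww.
exact: vv.
Qed.

Lemma munn_idem e f : E e -> E f -> munn e f -> e = f.
Proof.
move=> Ee Ef ef.
have efg g : E g -> e ** g = f ** g.
  by move=> Eg; rewrite -!(conj_of_idem invG)//; exact: ef.
rewrite -[LHS](idem_mulK _ Ee) efg// (idem_comm invG)// efg//.
exact: idem_mulK.
Qed.

Lemma conj_dom v : C v -> conj v (v^! ** v) = v ** v^!.
Proof. by move=> Cv; rewrite /munn_map !(smulAr invG)// (smulVKA invG). Qed.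

Lemma conj_ran v e : C v -> E e -> v ** v^! ** conj v e = conj v e.
Proof. by move=> Cv Ee; rewrite /munn_map !(smulAr invG)// (smulVKA invG). Qed.

Lemma munn_ran v w : C v -> C w -> munn v w -> v ** v^! = w ** w^!.
Proof.
have le a b : C a -> C b -> munn a b -> b ** b^! ** (a ** a^!) = a ** a^!.
  move=> Ca Cb ab; have Ed := idem_dom invG a Ca; rewrite -(conj_dom a)//.
  have -> : conj a (a^! ** a) = conj b (a^! ** a) by exact: ab.
  by rewrite conj_ran.
move=> Cv Cw vw; have Ev := idem_ran invG v Cv; have Ew := idem_ran invG w Cw.
by rewrite -(le v w)// (idem_comm invG)// le//; exact: munn_sym.
Qed.

(** [v] acts as a partial bijection of the idempotents and [v^!] as its inverse,
    which is determined by the action of [v]. *)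
Lemma munnV v w : C v -> C w -> munn v w -> munn v^! w^!.
Proof.
move=> Cv Cw vw g Eg; rewrite -[LHS]/(conj v^! g) -[RHS]/(conj w^! g).
set h := conj v^! g; set k := conj w^! g.
have Cv' : C v^! by []. have Cw' : C w^! by [].
have Eh : E h by exact: conj_idem. have Ek : E k by exact: conj_idem.
have Ev := idem_dom invG v Cv; have Ew := idem_dom invG w Cw.
have rr := munn_ran v w Cv Cw vw.
have cross a b : C a -> C b -> munn a b -> a ** a^! = b ** b^! ->
    b^! ** b ** conj a^! g = conj b^! g.
  move=> Ca Cb ab rab; rewrite -(conj_inv invG)//; last exact: conj_idem.
  have -> : conj b (conj a^! g) = conj a (conj a^! g).
    by symmetry; apply: ab; apply: conj_idem.
  rewrite conj_invr// rab.
  have Eb := idem_ran invG b Cb.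
  by rewrite /munn_map !(smulAr invG)// (sinvVKA invG).
have wh : w^! ** w ** h = k by exact: cross.
have vk : v^! ** v ** k = h by apply: cross => //; exact: munn_sym.
have <- : w^! ** w ** h = h.
  rewrite -[in LHS]vk -[in LHS]wh (idem_mulCA invG (w^! ** w))//.
  by rewrite (idem_mulKA invG)// wh vk.
by [].
Qed.

Definition munn_class v := [set w | C w /\ munn v w].
Local Notation cls := munn_class.
Local Notation Q := (quotient G munn).

Lemma munn_classP v w : C v -> C w -> cls v = cls w <-> munn v w.
Proof.
move=> Cv Cw; split=> [vw|vw].
  by have [] : cls v w by rewrite vw; split=> // e.
apply/seteqP; split=> u [Cu h]; split=> //; apply: munn_trans h => //.
exact: munn_sym.
Qed.

Lemma munn_class_refl v : C v -> cls v v. Proof. by move=> Cv; split=> // e. Qed.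

Lemma quotient_carrier v : C v -> carrier Q (cls v).
Proof. by move=> Cv; exists v. Qed.

Lemma quotient_mul v w : C v -> C w -> smul Q (cls v) (cls w) = cls (v ** w).
Proof.
move=> Cv Cw; apply/seteqP; split=> u [Cu].
  move=> [a [b [[Ca va] [Cb wb] abu]]]; split=> //.
  by apply: munn_trans abu; exact: munnM.
by move=> vwu; split=> //; exists v, w; split=> //; exact: munn_class_refl.
Qed.

Lemma quotient_inv v : C v -> sinv Q (cls v) = cls v^!.
Proof.
move=> Cv; apply/seteqP; split=> u [Cu].
  by move=> [a [Ca va] au]; split=> //; apply: munn_trans au; exact: munnV.
by move=> vu; split=> //; exists v => //; exact: munn_class_refl.
Qed.

(** The action of [u] is injective below [u^! u] and unchanged by iteration, so
    it is a restriction of the identity. *)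
Lemma munn_idem_dom u : C u -> munn (u ** u) u -> munn u (u^! ** u).
Proof.
move=> Cu uu.
have absorb a : C a -> munn (a ** a) a ->
    forall e, E e -> a^! ** a ** conj a e = a^! ** a ** e.
  move=> Ca aa e Ee; rewrite -!(conj_inv invG)//; last exact: conj_idem.
  have -> // : conj a (conj a e) = conj a e by rewrite -(conjM invG)//; exact: aa.
have Ed := idem_dom invG u Cu; have Er := idem_ran invG u Cu.
have pq : u^! ** u ** (u ** u^!) = u^! ** u.
  by rewrite -conj_dom// absorb// idem_mulK.
have Cu' : C u^! by [].
have uu' : munn (u^! ** u^!) u^!.
  by rewrite -(sinvM invG)//; apply: munnV.
have qp : u ** u^! ** (u^! ** u) = u ** u^!.
  have := conj_dom u^! Cu'; have := absorb u^! Cu' uu' (u ** u^!) Er.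
  by rewrite !(sinvK invG)// (idem_mulK _ Er) => + du; rewrite du.
have pqE : u ** u^! = u^! ** u by rewrite -qp (idem_comm invG).
move=> e Ee; rewrite -[LHS]/(conj u e) -[RHS]/(conj (u^! ** u) e) (conj_of_idem invG (u^! ** u))//.
by rewrite -(absorb u)// -pqE conj_ran.
Qed.

Lemma quotient_idem_lift A : idempotents Q A -> exists2 e, E e & A = cls e.
Proof.
move=> [[u Cu <-]]; rewrite -/(cls u) quotient_mul// => /munn_classP uu.
exists (u^! ** u); first exact: idem_dom.
by apply/munn_classP => //; apply: munn_idem_dom => //; exact: uu.
Qed.

Lemma quotient_idem e : E e -> idempotents Q (cls e).
Proof.
move=> Ee; split; first exact: quotient_carrier.
by rewrite quotient_mul// idem_mulK.
Qed.

Lemma quotient_inverse_semigroup : inverse_semigroup Q.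
Proof.
apply: inverse_semigroup_of_commuting_idempotents.
- move=> _ _ [s Cs <-] [t Ct <-]; rewrite -/(cls s) -/(cls t) quotient_mul//.
  exact: quotient_carrier.
- move=> _ _ _ [s Cs <-] [t Ct <-] [u Cu <-].
  by rewrite -/(cls s) -/(cls t) -/(cls u) !quotient_mul// (smulA invG).
- move=> _ [s Cs <-]; rewrite -/(cls s) !quotient_inv// !quotient_mul//.
  by rewrite smulVK// sinvVK//; split=> //; exact: quotient_carrier.
- move=> _ _ /quotient_idem_lift[e Ee ->] /quotient_idem_lift[f Ef ->].
  by rewrite !quotient_mul// (idem_comm invG).
Qed.

Lemma quotient_idem_inj e f : E e -> E f -> cls e = cls f -> e = f.
Proof. by move=> Ee Ef /munn_classP ef; apply: munn_idem => //; exact: ef. Qed.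

Lemma quotient_munn_eq A B : carrier Q A -> carrier Q B -> Defs.munn Q A B -> A = B.
Proof.
move=> [v Cv <-] [w Cw <-]; rewrite -/(cls v) -/(cls w) => vw.
apply/munn_classP => // e Ee; apply: quotient_idem_inj; try exact: conj_idem.
by have := vw (cls e) (quotient_idem e Ee); rewrite !quotient_inv// !quotient_mul.
Qed.

(** If the classes of [v] and [e] commute, evaluating the Munn maps of [v e] and
    [e v] at [v^! v] gives [v e v^! = v v^! e]: up to the congruence, [v] is the
    idempotent [v v^!]. *)
Lemma quotient_fundamental : fundamental Q.
Proof.
move=> _ [v Cv <-]; rewrite -/(cls v) => comm.
have Er := idem_ran invG v Cv; have Ed := idem_dom invG v Cv.
suff -> : cls v = cls (v ** v^!) by exact: quotient_idem.
apply/munn_classP => // e Ee.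
have := comm (cls e) (quotient_idem e Ee); rewrite !quotient_mul// => /munn_classP ve.
rewrite -[LHS]/(conj v e) -[RHS]/(conj (v ** v^!) e) (conj_of_idem invG (v ** v^!))//.
have := ve (smulC invG v e Cv (idem_carrier _ Ee)) (smulC invG e v (idem_carrier _ Ee) Cv).
move=> /(_ _ Ed); rewrite -[LHS]/(conj (v ** e) _) -[RHS]/(conj (e ** v) _).
rewrite !(conjM invG)// conj_dom// !(conj_of_idem invG e)// (conj_mul invG)// conj_dom//.
have Ec : E (conj v e) by exact: conj_idem.
by rewrite (idem_comm invG (conj v e))// conj_ran// => ->; exact: idem_comm.
Qed.

Lemma quotient_idem_le e f : E e -> E f ->
  natural_le Q (cls e) (cls f) <-> natural_le G e f.
Proof.
move=> Ee Ef; have invQ := quotient_inverse_semigroup.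
split.
  move=> /(idem_leP invQ _ _ (quotient_idem e Ee) (quotient_idem f Ef)).
  rewrite quotient_mul// => /quotient_idem_inj fe.
  by apply/(idem_leP invG) => //; apply: fe => //; exact: idem_mul.
move=> /(idem_leP invG _ _ Ee Ef) fe.
by apply/(idem_leP invQ); rewrite ?quotient_mul// ?fe//; exact: quotient_idem.
Qed.

Lemma quotient_lub X e : X `<=` E -> is_lub E (natural_le G) X e ->
  is_lub (idempotents Q) (natural_le Q) [set cls x | x in X] (cls e).
Proof.
move=> XE [Ee ub lub]; split; first exact: quotient_idem.
  by move=> _ [x Xx <-]; apply/quotient_idem_le; [exact: XE|exact: Ee|exact: ub].
move=> _ /quotient_idem_lift[f Ef ->] yub; apply/quotient_idem_le => //.
apply: lub => // x Xx; apply/quotient_idem_le => //; first exact: XE.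
by apply: yub; exists x.
Qed.

Lemma quotient_is_unit one : is_unit G one -> is_unit Q (cls one).
Proof.
move=> [C1 u1]; split; first exact: quotient_carrier.
by move=> _ [v Cv <-]; rewrite -/(cls v) !quotient_mul//; have [-> ->] := u1 v Cv.
Qed.

Lemma quotient_is_zero z : is_zero G z -> is_zero Q (cls z).
Proof.
move=> [C1 u1]; split; first exact: quotient_carrier.
by move=> _ [v Cv <-]; rewrite -/(cls v) !quotient_mul//; have [-> ->] := u1 v Cv.
Qed.

Section Boolean.
Variables (one zero : T) (co : T -> T).
Hypotheses (unit1 : is_unit G one) (zero0 : is_zero G zero).
Hypothesis co_idem : forall e, E e -> E (co e).
Hypothesis coK : forall e, E e -> co (co e) = e.
Hypothesis co_le : forall e f, E e -> E f -> f ** e = zero <-> f ** co e = f.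
Hypothesis completeE :
  forall X, X `<=` E -> exists e, is_lub E (natural_le G) X e.
Hypothesis orthogonal_joins : forall V, V `<=` C ->
  (forall s t, V s -> V t -> s <> t -> Defs.orthogonal G zero s t) -> has_join G V.

Let invQ := quotient_inverse_semigroup.

(** The class of [co e], written so as to make sense on arbitrary sets. *)
Let coQ (A : set T) : set T :=
  [set w | exists e, [/\ E e, A = cls e & cls (co e) w]].

Let coQE e : E e -> coQ (cls e) = cls (co e).
Proof.
move=> Ee; apply/seteqP; split=> w; last by move=> ew; exists e.
by move=> [f [Ef /quotient_idem_inj-> //]].
Qed.

Let coQ_idem A : idempotents Q A -> idempotents Q (coQ A).
Proof. by move=> /quotient_idem_lift[e Ee ->]; rewrite coQE//; apply/quotient_idem/co_idem. Qed.

Let coQK A : idempotents Q A -> coQ (coQ A) = A.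
Proof. by move=> /quotient_idem_lift[e Ee ->]; rewrite !coQE ?coK//; exact: co_idem. Qed.

Let coQ_le A B : idempotents Q A -> idempotents Q B ->
  smul Q B A = cls zero <-> smul Q B (coQ A) = B.
Proof.
move=> /quotient_idem_lift[e Ee ->] /quotient_idem_lift[f Ef ->].
have Ece := co_idem e Ee; rewrite coQE// !quotient_mul//; split=> h.
  by rewrite ((co_le e f Ee Ef).1 _)//; apply: quotient_idem_inj h => //;
    [exact: idem_mul|exact: idem_zero zero0].
by rewrite ((co_le e f Ee Ef).2 _)//; apply: quotient_idem_inj h => //; exact: idem_mul.
Qed.

Lemma quotient_complete Y : Y `<=` idempotents Q ->
  exists A, is_lub (idempotents Q) (natural_le Q) Y A.
Proof.
move=> YE; pose X := [set e | E e /\ Y (cls e)].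
have XE : X `<=` E by move=> e [].
have [e lube] := completeE X XE; exists (cls e).
rewrite (_ : Y = [set cls x | x in X]); first exact: quotient_lub.
apply/seteqP; split=> [A YA|_ [x [Ex Yx] <-]//].
by have [x Ex AE] := quotient_idem_lift A (YE A YA); exists x; rewrite -?AE// /X/= -AE.
Qed.

Lemma quotient_idem_boolean_algebra :
  boolean_algebra (idempotents Q) (natural_le Q).
Proof.
exact: (idem_boolean_algebra invQ _ _ _ (quotient_is_unit _ unit1)
  (quotient_is_zero _ zero0) coQ_idem coQK coQ_le).
Qed.

Lemma quotient_meet_semilattice : meet_semilattice (carrier Q) (natural_le Q).
Proof.
exact: (fundamental_meet invQ _ _ coQ_idem coQK coQ_le quotient_munn_eq
  quotient_complete).
Qed.

Lemma munn_zero v : C v -> munn v zero -> v = zero.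
Proof.
move=> Cv v0; have [C0 z0] := zero0; have Ed := idem_dom invG v Cv.
have vv : v ** v^! = zero.
  rewrite -conj_dom//; have -> : conj v (v^! ** v) = conj zero (v^! ** v) by exact: v0.
  rewrite /munn_map (smulAr invG)//.
  by case: (z0 (v^! ** v ** zero^!)) => //.
by rewrite -[LHS](smulVK invG)// vv; case: (z0 v Cv).
Qed.

Lemma munn_class_orthogonal v w : C v -> C w ->
  Defs.orthogonal Q (cls zero) (cls v) (cls w) -> Defs.orthogonal G zero v w.
Proof.
move=> Cv Cw; rewrite /Defs.orthogonal !quotient_inv// !quotient_mul//.
have [C0 z0] := zero0.
by case=> /munn_classP h1 /munn_classP h2; split; apply: munn_zero => //; auto.
Qed.

(** An orthogonal family of classes lifts to an orthogonal family, and the class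
    of the join [v] of the lift is the join of the classes: an upper bound of the
    classes agrees with [v] on all their domains, hence on the supremum of
    these, which is the domain of [v]. *)
Lemma quotient_orthogonal_joins (A : set (set T)) : A `<=` carrier Q ->
  (forall a b, A a -> A b -> a <> b -> Defs.orthogonal Q (cls zero) a b) ->
  has_join Q A.
Proof.
move=> AC Aorth.
have [rep repP] : {rep : set T -> T & forall a, A a -> C (rep a) /\ cls (rep a) = a}.
  apply: (@choice _ _ (fun a v => A a -> C v /\ cls v = a)) => a.
  have [/AC[v Cv va]|] := pselect (A a); first by exists v.
  by exists zero.
pose V := rep @` A.
have VC : V `<=` C by move=> _ [a Aa <-]; case: (repP a Aa).
have [|v [Cv vub vlub]] := orthogonal_joins V VC.
  move=> _ _ [a Aa <-] [b Ab <-] ab.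
  have [Ca ca] := repP a Aa; have [Cb cb] := repP b Ab.
  apply: munn_class_orthogonal => //; rewrite ca cb; apply: Aorth => //.
  by move=> aE; apply: ab; rewrite aE.
have VP u : V u -> [/\ C u, E (u^! ** u) & u = v ** (u^! ** u)].
  move=> Vu; have Cu := VC u Vu; split=> //; first exact: idem_dom.
  by apply/(natural_leP invG) => //; exact: vub.
pose X := [set u^! ** u | u in V].
have XE : X `<=` E by move=> _ [u /VP[Cu Eu _] <-].
have Ed := idem_dom invG v Cv.
have lubX : is_lub E (natural_le G) X (v^! ** v).
  split=> //.
    move=> _ [u /VP[Cu Eu uv] <-]; apply/(idem_leP invG) => //.
    have dom e : E e -> (v ** e)^! ** (v ** e) = v^! ** v ** e.
      move=> Ee; rewrite (sinvM invG)// (idem_inv invG e)// !(smulAr invG)//.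
      by rewrite !(smulA invG v^! v)// (idem_mulCA invG e)// (idem_mulK e).
    by rewrite -(dom _ Eu) -uv.
  move=> h Eh hub; apply/(idem_leP invG) => //.
  have : natural_le G v (v ** h).
    apply: vlub => // u /[dup] Vu /VP[Cu Eu uv]; exists (u^! ** u) => //.
    rewrite (smulAr invG)// (_ : h ** _ = u^! ** u)//.
    by apply/(idem_leP invG) => //; apply: hub; exists u.
  move=> /(natural_leP invG) vh.
  have {}vh : v = v ** h ** (v^! ** v) by apply: vh.
  have vvh : v = v ** h.
    rewrite {1}vh (smulAr invG)// (idem_comm invG h)// (smulA invG v)// (smulA invG v)//.
    by rewrite (smulVK invG).
  by rewrite (idem_comm invG)// (smulAr invG)// -vvh.
have lubQ := quotient_lub X _ XE lubX.
exists (cls v); split; first exact: quotient_carrier.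
  move=> a Aa; have [Ca ca] := repP a Aa.
  have [_ Er rv] := VP (rep a) (ex_intro2 _ _ a Aa erefl).
  exists (cls ((rep a)^! ** rep a)); first exact: quotient_idem.
  by rewrite quotient_mul// -rv ca.
move=> _ [w Cw <-] wub; rewrite -/(cls w) in wub *.
exists (cls (v^! ** v)); first exact: quotient_idem.
rewrite -[LHS](_ : smul Q (cls v) (cls (v^! ** v)) = _); last first.
  by rewrite quotient_mul// (smulA invG)// smulVK.
have QX : [set cls x | x in X] `<=` idempotents Q.
  by move=> _ [x Xx <-]; apply/quotient_idem/XE.
apply: (eq_on_sup invQ _ _ coQ_idem coQK coQ_le quotient_munn_eq _ _ _ _ _ _ QX lubQ).
- exact: quotient_carrier.
- exact: quotient_carrier.
move=> _ [_ [u Vu <-] <-]; have [Cu Eu uv] := VP u Vu.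
rewrite quotient_mul// -uv.
have [a Aa au] := Vu; have [_ ca] := repP a Aa.
have /(natural_leP invQ) := wub a Aa; rewrite -ca au => cu.
rewrite {1}cu//; [|exact: quotient_carrier|exact: quotient_carrier].
by rewrite quotient_inv// (quotient_mul u^! u).
Qed.

Lemma quotient_complete_boolean_inverse_monoid : complete_boolean_inverse_monoid Q.
Proof.
have joins A : A `<=` carrier Q ->
    (forall a b, A a -> A b -> a <> b -> Defs.orthogonal Q (cls zero) a b) ->
    has_join Q A by exact: quotient_orthogonal_joins.
have zQ := quotient_is_zero _ zero0.
split; last first.
  move=> z [Cz z0] A AC; suff -> : z = cls zero by exact: joins.
  have [C0 z0'] := zQ; have [<- _] := z0 _ C0.
  by have [_ ->] := z0' _ Cz.
split; first by split=> //; exists (cls one); exact: quotient_is_unit.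
exists (cls zero) => //; split.
- exact: quotient_idem_boolean_algebra.
- exact: quotient_meet_semilattice.
move=> s t Cs Ct st; apply: joins; first by move=> a [->|->].
have ts : Defs.orthogonal Q (cls zero) t s.
  have E0 := idem_inv invQ _ (idem_zero _ zQ).
  case: st => h1 h2; split.
    by rewrite -E0 -h1 (sinvM invQ)// ?(sinvK invQ)//; exact: sinvC.
  by rewrite -E0 -h2 (sinvM invQ)// ?(sinvK invQ)//; exact: sinvC.
by move=> a b [->|->] [->|->] // [].
Qed.

End Boolean.

End MunnQuotient.

(** * The Stone space of a complete Boolean algebra *)

Lemma compact_directed_cover (X : topologicalType) (K : set X) (I : Type)
    (D : set I) (W : I -> set X) : compact K -> D !=set0 ->
  (forall i, D i -> open (W i)) ->
  (forall i j, D i -> D j -> exists k, [/\ D k, W i `<=` W k & W j `<=` W k]) ->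
  (forall x, K x -> exists2 i, D i & W i x) ->
  exists2 i, D i & K `<=` W i.
Proof.
move=> cK [i0 Di0] oW dir cov; apply: contrapT => nK.
pose F : set_system X := [set S | exists2 i, D i & K `\` W i `<=` S].
have FF : ProperFilter F.
  split=> [[i Di KW]|].
    by apply: nK; exists i => // x Kx; apply: contrapT => Wx; exact: (KW x).
  split; first by exists i0.
  - move=> S S' [i Di iS] [j Dj jS]; have [k [Dk ik jk]] := dir i j Di Dj.
    exists k => // x [Kx Wx]; split; [apply: iS|apply: jS]; split=> // h;
      apply: Wx; [exact: ik|exact: jk].
  - by move=> S S' SS [i Di iS]; exists i => //; exact: subset_trans SS.
have [|x [Kx clx]] := cK F FF; first by exists i0 => // x [].
have [i Di Wx] := cov x Kx.
have FW : F (K `\` W i) by exists i.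
have nW : nbhs x (W i) by apply: open_nbhs_nbhs; split=> //; exact: oW.
by have [y [[_ nWy] /nWy]] := clx _ _ FW nW.
Qed.

Section CharacterSpace.
Context {T : Type} (A : set T) (le : T -> T -> Prop).
Local Notation B := (set_type A).
Local Notation X := (stone_space A le).
Implicit Types (a b c e : B) (x y : X).

Definition leB a b := le (set_val a) (set_val b).

Variables (mt jn : B -> B -> B) (cp : B -> B) (bt tp : B).
Hypothesis po : partial_order A le.
Hypothesis mtP : forall a b, is_glb A le [set set_val a; set_val b] (set_val (mt a b)).
Hypothesis jnP : forall a b, is_lub A le [set set_val a; set_val b] (set_val (jn a b)).
Hypothesis btP : is_lub A le set0 (set_val bt).
Hypothesis tpP : is_glb A le set0 (set_val tp).
Hypothesis mt_cp : forall a, mt a (cp a) = bt.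
Hypothesis jn_cp : forall a, jn a (cp a) = tp.
Hypothesis mt_jn : forall a b c, mt a (jn b c) = jn (mt a b) (mt a c).

Lemma memB a : A (set_val a). Proof. by rewrite set_valE; exact/set_mem/(valP a). Qed.
Local Hint Resolve memB : core.

Lemma leB_refl a : leB a a. Proof. by case: po => + _ _; apply. Qed.
Lemma leB_trans b a c : leB a b -> leB b c -> leB a c.
Proof. by case: po => _ _ t; exact: t. Qed.
Lemma leB_anti a b : leB a b -> leB b a -> a = b.
Proof. by case: po => _ t _ h k; apply/val_inj/t => //; exact: memB. Qed.

Lemma mt_lel a b : leB (mt a b) a. Proof. by case: (mtP a b) => _ + _; apply; left. Qed.
Lemma mt_ler a b : leB (mt a b) b. Proof. by case: (mtP a b) => _ + _; apply; right. Qed.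
Lemma le_mt a b c : leB c a -> leB c b -> leB c (mt a b).
Proof. by case: (mtP a b) => _ _ g ca cb; apply: g => // _ [->|->]. Qed.
Lemma jn_gel a b : leB a (jn a b). Proof. by case: (jnP a b) => _ + _; apply; left. Qed.
Lemma jn_ger a b : leB b (jn a b). Proof. by case: (jnP a b) => _ + _; apply; right. Qed.
Lemma jn_le a b c : leB a c -> leB b c -> leB (jn a b) c.
Proof. by case: (jnP a b) => _ _ g ca cb; apply: g => // _ [->|->]. Qed.
Lemma bt_le a : leB bt a. Proof. by case: btP => _ _; apply. Qed.
Lemma le_tp a : leB a tp. Proof. by case: tpP => _ _; apply. Qed.

Lemma mt_idPl a b : mt a b = a <-> leB a b.
Proof.
split=> [<-|ab]; first exact: mt_ler.
by apply: leB_anti; [exact: mt_lel|apply: le_mt => //; exact: leB_refl].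
Qed.

Lemma leB_bt a : leB a bt -> a = bt.
Proof. by move=> h; apply: leB_anti => //; exact: bt_le. Qed.

Lemma split_cp a e : leB (mt a e) bt -> leB (mt a (cp e)) bt -> a = bt.
Proof.
move=> h k; apply: leB_bt; apply: (leB_trans (mt a (jn e (cp e)))).
  by rewrite jn_cp; apply: le_mt; [exact: leB_refl|exact: le_tp].
by rewrite mt_jn; exact: jn_le.
Qed.

Definition ev x a : bool := (set_val x : B -> bool) a.

Lemma evP x : @boolean_character T A le (set_val x).
Proof. by rewrite set_valE; exact/set_mem/(valP x). Qed.

Lemma ev_mt x a b : ev x (mt a b) = ev x a && ev x b.
Proof. by case: (evP x) => + _ _ _; apply. Qed.
Lemma ev_jn x a b : ev x (jn a b) = ev x a || ev x b.
Proof. by case: (evP x) => _ + _ _; apply. Qed.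
Lemma ev_bt x : ev x bt = false. Proof. by case: (evP x) => _ _ + _; apply. Qed.
Lemma ev_tp x : ev x tp = true. Proof. by case: (evP x) => _ _ _; apply. Qed.
Lemma ev_cp x a : ev x (cp a) = ~~ ev x a.
Proof.
have := ev_tp x; rewrite -(jn_cp a) ev_jn; have := ev_bt x; rewrite -(mt_cp a) ev_mt.
by case: (ev x a); case: (ev x (cp a)).
Qed.
Lemma ev_le x a b : leB a b -> ev x a -> ev x b.
Proof. by move=> /mt_idPl <-; rewrite ev_mt => /andP[]. Qed.

Lemma ev_inj x y : (forall a, ev x a = ev y a) -> x = y.
Proof. by move=> xy; apply: val_inj; apply: funext => a; exact: xy. Qed.

Lemma ev_build (F : B -> bool) :
  (forall a b, F (mt a b) = F a && F b) -> (forall a b, F (jn a b) = F a || F b) ->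
  F bt = false -> F tp = true -> exists x, ev x = F.
Proof.
move=> Fm Fj Fb Ft.
have FA : @boolean_character T A le F.
  split.
  - move=> a b m [mA m1 m2]; rewrite -Fm; congr F; apply: leB_anti.
      by apply: le_mt; apply: m1; [left|right].
    apply: m2; first exact: memB.
    by move=> _ [->|->]; [exact: mt_lel|exact: mt_ler].
  - move=> a b m [mA m1 m2]; rewrite -Fj; congr F; apply: leB_anti; last first.
      by apply: jn_le; apply: m1; [left|right].
    apply: m2; first exact: memB.
    by move=> _ [->|->]; [exact: jn_gel|exact: jn_ger].
  - by move=> o [oA o1 o2]; rewrite -Fb; congr F; apply: leB_bt; apply: o2.
  - by move=> o [oA o1 o2]; rewrite -Ft; congr F; apply: leB_anti;
      [exact: le_tp|apply: o2].
by exists (SigSub (mem_set FA)).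
Qed.

Lemma mt_mono a b c d : leB a b -> leB c d -> leB (mt a c) (mt b d).
Proof.
move=> ab cd; apply: le_mt; [exact: leB_trans (mt_lel _ _) ab|].
exact: leB_trans (mt_ler _ _) cd.
Qed.

(** Nonzero elements are detected by characters: a filter that is maximal among
    those whose members all meet [a] is an ultrafilter containing [a]. *)
Lemma ev_separates a : a <> bt -> exists x, ev x a.
Proof.
move=> a0.
pose P := [set F : set B | [/\ forall b c, F b -> F c -> F (mt b c),
  forall b c, leB b c -> F b -> F c & forall b, F b -> mt a b <> bt]].
have [F [[Fm Fu Fa] Fmax]] : exists F, P F /\ forall F', F `<` F' -> ~ P F'.
  apply: Zorn_bigcup => C CP tot; split.
  - move=> b c [F CF Fb] [F' CF' F'c]; have [Fm _ _] := CP F CF.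
    have [Fm' _ _] := CP F' CF'.
    by have [/(_ _ Fb) F'b|/(_ _ F'c) Fc] := tot _ _ CF CF'; [exists F'|exists F] => //;
      [exact: Fm'|exact: Fm].
  - by move=> b c bc [F CF Fb]; exists F => //; have [_ Fu _] := CP F CF; exact: Fu Fb.
  - by move=> b [F CF Fb]; have [_ _ Fa] := CP F CF; exact: Fa.
have Fin e : (forall b, F b \/ b = tp -> mt a (mt b e) <> bt) -> F e.
  move=> Fe; apply: contrapT => nFe.
  pose F' := [set c | exists2 b, F b \/ b = tp & leB (mt b e) c].
  apply: (Fmax F').
    split; last by apply: contra_not nFe => /(_ e); apply; exists tp; [right|exact: mt_ler].
    by move=> b Fb; exists b; [left|exact: mt_lel].
  split.
  - move=> b c [b' hb le1] [c' hc le2].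
    have both d : leB d b' -> leB d c' -> leB (mt d e) (mt b c).
      by move=> db dc; apply: le_mt; [apply: leB_trans le1|apply: leB_trans le2];
        apply: mt_mono => //; exact: leB_refl.
    case: hb hc => [Fb|b1] [Fc|c1].
    + exists (mt b' c'); first by left; exact: Fm.
      by apply: both; [exact: mt_lel|exact: mt_ler].
    + by exists b'; [left|apply: both; [exact: leB_refl|rewrite c1; exact: le_tp]].
    + by exists c'; [left|apply: both; [rewrite b1; exact: le_tp|exact: leB_refl]].
    + by exists b'; [right|apply: both; [|rewrite c1 -b1]; exact: leB_refl].
  - by move=> b c bc [b' hb le1]; exists b' => //; exact: leB_trans bc.
  - move=> b [b' hb le1] ab; apply: (Fe b' hb); apply: leB_bt; rewrite -ab.
    by apply: mt_mono => //; exact: leB_refl.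
have mt_bt b : mt b bt = bt by apply: leB_bt; exact: mt_ler.
have Ftp : F tp.
  apply: Fin => b [/Fa ab|->] h.
    apply: ab; apply: leB_bt; rewrite -h; apply: mt_mono; first exact: leB_refl.
    by apply: le_mt; [exact: leB_refl|exact: le_tp].
  apply: a0; apply: leB_bt; rewrite -h; apply: le_mt; first exact: leB_refl.
  by apply: le_mt; exact: le_tp.
have Fdich e : F e \/ F (cp e).
  apply: contrapT => /not_orP[ne nce].
  have bad d : ~ F d -> exists2 b, F b & mt a (mt b d) = bt.
    move=> nd; apply: contrapT => h; apply: nd; apply: Fin => b hb ab.
    by apply: h; exists b => //; case: hb => // ->.
  have [b Fb ab] := bad _ ne; have [c Fc ac] := bad _ nce.
  apply: (Fa (mt b c)); first exact: Fm.
  apply: (split_cp _ e); rewrite -1?ab -1?ac.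
    apply: le_mt; first exact: leB_trans (mt_lel _ _) (mt_lel _ _).
    by apply: mt_mono; [exact: leB_trans (mt_ler _ _) (mt_lel _ _)|exact: leB_refl].
  rewrite ab -ac; apply: le_mt; first exact: leB_trans (mt_lel _ _) (mt_lel _ _).
  by apply: mt_mono; [exact: leB_trans (mt_ler _ _) (mt_ler _ _)|exact: leB_refl].
have Fbt : ~ F bt by move=> /Fa; rewrite mt_bt.
have disj b : F b -> F (cp b) -> False by move=> Fb Fc; apply: Fbt; rewrite -(mt_cp b); exact: Fm.
have [x xF] : exists x, ev x = fun b => `[< F b >].
  apply: ev_build.
  - move=> b c; apply/asboolP/andP => [Fbc|[/asboolP Fb /asboolP Fc]]; last exact: Fm.
    by split; apply/asboolP; apply: Fu Fbc; [exact: mt_lel|exact: mt_ler].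
  - move=> b c; apply/asboolP/orP => [Fbc|[/asboolP Fb|/asboolP Fc]]; last 2 first.
    + by apply: Fu Fb; exact: jn_gel.
    + by apply: Fu Fc; exact: jn_ger.
    have [Fb|Fb] := Fdich b; first by left; apply/asboolP.
    have [Fc|Fc] := Fdich c; first by right; apply/asboolP.
    exfalso; apply: Fbt; apply: Fu (Fm _ _ (Fm _ _ Fb Fc) Fbc).
    rewrite mt_jn; apply: jn_le.
      by rewrite -(mt_cp b); apply: le_mt; [exact: mt_ler|exact: leB_trans (mt_lel _ _) (mt_lel _ _)].
    by rewrite -(mt_cp c); apply: le_mt; [exact: mt_ler|exact: leB_trans (mt_lel _ _) (mt_ler _ _)].
  - exact/asboolPn.
  - exact/asboolP.
exists x; rewrite xF; apply/asboolP.
by have [//|/Fa] := Fdich a; rewrite mt_cp.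
Qed.

Lemma ev_leP a b : (forall x, ev x a -> ev x b) -> leB a b.
Proof.
move=> ab; apply/mt_idPl.
suff ac : mt a (cp b) = bt.
  apply: leB_anti; first exact: mt_lel.
  apply: (leB_trans (mt a (jn b (cp b)))).
    by rewrite jn_cp; apply: le_mt; [exact: leB_refl|exact: le_tp].
  by rewrite mt_jn ac; apply: jn_le; [exact: leB_refl|exact: bt_le].
apply: contrapT => /ev_separates[x]; rewrite ev_mt ev_cp => /andP[xa /negP].
by apply; exact: ab.
Qed.

Lemma ev_eqP a b : (forall x, ev x a = ev x b) -> a = b.
Proof. by move=> ab; apply: leB_anti; apply: ev_leP => x; rewrite ab. Qed.

Definition clopen_of a : set X := [set x | ev x a].

Local Notation Y := {ptws B -> bool}.

Lemma ev_continuous a : continuous (fun x : X => ev x a).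
Proof.
move=> x; apply: (@continuous_comp X Y bool (fun x : X => (set_val x : Y))
  (fun f : Y => f a)); first exact: initial_continuous.
exact: (@proj_continuous {classic B} (fun _ => bool) a).
Qed.

Lemma clopen_of_open a : open (clopen_of a).
Proof.
rewrite (_ : clopen_of a = (fun x : X => ev x a) @^-1` [set true]); last first.
  by apply/seteqP; split.
by apply: open_comp; [move=> x _; exact: ev_continuous|exact: discrete_open].
Qed.

Lemma clopen_ofC a : ~` clopen_of a = clopen_of (cp a).
Proof. by apply/seteqP; split=> x; rewrite /clopen_of /= ev_cp => /negP. Qed.

Lemma clopen_of_closed a : closed (clopen_of a).
Proof.
rewrite -[clopen_of a]setCK; apply: open_closedC; rewrite clopen_ofC.
exact: clopen_of_open.
Qed.

Lemma stone_hausdorff : hausdorff_space X.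
Proof.
rewrite open_hausdorff => x y xy.
have [a xya] : exists a, ev x a <> ev y a.
  by apply/existsNP => h; move/eqP: xy; apply; exact: ev_inj.
wlog xa : x y xy xya / ev x a.
  move=> W; case: (boolP (ev x a)) => xa; first exact: W.
  have ya : ev y a by move: xya xa; case: (ev x a); case: (ev y a).
  rewrite eq_sym in xy; have [|[U V] /= [? ?] [? ? ?]] := W y x xy _ ya.
    by move=> e; apply: xya.
  by exists (V, U) => //=; split => //; rewrite setIC.
exists (clopen_of a, clopen_of (cp a)) => /=.
  by split; apply/mem_set => //=; rewrite /clopen_of /= ev_cp; move: xya; rewrite xa; case: (ev y a).
split; try exact: clopen_of_open.
by rewrite -clopen_ofC setICr.
Qed.

(** The characters form a closed subset of a product of copies of [bool]. *)
Lemma stone_compact : compact [set: X].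
Proof.
have K0 : compact [set f : Y | forall a, [set: bool] (f a)].
  apply: (@tychonoff {classic B} (fun _ => bool) (fun _ => setT)) => _.
  exact: bool_compact.
pose K : set Y := [set f : Y | [/\ forall a b, f (mt a b) = f a && f b,
   forall a b, f (jn a b) = f a || f b, f bt = false & f tp = true]].
have cl (a : B) (b : bool) : closed [set f : Y | f a = b].
  apply: (@closed_comp Y bool (fun f : Y => f a) [set b]); last exact: discrete_closed.
  by move=> f _; exact: (@proj_continuous {classic B} (fun _ => bool) a).
have clK : closed K.
  rewrite (_ : K = \bigcap_(ab in [set: B * B])
     ((([set f | f (mt ab.1 ab.2) = true] `&` [set f | f ab.1 = true] `&` [set f | f ab.2 = true]) `|`
      ([set f | f (mt ab.1 ab.2) = false] `&` ([set f | f ab.1 = false] `|` [set f | f ab.2 = false]))) `&`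
     (([set f | f (jn ab.1 ab.2) = false] `&` [set f | f ab.1 = false] `&` [set f | f ab.2 = false]) `|`
      ([set f | f (jn ab.1 ab.2) = true] `&` ([set f | f ab.1 = true] `|` [set f | f ab.2 = true])))) `&`
     ([set f | f bt = false] `&` [set f | f tp = true])).
    apply: closedI; last by apply: closedI; [apply: (cl bt)|apply: (cl tp)].
    by apply: closed_bigI => ab _; apply: closedI; apply: closedU; repeat apply: closedI;
      try apply: closedU; apply: cl.
  apply/seteqP; split=> f /=.
    move=> [fm fj fb ft]; split=> // -[a b] _ /=; rewrite fm fj.
    by case: (f a); case: (f b); split; solve [by left|by right; split=> //; left|by right; split=> //; right].
  move=> [h [fb ft]]; split=> // a b; case: (h (a, b) I) => /=.
    by move=> [[[-> ->] ->]//|[-> [->|->]]]; rewrite ?andbF.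
  by move=> _ [[[-> ->] ->]//|[-> [->|->]]]; rewrite ?orbT.
have cK : compact K by apply: subclosed_compact clK K0 _.
move=> F PF _.
pose G : set_system Y := fmap (fun x : X => (set_val x : Y)) F.
have PG : ProperFilter G by exact: fmap_proper_filter.
have GK : G K.
  apply: (@filterS _ F _ setT) (filterT : F setT) => x _ /=.
  by split; [exact: ev_mt|exact: ev_jn|exact: ev_bt|exact: ev_tp].
have [p [Kp clp]] := cK G PG GK.
have [x xp] : exists x, ev x = p by case: Kp => *; exact: ev_build.
exists x; split=> // S V FS; rewrite nbhsE => -[_ [[W oW <-] Wx] WV].
have GS : G [set (set_val s : Y) | s in S] by apply: (@filterS X F _ S) FS => s Ss; exists s.
have nW : nbhs (p : Y) W by rewrite nbhsE; exists W => //; split=> //; rewrite -xp.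
have [_ [[s Ss <-] Ws]] := clp _ _ GS nW.
by exists s; split=> //; exact: WV.
Qed.

(** The clopen sets that avoid [x] are directed and cover the compact set [~` W],
    so one of them contains it. *)
Lemma stone_basis (W : set X) x : open W -> W x ->
  exists2 a, ev x a & clopen_of a `<=` W.
Proof.
move=> oW Wx.
have cW : compact (~` W).
  by apply: subclosed_compact stone_compact _ => //; exact: open_closedC.
have [||||a xa aW] := compact_directed_cover _ _ _ [set a | ~~ ev x a] clopen_of cW.
- by exists bt; rewrite /= ev_bt.
- by move=> a _; exact: clopen_of_open.
- move=> a b /= xa xb; exists (jn a b); split; first by rewrite /= ev_jn negb_or xa.
    by move=> y; rewrite /clopen_of /= ev_jn => ->.
  by move=> y; rewrite /clopen_of /= ev_jn => ->; rewrite orbT.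
- move=> y Wy; have [a xya] : exists a, ev x a <> ev y a.
    by apply/existsNP => h; apply: Wy; rewrite -(ev_inj x y).
  have [xa|xa] := boolP (ev x a).
    exists (cp a) => /=; rewrite /clopen_of/= ev_cp ?xa//.
    by move: xya; rewrite xa; case: (ev y a).
  by exists a => //; rewrite /clopen_of/=; move: xya; rewrite (negbTE xa); case: (ev y a).
exists (cp a); first by rewrite ev_cp.
move=> y; rewrite /clopen_of /= ev_cp => /negP ya; apply: contrapT => /aW.
exact: ya.
Qed.

Definition is_sup (D : set B) e :=
  (forall a, D a -> leB a e) /\ (forall f, (forall a, D a -> leB a f) -> leB e f).

Lemma clopen_of_sub a b : clopen_of a `<=` clopen_of b <-> leB a b.
Proof. by split=> [h|ab x]; [exact: ev_leP|exact: ev_le]. Qed.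

Lemma disjoint_cp a b : mt a b = bt -> leB a (cp b).
Proof.
move=> ab; apply: ev_leP => x xa; rewrite ev_cp; apply/negP => xb.
by have := ev_bt x; rewrite -ab ev_mt xa xb.
Qed.

(** If a basic neighbourhood [clopen_of b] is disjoint from [U], then [cp b] is an
    upper bound of the elements inside [U]; hence [clopen_of b] misses
    [clopen_of e]. *)
Lemma clopen_of_closure (U : set X) e : open U ->
  is_sup [set a | clopen_of a `<=` U] e -> closure U = clopen_of e.
Proof.
move=> oU [ub lub]; apply/seteqP; split.
  have -> : clopen_of e = closure (clopen_of e) by apply/closure_id/clopen_of_closed.
  apply: closureS => x Ux; have [a xa aU] := stone_basis U x oU Ux.
  exact: (ev_le _ _ _ (ub a aU)).
move=> x xe V; rewrite nbhsE => -[W [oW Wx] WV].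
have [b xb bW] := stone_basis W x oW Wx.
apply: contrapT => UV.
have : leB e (cp b).
  apply: lub => a aU; apply: disjoint_cp; apply: contrapT => /ev_separates[y].
  rewrite ev_mt => /andP[ya yb]; apply: UV; exists y; split; first exact: aU.
  exact/WV/bW.
by move=> /ev_le/(_ xe); rewrite ev_cp xb.
Qed.

Hypothesis complete : forall D : set B, exists e, is_sup D e.

Lemma stone_stonean : stonean X.
Proof.
split; [exact: stone_compact|exact: stone_hausdorff|move=> U oU].
have [e supe] := complete [set a | clopen_of a `<=` U].
by rewrite (clopen_of_closure _ _ oU supe); exact: clopen_of_open.
Qed.

Definition directed (D : set B) :=
  D !=set0 /\ forall a b, D a -> D b -> exists c, [/\ D c, leB a c & leB b c].

Section Weight.
Context (R : realType) (w : B -> R).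
Hypothesis w_ge0 : forall a, 0 <= w a.
Hypothesis w_jn : forall a b, mt a b = bt -> w (jn a b) = w a + w b.
Hypothesis w_normal : forall D e, directed D -> is_sup D e ->
  forall eps, 0 < eps -> exists2 a, D a & w e <= w a + eps.

Lemma weight_split a b : w a = w (mt a b) + w (mt a (cp b)).
Proof.
rewrite -w_jn; last first.
  by apply: ev_eqP => x; rewrite !ev_mt ev_bt ev_cp; case: (ev x a); case: (ev x b).
by congr w; apply: ev_eqP => x; rewrite ev_jn !ev_mt ev_cp; case: (ev x a); case: (ev x b).
Qed.

Lemma weight_mono a b : leB a b -> w a <= w b.
Proof.
move=> ab; rewrite (weight_split b a) (_ : mt b a = a) ?lerDl//.
apply: ev_eqP => x; rewrite ev_mt; case: (boolP (ev x a)) => [/(ev_le _ _ _ ab)->//|].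
by rewrite andbF.
Qed.

Lemma weight_bt : w bt = 0.
Proof.
have := weight_split bt bt; rewrite (_ : mt bt bt = bt); last first.
  by apply: leB_bt; exact: mt_lel.
rewrite (_ : mt bt (cp bt) = bt); last by apply: leB_bt; exact: mt_lel.
by move/esym/eqP; rewrite -subr_eq0 addrK => /eqP.
Qed.

Lemma weight_jn a b : w (jn a b) <= w a + w b.
Proof.
rewrite (weight_split _ a); apply: lerD; apply: weight_mono; apply: ev_leP => x.
  by rewrite ev_mt => /andP[].
by rewrite ev_mt ev_jn ev_cp; case: (ev x a); case: (ev x b).
Qed.

Lemma weight_big (s : seq nat) (a : nat -> B) :
  w (\big[jn/bt]_(i <- s) a i) <= \sum_(i <- s) w (a i).
Proof.
elim: s => [|i s IH]; first by rewrite !big_nil weight_bt.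
by rewrite !big_cons; apply: le_trans (weight_jn _ _) _; rewrite lerD2l.
Qed.

Variable x0 : X.
Local Notation P := (based x0).

(** The outer measure induced by the values of the weight on clopen sets. *)
Definition weight_outer (V : set P) : \bar R :=
  ereal_inf [set (w e)%:E | e in [set e | V `<=` clopen_of e]].

Lemma weight_outer_le V e : V `<=` clopen_of e -> (weight_outer V <= (w e)%:E)%E.
Proof. by move=> Ve; apply: ereal_inf_lbound; exists e. Qed.

Lemma weight_outer_ge0 V : (0 <= weight_outer V)%E.
Proof. by apply: le_ereal_inf_tmp => _ [e _ <-]; rewrite lee_fin. Qed.

Lemma weight_outer_fin V : weight_outer V \is a fin_num.
Proof.
rewrite ge0_fin_numE ?weight_outer_ge0//; apply: le_lt_trans (ltry (w tp)).
by apply: weight_outer_le => x _; exact: ev_tp.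
Qed.

Lemma weight_outer_adherent V (eps : R) : 0 < eps ->
  exists2 e, V `<=` clopen_of e & ((w e)%:E <= weight_outer V + eps%:E)%E.
Proof.
move=> eps0; have [_ [e Ve <-] /ltW h] := lb_ereal_inf_adherent eps0 (weight_outer_fin V).
by exists e.
Qed.

Lemma weight_outer_clopen e : weight_outer (clopen_of e) = (w e)%:E.
Proof.
apply/eqP; rewrite eq_le weight_outer_le//=.
by apply: le_ereal_inf_tmp => _ [f /clopen_of_sub ef <-]; rewrite lee_fin weight_mono.
Qed.

Lemma weight_outer0 : weight_outer set0 = 0%E.
Proof.
apply/eqP; rewrite eq_le weight_outer_ge0 andbT -[leRHS]/(0%:E) -weight_bt.
exact: weight_outer_le.
Qed.

Lemma le_weight_outer : {homo weight_outer : U V / U `<=` V >-> (U <= V)%E}.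
Proof.
move=> U V UV; apply: le_ereal_inf_tmp => _ [e Ve <-].
by apply: weight_outer_le; exact: subset_trans Ve.
Qed.

(** Countable subadditivity: if [e] is the supremum of covering elements [a i],
    normality approximates [w e] by the weights of finite joins of the [a i]. *)
Lemma weight_outer_sigma_subadditive : sigma_subadditive weight_outer.
Proof.
move=> F; apply/lee_addgt0Pr => eps eps0.
pose d := eps / 2; have d0 : 0 < d by rewrite divr_gt0.
have [a aP] : {a : nat -> B & forall n, F n `<=` clopen_of (a n) /\
    ((w (a n))%:E <= weight_outer (F n) + (d / (2 ^ n.+1)%:R)%:E)%E}.
  apply: (@choice _ _ (fun n (e : B) => F n `<=` clopen_of e /\
    ((w e)%:E <= weight_outer (F n) + (d / (2 ^ n.+1)%:R)%:E)%E)) => n.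
  have dn : 0 < d / (2 ^ n.+1)%:R by rewrite divr_gt0// ltr0n expn_gt0.
  by have [e Ve we] := weight_outer_adherent (F n) _ dn; exists e.
pose D := [set \big[jn/bt]_(i <- s) a i | s in [set: seq nat]].
have ev_big x s : ev x (\big[jn/bt]_(i <- s) a i) = has (fun i => ev x (a i)) s.
  elim: s => [|i s IH]; first by rewrite big_nil ev_bt.
  by rewrite big_cons ev_jn IH.
have dirD : directed D.
  split; first by exists (\big[jn/bt]_(i <- [::]) a i); exists [::].
  move=> _ _ [s _ <-] [t _ <-]; exists (\big[jn/bt]_(i <- s ++ t) a i).
  by split; [exists (s ++ t)| |]; try (apply: ev_leP => x; rewrite !ev_big has_cat => ->);
    rewrite ?orbT.
have [e supe] := complete D; have [ub _] := supe.
have [_ [s _ <-] we] := w_normal D e dirD supe d d0.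
apply: (le_trans (weight_outer_le _ e _)).
  move=> x [n _ Fx]; have := (aP n).1 x Fx; apply: (@ev_le x).
  have -> : a n = \big[jn/bt]_(i <- [:: n]) a i.
    by apply: ev_eqP => y; rewrite ev_big /= orbF.
  by apply: ub; exists [:: n].
pose N := (\max_(i <- s) i).+1.
have ws : (w (\big[jn/bt]_(i <- s) a i) <= \sum_(0 <= i < N) w (a i)).
  apply: le_trans (weight_big (index_iota 0 N) a).
  apply: weight_mono; apply: ev_leP => x; rewrite !ev_big => /hasP[i si xi].
  apply/hasP; exists i => //; rewrite mem_index_iota /N /= ltnS.
  by rewrite (big_rem i) //= leq_maxl.
apply: (@le_trans _ _ ((\sum_(0 <= i < N) w (a i))%:E + d%:E)%E).
  by rewrite -EFinD lee_fin; apply: le_trans we _; rewrite lerD2r.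
have -> : eps%:E = (d%:E + d%:E)%E by rewrite -EFinD -splitr.
rewrite addeA leeD2r//; apply: le_trans (epsilon_trick _ _ (ltW d0)); last first.
  by move=> n; exact: weight_outer_ge0.
rewrite -sumEFin; apply: (@le_trans _ _ (\sum_(0 <= i < N)
    (weight_outer (F i) + (d / (2 ^ i.+1)%:R)%:E))%E).
  by apply: lee_sum => i _; exact: (aP i).2.
apply: nneseries_lim_ge => i _ _; rewrite adde_ge0 ?weight_outer_ge0// lee_fin.
by rewrite divr_ge0// ltW.
Qed.

HB.instance Definition _ := isOuterMeasure.Build R P weight_outer weight_outer0
  weight_outer_ge0 le_weight_outer weight_outer_sigma_subadditive.

(** Open sets are measurable: by normality an open set [U] contains clopen sets
    of weight arbitrarily close to that of its closure. *)
Lemma open_caratheodory (U : set X) : open U ->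
  caratheodory_measurable weight_outer (U : set P).
Proof.
move=> oU; apply: le_caratheodory_measurable => V.
pose D := [set a | clopen_of a `<=` U].
have [f supf] := complete D; have clU := clopen_of_closure U f oU supf.
have dirD : directed D.
  split; first by exists bt => x; rewrite /clopen_of /= ev_bt.
  move=> a b aU bU; exists (jn a b); split; [|exact: jn_gel|exact: jn_ger].
  by move=> x; rewrite /clopen_of/= ev_jn => /orP[/aU|/bU].
apply/lee_addgt0Pr => eps eps0; pose d := eps / 2.
have d0 : 0 < d by rewrite divr_gt0.
have [e Ve we] := weight_outer_adherent V d d0.
have [a aU wa] := w_normal D f dirD supf d d0.
have af : leB a f by case: supf => + _; apply.
apply: (@le_trans _ _ ((w (mt e f))%:E + (w (mt e (cp a)))%:E)%E).
  apply: leeD; apply: weight_outer_le => x [Vx Ux]; rewrite /clopen_of/= ev_mt.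
    rewrite (Ve x Vx); have : closure U x by exact: subset_closure.
    by rewrite clU.
  by rewrite (Ve x Vx) ev_cp/=; apply/negP => /aU.
have -> : eps%:E = (d%:E + d%:E)%E by rewrite -EFinD -splitr.
rewrite addeA; apply: le_trans (leeD2r d%:E we).
rewrite -!EFinD lee_fin.
have h1 := weight_split (mt e f) a; have h2 := weight_split e a.
have h3 : w (mt (mt e f) a) <= w (mt e a).
  by apply: weight_mono; apply: ev_leP => x; rewrite !ev_mt => /andP[/andP[-> _] ->].
have h4 : w (mt (mt e f) (cp a)) <= w (mt f (cp a)).
  by apply: weight_mono; apply: ev_leP => x; rewrite !ev_mt => /andP[/andP[_ ->] ->].
have h5 := weight_split f a.
have h6 : mt f a = a.
  by apply: leB_anti; [exact: mt_ler|apply: le_mt => //; exact: leB_refl].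
by rewrite h6 in h5; lra.
Qed.

Lemma borel_caratheodory (V : set (borel x0)) : measurable V ->
  caratheodory_measurable weight_outer (V : set P).
Proof.
move: V; apply: smallest_sub; last by move=> U; exact: open_caratheodory.
split.
- exact: caratheodory_measurable_set0.
- by move=> V mV; rewrite setTD; exact: caratheodory_measurable_setC.
- by move=> F mF; exact: caratheodory_measurable_bigcup.
Qed.

Definition weight_measure : set (borel x0) -> \bar R := weight_outer.

Lemma weight_measure_sigma_additive : semi_sigma_additive weight_measure.
Proof.
move=> F mF tF mU.
exact: (@caratheodory_measure_sigma_additive R P weight_outer F
  (fun i => borel_caratheodory _ (mF i)) tF (borel_caratheodory _ mU)).
Qed.

HB.instance Definition _ := isMeasure.Build _ (borel x0) R weight_measure
  weight_outer0 weight_outer_ge0 weight_measure_sigma_additive.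
HB.instance Definition _ := @Measure_isFinite.Build _ (borel x0) R weight_measure
  (fun V _ => weight_outer_fin V).

Lemma weight_measure_clopen e : weight_measure (clopen_of e) = (w e)%:E.
Proof. exact: weight_outer_clopen. Qed.

Lemma clopen_of_measurable e : measurable (clopen_of e : set (borel x0)).
Proof. by apply: sub_sigma_algebra; exact: clopen_of_open. Qed.

(** Approximating the complement of [V] from outside by clopen sets approximates
    [V] from inside by compact ones. *)
Lemma weight_measure_radon : radon weight_measure.
Proof.
move=> V mV; apply/eqP; rewrite eq_le; apply/andP; split; last first.
  by apply: ge_ereal_sup => _ [K [_ KV] <-]; exact: le_weight_outer.
apply/lee_addgt0Pr => eps eps0.
have [e Ve we] := weight_outer_adherent (~` V) eps eps0.
have cpV : clopen_of (cp e) `<=` V.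
  by rewrite -clopen_ofC => x xe; apply: contrapT => /Ve.
apply: (@le_trans _ _ ((w (cp e))%:E + eps%:E)%E); last first.
  rewrite leeD2r// -weight_measure_clopen; apply: ereal_sup_ubound.
  exists (clopen_of (cp e)) => //; split=> //.
  by apply: subclosed_compact stone_compact _ => //; exact: clopen_of_closed.
have total : (weight_outer V + weight_outer (~` V) = (w (cp e))%:E + (w e)%:E)%E.
  have := borel_caratheodory V mV setT; rewrite !setTI => <-.
  rewrite (_ : setT = clopen_of tp); last first.
    by apply/seteqP; split=> x // _; exact: ev_tp.
  rewrite weight_outer_clopen (weight_split tp e) -EFinD addrC.
  by congr (_%:E); congr (w _ + w _); apply: ev_eqP => x; rewrite ev_mt ev_tp.
have fv := weight_outer_fin (~` V).
rewrite -[leLHS]/(weight_outer V) -(leeD2rE _ _ fv) total -addeA leeD2l//.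
by rewrite addeC.
Qed.

Lemma continuous_bounded (g : X -> R) : continuous g ->
  exists2 C, 0 <= C & forall x, `|g x| <= C.
Proof.
move=> cg; have [||||n _ gn] := compact_directed_cover X setT nat setT
    (fun n => [set x | `|g x| < n%:R]) stone_compact.
- by exists 0%N.
- move=> n _; rewrite (_ : [set x | _] = (fun x => `|g x|) @^-1` [set r | r < n%:R])//.
  apply: open_comp; last exact: open_lt.
  by move=> x _; apply: continuous_comp; [exact: cg|exact: norm_continuous].
- move=> i j _ _; exists (maxn i j); split=> // x /= h; apply: lt_le_trans h _;
    by rewrite ler_nat ?leq_maxl ?leq_maxr.
- move=> x _; exists (Num.truncn `|g x|).+1 => //=.
  by have /andP[] := truncn_itv (normr_ge0 (g x)).
by exists n%:R => // x; apply/ltW/gn.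
Qed.

Lemma continuous_borel_measurable (g : X -> R) : continuous g ->
  measurable_fun [set: borel x0] (g : borel x0 -> R).
Proof.
move=> cg; apply: (measurability _ (RGenOpens.measurableE R)).
move=> _ [_ [a [b ->] <-]]; rewrite setTI; apply: sub_sigma_algebra.
by apply: open_comp => [x _|]; [exact: cg|exact: interval_open].
Qed.

Lemma continuous_integrable (g : X -> R) : continuous g ->
  weight_measure.-integrable [set: borel x0] (EFin \o (g : borel x0 -> R)).
Proof.
move=> cg; apply: measurable_bounded_integrable => //.
- by rewrite -ge0_fin_numE ?weight_outer_ge0//; exact: weight_outer_fin.
- exact: continuous_borel_measurable.
- have [C C0 gC] := continuous_bounded g cg.
  by exists C; split=> [|M CM x _ /=]; rewrite ?num_real//; apply: le_trans (ltW CM).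
Qed.

(** The supremum [g] of a directed family in [C(X)] is approached within [d],
    uniformly by one member, on a clopen set of almost full weight: the points where
    some member exceeds [g - d] form a dense open set. *)
Lemma weight_measure_normal : normal_measure weight_measure.
Proof.
move=> F g [f0 Ff0] Fc dirF [cg gub glub].
have intF f : F f -> weight_measure.-integrable setT (EFin \o (f : borel x0 -> R)).
  by move=> Ff; apply/continuous_integrable/Fc.
have intg := continuous_integrable g cg.
apply/eqP; rewrite eq_le; apply/andP; split; last first.
  apply: ge_ereal_sup => _ [f Ff <-]; apply: le_integral => //; first exact: intF.
  by move=> x _; rewrite lee_fin; exact: gub.
apply/lee_addgt0Pr => eps eps0.
have [C1 C10 gC] := continuous_bounded g cg.
have [C2 C20 fC] := continuous_bounded f0 (Fc _ Ff0).
pose c := C1 + C2; have c0 : 0 <= c by exact: addr_ge0.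
have W0 := w_ge0 tp.
pose d := eps / 2 / (w tp + 1).
have d0 : 0 < d by rewrite !divr_gt0// ltr_wpDl.
pose e1 := eps / 2 / (c + 1).
have e10 : 0 < e1 by rewrite !divr_gt0// ltr_wpDl.
pose good f := [set x | g x - d < f x].
have ogood f : F f -> open (good f).
  move=> Ff; rewrite (_ : good f = (fun x => f x - g x) @^-1` [set r | - d < r]).
    apply: open_comp; last exact: open_gt.
    have cf : continuous f := Fc f Ff.
    by move=> x _; apply: (@continuousB _ _ _ f g x); [exact: cf|exact: cg].
  by apply/seteqP; split=> x; rewrite /good /=; lra.
pose U := \bigcup_(f in F) good f.
have oU : open U by apply: bigcup_open => f Ff; exact: ogood.
pose D := [set a | clopen_of a `<=` U].
have sup1 : is_sup D tp.
  split=> [a _|b Db]; first exact: le_tp.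
  apply: contrapT => nb.
  have [x] : exists x, ev x (cp b).
    apply: ev_separates => cb; apply: nb; apply: ev_leP => x _.
    by rewrite -[ev x b]negbK -ev_cp cb ev_bt.
  move=> xb.
  (* otherwise g could be lowered by d on the clopen set of cp b *)
  pose g' y := if ev y b then g y else g y - d.
  have cg' : continuous g'.
    move=> y; rewrite /continuous_at; have [yb|yb] := boolP (ev y b).
      have -> : g' y = g y by rewrite /g' yb.
      apply: (@cvg_trans _ (g @ y)); last exact: cg.
      apply: (@near_eq_cvg _ _ (nbhs y) (nbhs_filter y) g g'); near=> z.
      rewrite /g'; suff -> : ev z b by [].
      by near: z; apply: open_nbhs_nbhs; split=> //; exact: clopen_of_open.
    have -> : g' y = g y - d by rewrite /g' (negbTE yb).
    apply: (@cvg_trans _ ((fun z => g z - d) @ y)); last first.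
      by apply: (@continuousB _ _ _ g (fun=> d) y); [exact: cg|exact: cst_continuous].
    apply: (@near_eq_cvg _ _ (nbhs y) (nbhs_filter y) (fun z => g z - d) g'); near=> z.
    rewrite /g'; suff -> : ev z b = false by [].
    apply/negbTE; rewrite -ev_cp; near: z; apply: open_nbhs_nbhs; split=> /=.
      exact: clopen_of_open.
    by rewrite /clopen_of /= ev_cp.
  have := glub g' cg' _ x; rewrite /g' -[ev x b]negbK -ev_cp xb /=.
  suff h : forall f, F f -> forall y, f y <= g' y by move=> /(_ h); lra.
  move=> f Ff y; rewrite /g'; case: ifPn => yb; first exact: gub.
  rewrite leNgt; apply/negP => fy.
  have [a ya aU] := stone_basis U y oU (ex_intro2 _ _ f Ff fy).
  by move/negP: yb; apply; exact: (ev_le _ _ _ (Db a aU)).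
have dirD : directed D.
  split; first by exists bt => x; rewrite /clopen_of /= ev_bt.
  move=> a b aU bU; exists (jn a b); split; [|exact: jn_gel|exact: jn_ger].
  by move=> x; rewrite /clopen_of/= ev_jn => /orP[/aU|/bU].
have [a aU wa] := w_normal D tp dirD sup1 e1 e10.
have wca : w (cp a) <= e1.
  have := weight_split tp a; rewrite (_ : mt tp a = a) 1?(_ : mt tp (cp a) = cp a).
  - by lra.
  - by apply: ev_eqP => x; rewrite ev_mt ev_tp.
  - by apply: ev_eqP => x; rewrite ev_mt ev_tp.
have [f [Ff f0f gf]] : exists f, [/\ F f, forall x, f0 x <= f x &
    forall x, ev x a -> g x - d < f x].
  have ca : compact (clopen_of a).
    by apply: subclosed_compact stone_compact _ => //; exact: clopen_of_closed.
  have [||||f [Ff f0f] af] := compact_directed_cover X _ (X -> R)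
      [set f | F f /\ forall x, f0 x <= f x] good ca.
  - by exists f0.
  - by move=> f [Ff _]; exact: ogood.
  - move=> f1 f2 [Ff1 h1] [Ff2 h2]; have [f3 Ff3 f3P] := dirF _ _ Ff1 Ff2.
    exists f3; split.
    + by split=> // x; apply: le_trans (h1 x) _; case: (f3P x).
    + by move=> x /= h; apply: lt_le_trans h _; case: (f3P x).
    + by move=> x /= h; apply: lt_le_trans h _; case: (f3P x).
  - move=> x /aU [f1 Ff1 gf1]; have [f3 Ff3 f3P] := dirF _ _ Ff0 Ff1.
    exists f3; first by split=> // y; case: (f3P y).
    by apply: lt_le_trans gf1 _; case: (f3P x).
  by exists f; split=> // x xa; exact: af.
apply: (@le_trans _ _ (\int[weight_measure]_x (f x)%:E + eps%:E)%E); last first.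
  by rewrite leeD2r//; apply: ereal_sup_ubound; exists f.
pose A' : set (borel x0) := clopen_of (cp a).
have mA' : measurable A' by exact: clopen_of_measurable.
pose h (x : borel x0) := (d%:E + c%:E * (\1_A' x)%:E)%E.
have inth1 : weight_measure.-integrable setT (EFin \o cst d : borel x0 -> \bar R).
  exact: finite_measure_integrable_cst.
have inti : weight_measure.-integrable setT (fun x : borel x0 => (\1_A' x)%:E).
  exact: integrable_indic.
have inth2 : weight_measure.-integrable setT (fun x : borel x0 => (c%:E * (\1_A' x)%:E)%E).
  exact: integrableZl.
have inth : weight_measure.-integrable setT h by exact: integrableD.
apply: (@le_trans _ _ (\int[weight_measure]_x ((f x)%:E + h x))%E).
  apply: le_integral => //; first by apply: integrableD => //; exact: intF.
  move=> x _; rewrite /h -EFinM -!EFinD lee_fin indicE.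
  have [xa|xa] := boolP (ev x a).
    have -> : (x \in A') = false.
      by apply/negbTE/negP => /set_mem; rewrite /A' /clopen_of /= ev_cp xa.
    by rewrite mulr0 addr0; have := gf x xa; lra.
  have -> : (x \in A') = true by apply/mem_set; rewrite /A' /clopen_of /= ev_cp.
  rewrite mulr1; have := f0f x; have := gC x; have := fC x; rewrite /c.
  by rewrite !ler_norml => /andP[] + _ /andP[]; lra.
rewrite (integralD _ (intF f Ff) inth)//; apply: leeD2l.
have intd : (\int[weight_measure]_x (EFin \o cst d : borel x0 -> \bar R) x =
    d%:E * weight_measure [set: borel x0])%E.
  exact: (integral_cst weight_measure measurableT d%:E).
rewrite /h (integralD _ inth1 inth2)// intd (integralZl _ inti)//.
rewrite integral_indic// setIT.
rewrite [X in (d%:E * X)%E](_ : _ = (w tp)%:E); last first.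
  rewrite (_ : [set: borel x0] = clopen_of tp); first exact: weight_outer_clopen.
  by apply/seteqP; split=> x // _; exact: ev_tp.
rewrite [X in (c%:E * X)%E](_ : _ = (w (cp a))%:E); last exact: weight_outer_clopen.
rewrite -!EFinM -EFinD lee_fin.
have frac t : 0 <= t -> eps / 2 / (t + 1) * t <= eps / 2.
  move=> t0; have t1 : 0 < t + 1 by lra.
  by rewrite mulrAC ler_pdivrMr// ler_wpM2l ?divr_ge0 ?ltW//; lra.
have h1 : d * w tp <= eps / 2 by exact: frac.
have h2 : c * w (cp a) <= eps / 2.
  by apply: le_trans (frac c c0); rewrite mulrC ler_wpM2r.
by rewrite [leRHS](splitr eps) lerD.
Unshelve. all: by end_near. Qed.

Lemma weight_measure_pos (f : X -> R) (eps : R) a : continuous f ->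
  (forall x, 0 <= f x) -> 0 < eps -> (forall x, ev x a -> eps <= f x) ->
  0 < w a -> (\int[weight_measure]_x (f x)%:E)%E <> 0%E.
Proof.
move=> cf f0 eps0 fa wa; apply/eqP; rewrite gt_eqF//.
apply: (@lt_le_trans _ _ (eps%:E * (w a)%:E)%E).
  by rewrite -EFinM lte_fin mulr_gt0.
have ma := clopen_of_measurable a.
have inti : weight_measure.-integrable setT
    (fun x : borel x0 => (\1_(clopen_of a : set (borel x0)) x)%:E).
  exact: integrable_indic.
rewrite -weight_measure_clopen -[X in weight_measure X]setIT -integral_indic//.
rewrite -(integralZl _ inti)//; apply: le_integral => //.
- exact: integrableZl.
- exact: continuous_integrable.
move=> x _; rewrite -EFinM lee_fin indicE.
case: (boolP (x \in _)) => [/set_mem|_]; last by rewrite mulr0.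
by rewrite mulr1; exact: fa.
Qed.

Lemma weight_measure_exists (f : X -> R) eps a : continuous f ->
  (forall x, 0 <= f x) -> 0 < eps -> (forall x, ev x a -> eps <= f x) ->
  0 < w a -> exists mu : {finite_measure set (borel x0) -> \bar R},
    [/\ radon mu, normal_measure mu & (\int[mu]_x (f x)%:E)%E <> 0%E].
Proof.
move=> cf f0 eps0 fa wa; exists weight_measure; split.
- exact: weight_measure_radon.
- exact: weight_measure_normal.
- exact: weight_measure_pos fa wa.
Qed.

End Weight.

End CharacterSpace.

Section Hyperstonean.
Context {T : Type} (A : set T) (le : T -> T -> Prop) (R : realType).

(** A finite, additive and order continuous weight, expressed by the order alone:
    elements are disjoint when their infimum is the least element. *)
Definition normal_weight (w : T -> R) :=
  [/\ forall a, A a -> 0 <= w a,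
      forall a b o j, A a -> A b -> is_lub A le set0 o ->
        is_glb A le [set a; b] o -> is_lub A le [set a; b] j -> w j = w a + w b
    & forall D e, D `<=` A -> D !=set0 ->
        (forall a b, D a -> D b -> exists c, [/\ D c, le a c & le b c]) ->
        is_lub A le D e ->
        forall eps, 0 < eps -> exists2 a, D a & w e <= w a + eps].

(** A complete Boolean algebra whose nonzero elements are detected by finite normal
    weights is the algebra of clopen sets of a hyperstonean space: each weight
    extends to a normal Radon measure on the Stone space. *)
Lemma hyperstonean_stone_space : boolean_algebra A le ->
  (forall D, D `<=` A -> exists e, is_lub A le D e) ->
  (forall a, A a -> ~ is_lub A le set0 a ->
     exists2 w, normal_weight w & 0 < w a) ->
  hyperstonean R (stone_space A le).
Proof.
move=> [[po glbA] lubA distr [bot [top [botP topP compl]]]] complete sep.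
pose B := set_type A.
have memB (a : B) : A (set_val a) by rewrite set_valE; exact/set_mem/(valP a).
have toB (a : T) : A a -> {b : B | set_val b = a}.
  by move=> Aa; exists (SigSub (mem_set Aa)).
have lub_uniq D x y : is_lub A le D x -> is_lub A le D y -> x = y.
  by case: po => _ anti _ [Ax x1 x2] [Ay y1 y2]; apply: anti => //; [exact: x2|exact: y2].
have glb_uniq D x y : is_glb A le D x -> is_glb A le D y -> x = y.
  by case: po => _ anti _ [Ax x1 x2] [Ay y1 y2]; apply: anti => //; [exact: y2|exact: x2].
have [mt mtP] : {mt : B * B -> B & forall ab,
    is_glb A le [set set_val ab.1; set_val ab.2] (set_val (mt ab))}.
  apply: (@choice _ _ (fun (ab : B * B) (m : B) =>
    is_glb A le [set set_val ab.1; set_val ab.2] (set_val m))) => -[a b] /=.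
  have [m mP] := glbA _ _ (memB a) (memB b).
  by have [Am _ _] := mP; have [c cm] := toB m Am; exists c; rewrite cm.
have [jn jnP] : {jn : B * B -> B & forall ab,
    is_lub A le [set set_val ab.1; set_val ab.2] (set_val (jn ab))}.
  apply: (@choice _ _ (fun (ab : B * B) (m : B) =>
    is_lub A le [set set_val ab.1; set_val ab.2] (set_val m))) => -[a b] /=.
  have [m mP] := lubA _ _ (memB a) (memB b).
  by have [Am _ _] := mP; have [c cm] := toB m Am; exists c; rewrite cm.
have [cp cpP] : {cp : B -> B & forall a,
    is_glb A le [set set_val a; set_val (cp a)] bot /\
    is_lub A le [set set_val a; set_val (cp a)] top}.
  apply: (@choice _ _ (fun a c : B => is_glb A le [set set_val a; set_val c] bot /\
    is_lub A le [set set_val a; set_val c] top)) => a.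
  have [c [Ac c1 c2]] := compl _ (memB a).
  by have [d dc] := toB c Ac; exists d; rewrite dc.
have [Abot _ _] := botP; have [Atop _ _] := topP.
have [bt btE] := toB bot Abot; have [tp tpE] := toB top Atop.
rewrite -btE in botP cpP; rewrite -tpE in topP cpP.
pose mt2 a b := mt (a, b); pose jn2 a b := jn (a, b).
have mt2P a b : is_glb A le [set set_val a; set_val b] (set_val (mt2 a b)).
  exact: (mtP (a, b)).
have jn2P a b : is_lub A le [set set_val a; set_val b] (set_val (jn2 a b)).
  exact: (jnP (a, b)).
have mt_cp a : mt2 a (cp a) = bt.
  by apply: val_inj; apply: glb_uniq (mt2P _ _) (cpP a).1.
have jn_cp a : jn2 a (cp a) = tp.
  by apply: val_inj; apply: lub_uniq (jn2P _ _) (cpP a).2.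
have mt_jn a b c : mt2 a (jn2 b c) = jn2 (mt2 a b) (mt2 a c).
  apply: val_inj; apply: lub_uniq (jn2P _ _).
  exact: (distr _ _ _ _ _ _ _ (memB a) (memB b) (memB c) (jn2P b c)
    (mt2P _ _) (mt2P _ _) (mt2P _ _)).
have val_sup (D : set B) e : is_lub A le (set_val @` D) (set_val e) <-> is_sup A le D e.
  split=> [[_ ub lub]|[ub lub]].
    split=> [a Da|f fub]; first by apply: ub; exists a.
    by apply: lub; [exact: memB|move=> _ [a Da <-]; exact: fub].
  split; [exact: memB|by move=> _ [a Da <-]; exact: ub|move=> y Ay yub].
  by have [f fy] := toB y Ay; rewrite -fy; apply: lub => a Da; rewrite /leB fy; apply: yub; exists a.
have completeB (D : set B) : exists e, is_sup A le D e.
  have [|e eP] := complete (set_val @` D); first by move=> _ [a _ <-].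
  have [Ae _ _] := eP; have [f fe] := toB e Ae; exists f.
  by apply/val_sup; rewrite fe.
split; first exact: (stone_stonean A le mt2 jn2 cp bt tp).
move=> f x0 cf f0 fx0.
have fx0pos : 0 < f x0 by rewrite lt_neqAle f0 andbT eq_sym; apply/eqP.
pose eps := f x0 / 2; have eps0 : 0 < eps by rewrite divr_gt0.
pose U := [set x | eps < f x].
have oU : open U.
  apply: (@open_comp _ _ f [set r | eps < r]); last exact: open_gt.
  by move=> x _; exact: cf.
have Ux0 : U x0 by rewrite /U /= /eps; lra.
have [a x0a aU] := stone_basis A le mt2 jn2 cp bt tp po mt2P jn2P botP topP
  mt_cp jn_cp U x0 oU Ux0.
have [|w [w0 wj wn] wa] := sep (set_val a) (memB a).
  move=> abot; have aE : a = bt by apply: val_inj; apply: lub_uniq abot botP.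
  by move: x0a; rewrite aE (ev_bt A le bt botP).
pose wB (b : B) := w (set_val b).
have wB0 b : 0 <= wB b by exact: w0.
have wBj b c : mt2 b c = bt -> wB (jn2 b c) = wB b + wB c.
  move=> bc; apply: (wj _ _ (set_val bt)) => //.
  by rewrite -bc; exact: mt2P.
have wBn (D : set B) e : directed A le D -> is_sup A le D e ->
    forall eps, 0 < eps -> exists2 b, D b & wB e <= wB b + eps.
  move=> [[d Dd] dir] supe eps' eps'0.
  have sD : set_val @` D `<=` A by move=> _ [b _ <-]; exact: memB.
  have nD : set_val @` D !=set0 by exists (set_val d); exists d.
  have dD b c : (set_val @` D) b -> (set_val @` D) c ->
      exists g, [/\ (set_val @` D) g, le b g & le c g].
    move=> [b' Db <-] [c' Dc <-]; have [g [Dg bg cg]] := dir b' c' Db Dc.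
    by exists (set_val g); split=> //; exists g.
  have [_ [b Db <-] h] := wn _ _ sD nD dD ((val_sup D e).2 supe) eps' eps'0.
  by exists b.
apply: (weight_measure_exists A le mt2 jn2 cp bt tp po mt2P jn2P botP topP
  mt_cp jn_cp mt_jn completeB R wB wB0 wBj wBn x0 f eps a cf f0 eps0 _ wa).
by move=> x /aU/ltW.
Qed.

End Hyperstonean.

(** ** Transport of normal weights *)

Section OrderIsomorphism.
Context {T U : Type} (A : set T) (leA : T -> T -> Prop) (B : set U)
  (leB : U -> U -> Prop) (psi : U -> T).
Hypothesis psiB : forall b, B b -> A (psi b).
Hypothesis psi_surj : forall a, A a -> exists2 b, B b & psi b = a.
Hypothesis psi_le : forall b c, B b -> B c -> leB b c <-> leA (psi b) (psi c).

Lemma order_iso_lub Y j : Y `<=` B -> is_lub B leB Y j ->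
  is_lub A leA [set psi b | b in Y] (psi j).
Proof.
move=> YB [Bj ub lub]; split; first exact: psiB.
  by move=> _ [b Yb <-]; apply/psi_le; [exact: YB|exact: Bj|exact: ub].
move=> a /psi_surj[b Bb <-] aub; apply/psi_le => //; apply: lub => // y Yy.
by apply/psi_le; [exact: YB|exact: Bb|apply: aub; exists y].
Qed.

End OrderIsomorphism.

Lemma normal_weight_iso (T U : Type) (A : set T) (leA : T -> T -> Prop) (B : set U)
    (leB : U -> U -> Prop) (psi : U -> T) (R : realType) (w : T -> R) :
  (forall b, B b -> A (psi b)) ->
  (forall a, A a -> exists2 b, B b & psi b = a) ->
  (forall b c, B b -> B c -> leB b c <-> leA (psi b) (psi c)) ->
  normal_weight A leA R w -> normal_weight B leB R (w \o psi).
Proof.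
move=> psiB psi_surj psi_le [w0 wadd wnorm].
have psi_ge b c : B b -> B c -> leB c b <-> leA (psi c) (psi b) by move=> Bb Bc; exact: psi_le.
have im2 a b : [set psi x | x in [set a; b]] = [set psi a; psi b].
  by rewrite image_setU !image_set1.
split=> [a Ba|a b o j Ba Bb lo go lj|D e DB [d Dd] dir lub eps eps0] /=.
- exact/w0/psiB.
- have ab : [set a; b] `<=` B by move=> x [->|->].
  apply: (wadd _ _ (psi o)); try exact: psiB.
  + rewrite -(image_set0 psi); exact: (order_iso_lub A leA B leB psi psiB psi_surj psi_le).
  + rewrite -im2.
    exact: (order_iso_lub A (fun x y => leA y x) B (fun x y => leB y x) psi psiB psi_surj psi_ge).
  + by rewrite -im2; exact: (order_iso_lub A leA B leB psi psiB psi_surj psi_le).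
- have [_ [x Dx <-] h] : exists2 a, [set psi b | b in D] a & w (psi e) <= w a + eps.
    apply: (wnorm [set psi b | b in D] (psi e)) => //.
    + by move=> _ [b Db <-]; exact/psiB/DB.
    + by exists (psi d); exists d.
    + move=> _ _ [b Db <-] [c Dc <-]; have [x [Dx bx cx]] := dir b c Db Dc.
      exists (psi x); split; first by exists x.
        by apply/psi_le => //; exact: DB.
      by apply/psi_le => //; exact: DB.
    + exact: (order_iso_lub A leA B leB psi psiB psi_surj psi_le).
  by exists x.
Qed.

(** The idempotents of the Munn quotient are order isomorphic to those of the
    semigroup, so their Stone space is hyperstonean as soon as the idempotents
    upstairs carry enough normal weights. *)
Lemma quotient_hyperstonean (T : Type) (G : star_magma T) (one zero : T) (co : T -> T)
    (R : realType) :
  inverse_semigroup G -> is_unit G one -> is_zero G zero ->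
  (forall e, idempotents G e -> idempotents G (co e)) ->
  (forall e, idempotents G e -> co (co e) = e) ->
  (forall e f, idempotents G e -> idempotents G f ->
     smul G f e = zero <-> smul G f (co e) = f) ->
  (forall X, X `<=` idempotents G ->
     exists e, is_lub (idempotents G) (natural_le G) X e) ->
  (forall e, idempotents G e -> e <> zero ->
     exists2 w, normal_weight (idempotents G) (natural_le G) R w & 0 < w e) ->
  let Q := quotient G (munn G) in
  hyperstonean R (stone_space (idempotents Q) (natural_le Q)).
Proof.
move=> invG unit1 zero0 co_idem coK co_le complete sep Q.
pose cls v : set T := @munn_class T G v.
have [psi psiP] : {psi : set T -> T & forall A, (exists2 e, idempotents G e & A = cls e) ->
    idempotents G (psi A) /\ A = cls (psi A)}.
  apply: (@choice _ _ (fun A f => (exists2 e, idempotents G e & A = cls e) ->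
    idempotents G f /\ A = cls f)) => A.
  by have [[e Ee Ae]|no] := pselect (exists2 e, idempotents G e & A = cls e);
    [exists e|exists one].
have psiK e : idempotents G e -> psi (cls e) = e.
  move=> Ee; have [|Ep pe] := psiP (cls e); first by exists e.
  by symmetry; exact: (quotient_idem_inj invG) pe.
have lift A : idempotents Q A -> exists2 e, idempotents G e & A = cls e.
  exact: quotient_idem_lift.
have idem e : idempotents G e -> idempotents Q (cls e) by exact: quotient_idem.
apply: hyperstonean_stone_space.
- exact: (quotient_idem_boolean_algebra invG one zero co).
- exact: quotient_complete.
move=> _ /lift[e Ee ->] ne0.
have [|w nw we] := sep e Ee.
  move=> e0; apply: ne0; split; [exact: idem|by []|].
  move=> B /lift[f Ef ->] _; apply/(quotient_idem_le invG) => //; exists e => //.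
  by rewrite e0; have [_ z0] := zero0; case: (z0 f (proj1 Ef)).
exists (w \o psi); last by rewrite /= psiK.
apply: (normal_weight_iso _ _ (idempotents G) (natural_le G)) => //.
- by move=> _ /lift[f Ef ->]; rewrite psiK.
- by move=> f Ef; exists (cls f); [exact: idem|exact: psiK].
- move=> _ _ /lift[f Ef ->] /lift[g Eg ->]; rewrite !psiK//.
  exact: quotient_idem_le.
Qed.

(** * Hilbert space geometry *)

Section Hilbert.
Context (R : realType) (H : completeNormedModType R[i])
  (ip : {dot H for (@Num.conj R[i])})
  (ip_norm : forall x : H, ip x x = `|x| ^+ 2).
Implicit Types (x y z : H) (r e : R) (c : R[i]).

(** Norm and inner product take complex values. Working with real parts gives
    access to the order of [R], and loses nothing: [ip x y] is determined by
    [rip x y] and [rip ('i *: x) y]. *)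
Definition nm x : R := complex.Re `|x|.
Definition rip x y : R := complex.Re (ip x y).

Lemma normE x : `|x| = (nm x)%:C.
Proof. by rewrite /nm RRe_real// normr_real. Qed.

Lemma nm_ge0 x : 0 <= nm x.
Proof. by rewrite -ler0c -normE normr_ge0. Qed.

Lemma nm0 : nm 0 = 0. Proof. by rewrite /nm normr0. Qed.

Lemma nm_eq0 x : nm x = 0 -> x = 0.
Proof. by move=> h; apply/normr0_eq0; rewrite normE h. Qed.

Lemma nmD x y : nm (x + y) <= nm x + nm y.
Proof. by rewrite -lecR rmorphD /= -!normE ler_normD. Qed.

Lemma nmN x : nm (- x) = nm x. Proof. by rewrite /nm normrN. Qed.

Lemma nmB x y : nm (x - y) = nm (y - x). Proof. by rewrite -nmN opprB. Qed.

Lemma nmZ c x : nm (c *: x) = complex.Re `|c| * nm x.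
Proof.
apply: complexI; rewrite -normE normrZ normE [RHS]rmorphM /=.
by congr (_ * _); rewrite RRe_real// normr_real.
Qed.

Lemma nmZr r x : nm (r%:C *: x) = `|r| * nm x.
Proof.
rewrite nmZ; congr (_ * _); rewrite normc_def /= expr0n /= addr0.
exact: sqrtr_sqr.
Qed.

Lemma nm_triangle y x z : nm (x - z) <= nm (x - y) + nm (y - z).
Proof. by apply: le_trans (nmD _ _); rewrite addrA subrK. Qed.

Lemma ripC x y : rip x y = rip y x.
Proof.
rewrite /rip hermC expr0 mul1r -[LHS]/(complex.Re (conjc (ip y x))).
by case: (ip y x).
Qed.

Lemma ripDl x y z : rip (x + y) z = rip x z + rip y z.
Proof. by rewrite /rip linearDl raddfD. Qed.

Lemma ripNl x y : rip (- x) y = - rip x y.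
Proof. by rewrite /rip linearNl raddfN. Qed.

Lemma ripZl r x y : rip (r%:C *: x) y = r * rip x y.
Proof. by rewrite /rip linearZl_LR /=; case: (ip x y) => a b /=; rewrite mul0r subr0. Qed.

Lemma ripDr x y z : rip z (x + y) = rip z x + rip z y.
Proof. by rewrite ripC ripDl !(ripC z). Qed.

Lemma ripNr x y : rip y (- x) = - rip y x.
Proof. by rewrite ripC ripNl ripC. Qed.

Lemma ripZr r x y : rip y (r%:C *: x) = r * rip y x.
Proof. by rewrite ripC ripZl ripC. Qed.

Lemma ripBl x y z : rip (x - y) z = rip x z - rip y z.
Proof. by rewrite ripDl ripNl. Qed.

Lemma ripBr x y z : rip z (x - y) = rip z x - rip z y.
Proof. by rewrite ripDr ripNr. Qed.

Lemma rip0l x : rip 0 x = 0.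
Proof. by rewrite -(subrr 0) ripBl subrr. Qed.

Lemma rip0r x : rip x 0 = 0.
Proof. by rewrite ripC rip0l. Qed.

Lemma rip_nm x : rip x x = nm x ^+ 2.
Proof. by rewrite /rip ip_norm normE -rmorphXn. Qed.

Lemma rip_ge0 x : 0 <= rip x x. Proof. by rewrite rip_nm sqr_ge0. Qed.

Lemma rip_iN x y : rip ('i *: x) y = - complex.Im (ip x y).
Proof. by rewrite /rip linearZl_LR /=; case: (ip x y) => a b /=; rewrite mul0r mul1r sub0r. Qed.

Lemma rip_i x y : rip ('i *: x) ('i *: y) = rip x y.
Proof.
rewrite /rip linearZl_LR linearZr_LR -[LHS]/(complex.Re ('i * (conjc 'i * ip x y))).
case: (ip x y) => a b /=.
by rewrite !(mul0r, mul1r, oppr0, mulN1r, add0r, subr0, opprK, sub0r, mulr0, addr0, mulr1).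
Qed.

Lemma ip_eq x y x' y' : rip x y = rip x' y' ->
  rip ('i *: x) y = rip ('i *: x') y' -> ip x y = ip x' y'.
Proof.
rewrite !rip_iN /rip; case: (ip x y) => a b; case: (ip x' y') => a' b' /= -> /oppr_inj ->.
by [].
Qed.

Lemma rip_inj x y : (forall z, rip x z = rip y z) -> x = y.
Proof.
move=> xy; apply/eqP; rewrite -subr_eq0; apply/eqP/nm_eq0/eqP.
by rewrite -sqrf_eq0 -rip_nm ripBl xy subrr.
Qed.

Lemma nm_sqD x y : nm (x + y) ^+ 2 = nm x ^+ 2 + 2 * rip x y + nm y ^+ 2.
Proof. by rewrite -!rip_nm ripDl !ripDr (ripC y x); ring. Qed.

Lemma nm_sqB x y : nm (x - y) ^+ 2 = nm x ^+ 2 - 2 * rip x y + nm y ^+ 2.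
Proof. by rewrite nm_sqD nmN ripNr mulrN. Qed.

Lemma cauchy_schwarz x y : rip x y <= nm x * nm y.
Proof.
have h : nm (x + y) ^+ 2 <= (nm x + nm y) ^+ 2.
  by rewrite lerXn2r ?nnegrE ?addr_ge0 ?nm_ge0// nmD.
by move: h; rewrite nm_sqD; lra.
Qed.

Lemma nm_le_sq x y : nm x ^+ 2 <= nm y ^+ 2 -> nm x <= nm y.
Proof. by rewrite ler_pXn2r ?nnegrE ?nm_ge0. Qed.

(** Since the norm is complex valued, convergence is restated with real tolerances. *)
Definition tends (u : nat -> H) x :=
  forall e, 0 < e -> exists n0, forall n, (n0 <= n)%N -> nm (u n - x) < e.

Lemma complete_seq (u : nat -> H) :
  (forall e, 0 < e -> exists n0, forall n m, (n0 <= n)%N -> (n0 <= m)%N ->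
     nm (u n - u m) < e) -> exists x, tends u x.
Proof.
move=> cu.
have : cauchy (u @ \oo).
  apply/cauchy_ballP => e; rewrite ltcE /= => /andP[/eqP ei e0].
  have [n0 hn] := cu _ e0; have eE : e = (complex.Re e)%:C by case: e ei {e0 hn} => a b /= ->.
  exists ([set u n | n in [set n | (n0 <= n)%N]], [set u n | n in [set n | (n0 <= n)%N]]).
    by split; exists n0 => // n /= h; exists n.
  by move=> [_ _] /= [[n hn1 <-] [m hm1 <-]]; rewrite -ball_normE /= eE normE ltcR; exact: hn.
move=> /cauchy_cvgP /cvg_ex[x ux]; exists x => e e0.
have e0' : 0 < e%:C by rewrite ltcR.
have /cvgrPdist_lt/(_ _ e0') [n0 _ hn] := ux.
by exists n0 => n /hn /=; rewrite normE ltcR nmB.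
Qed.

Definition subspace_of (K : set H) :=
  [/\ K 0, forall x y, K x -> K y -> K (x + y) & forall c x, K x -> K (c *: x)].

Definition closed_subspace (K : set H) := subspace_of K /\
  forall x, (forall e, 0 < e -> exists2 y, K y & nm (x - y) < e) -> K x.

Lemma subspaceB K x y : subspace_of K -> K x -> K y -> K (x - y).
Proof. by move=> [_ KD KZ] Kx Ky; apply: KD => //; rewrite -scaleN1r; exact: KZ. Qed.

(** A closed subspace has a point nearest to [x]: by the parallelogram law a
    minimizing sequence is Cauchy. *)
Lemma projection_theorem K x : closed_subspace K ->
  exists2 p, K p & forall y, K y -> rip (x - p) y = 0.
Proof.
move=> [sK clK]; have [K0 KD KZ] := sK.
pose S := [set nm (x - y) ^+ 2 | y in K].
have infS : has_inf S.
  by split; [exists (nm (x - 0) ^+ 2); exists 0|exists 0 => _ [y _ <-]; exact: sqr_ge0].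
pose d := inf S.
have dle y : K y -> d <= nm (x - y) ^+ 2.
  by move=> Ky; apply: ge_inf; [case: infS|exists y].
have [u uP] : {u : nat -> H & forall n, K (u n) /\ nm (x - u n) ^+ 2 < d + n.+1%:R^-1}.
  apply: (@choice _ _ (fun n y => K y /\ nm (x - y) ^+ 2 < d + n.+1%:R^-1)) => n.
  have n0 : 0 < n.+1%:R^-1 :> R by rewrite invr_gt0.
  by have [_ [y Ky <-] yd] := inf_adherent n0 infS; exists y.
have para n m : nm (u n - u m) ^+ 2 <= 2 * n.+1%:R^-1 + 2 * m.+1%:R^-1.
  have [Kn hn] := uP n; have [Km hm] := uP m.
  have := dle (2^-1%:C *: (u n + u m)) (KZ _ _ (KD _ _ Kn Km)).
  have e1 : x - 2^-1%:C *: (u n + u m) = 2^-1%:C *: ((x - u n) + (x - u m)).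
    rewrite [in RHS]addrACA -opprD [RHS]scalerDr scalerN; congr (_ - _).
    by rewrite scalerDr -scalerDl -rmorphD /= (_ : 2^-1 + 2^-1 = 1) ?scale1r//; lra.
  have e2 : u n - u m = (x - u m) - (x - u n).
    by rewrite opprB [RHS]addrC addrA subrK.
  rewrite e1 e2 nmZr exprMn real_normK ?num_real// (nm_sqD (x - u n)).
  rewrite (nm_sqB (x - u m)) (ripC (x - u m)).
  set a := rip _ _; set b := nm _ ^+ 2 in hn *; set b' := nm _ ^+ 2 in hm *.
  rewrite expr2; move: (n.+1%:R^-1) (m.+1%:R^-1) hn hm => i j hn hm; lra.
have small e : 0 < e -> exists n0, forall n, (n0 <= n)%N -> n.+1%:R^-1 < e.
  move=> e0; exists (Num.truncn e^-1) => k h.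
  rewrite invf_plt ?posrE ?ltr0n//.
  by have := truncnS_gt e^-1; move=> /lt_le_trans; apply; rewrite ler_nat.
have [p up] : exists p, tends u p.
  apply: complete_seq => e e0.
  have e4 : 0 < e ^+ 2 / 4 by rewrite divr_gt0// exprn_gt0.
  have [n0 hn0] := small _ e4.
  exists n0 => n m /hn0 hn /hn0 hm; rewrite -(@ltr_pXn2r _ 2)// ?nnegrE ?nm_ge0 ?ltW//.
  apply: le_lt_trans (para n m) _.
  by move: (n.+1%:R^-1) (m.+1%:R^-1) hn hm => i j; lra.
have Kp : K p.
  apply: clK => e e0; have [n0 hn] := up e e0; exists (u n0); first by case: (uP n0).
  by rewrite nmB; exact: hn.
exists p => // y Ky; set rho := rip _ y.
have quad t : 2 * t * rho <= t ^+ 2 * nm y ^+ 2.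
  suff h (e : R) : 0 < e -> 2 * t * rho <= t ^+ 2 * nm y ^+ 2 + e by exact/ler_addgt0Pr.
  move=> e0; pose L := nm (t%:C *: y).
  have L0 : 0 <= L by exact: nm_ge0.
  have e1 : 0 < e / 4 / (L + 1) by rewrite !divr_gt0//; lra.
  have [n0 hn0] := up _ e1.
  have e2 : 0 < e / 2 by rewrite divr_gt0.
  have [n1 hn1] := small _ e2.
  pose n := maxn n0 n1.
  have /ltW a1 := hn0 n (leq_maxl _ _); have /ltW a2 := hn1 n (leq_maxr _ _).
  have [Kn hn] := uP n.
  have := dle _ (KD _ _ Kn (KZ t%:C _ Ky)).
  rewrite (_ : x - (u n + t%:C *: y) = (x - u n) - t%:C *: y); last by rewrite opprD addrA.
  rewrite nm_sqB nmZr exprMn real_normK ?num_real// ripZr => h.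
  have ex : rip (x - u n) y = rho - rip (u n - p) y.
    by rewrite -ripBl opprB addrA subrK.
  have cs : t * rip (u n - p) y <= e / 4.
    rewrite -ripZr; apply: le_trans (cauchy_schwarz _ _) _; rewrite -/L.
    apply: (@le_trans _ _ (e / 4 / (L + 1) * (L + 1))); last by rewrite mulfVK//; lra.
    by apply: ler_pM => //; [exact: nm_ge0|lra].
  rewrite ex mulrBr in h; move: (n.+1%:R^-1) hn a2 => i hn a2.
  rewrite -[2 * t * rho]mulrA.
  by move: (t * rho) (t * rip _ _) (nm (x - u n) ^+ 2) (t ^+ 2 * _) hn h cs => *; lra.
have s0 := sqr_ge0 (nm y).
pose z := rho / (nm y ^+ 2 + 1).
have zE : rho = z * (nm y ^+ 2 + 1) by rewrite divfK// gt_eqF//; lra.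
have := quad z; rewrite {1}zE; move: (nm y ^+ 2) s0 zE => s s0 zE h.
have zs : 0 <= z ^+ 2 * s by rewrite mulr_ge0 ?sqr_ge0.
have z2 : z ^+ 2 <= 0 by rewrite expr2 in h zs *; nra.
have /eqP : z ^+ 2 == 0 by rewrite eq_le z2 sqr_ge0.
by move/eqP; rewrite sqrf_eq0 zE => /eqP ->; rewrite mul0r.
Qed.

Lemma rip_iC x y : rip ('i *: x) y = - rip x ('i *: y).
Proof.
rewrite -[y in LHS]opprK -[y in LHS]scale1r -scaleNr -sqr_i expr2 -scalerA ripNr.
by rewrite rip_i.
Qed.

Lemma scale_reim c x : c *: x = (complex.Re c)%:C *: x + (complex.Im c)%:C *: ('i *: x).
Proof. by rewrite {1}[c]complexE scalerDl scalerA (mulrC 'i). Qed.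

(** ** Bounded operators *)

Local Notation bop := (@bounded_operator R H).
Implicit Types (a b : H -> H).

Section LinearFacts.
Variable a : H -> H.
Hypothesis la : linear a.
Lemma lin0 : a 0 = 0.
Proof. by have := la (-1) 0 0; rewrite scaler0 addr0 scaleN1r addNr. Qed.
Lemma linD x y : a (x + y) = a x + a y.
Proof. by have := la 1 x y; rewrite !scale1r. Qed.
Lemma linZ c x : a (c *: x) = c *: a x.
Proof. by have := la c x 0; rewrite !addr0 lin0 addr0. Qed.
Lemma linN x : a (- x) = - a x.
Proof. by rewrite -scaleN1r linZ scaleN1r. Qed.
Lemma linB x y : a (x - y) = a x - a y.
Proof. by rewrite linD linN. Qed.
End LinearFacts.

Lemma bounded_operatorP a : bop a <->
  linear a /\ exists2 C, 0 <= C & forall x, nm (a x) <= C * nm x.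
Proof.
split=> -[la]; last first.
  move=> [C C0 aC]; split=> // x.
  apply/cvgrPdist_lt => e; rewrite ltcE /= => /andP[/eqP ei e0].
  have eE : e = (complex.Re e)%:C by case: e ei {e0} => u v /= ->.
  have d0 : 0 < complex.Re e / (C + 1) by rewrite divr_gt0//; lra.
  have d0' : 0 < (complex.Re e / (C + 1))%:C by rewrite ltcR.
  near=> y; rewrite -linB// eE normE ltcR; apply: le_lt_trans (aC _) _.
  have : `|x - y| < (complex.Re e / (C + 1))%:C.
    by near: y; apply: cvgr_dist_lt => //; exact: cvg_id.
  rewrite normE ltcR ltr_pdivlMr; last lra.
  by apply: le_lt_trans; rewrite mulrC ler_wpM2l ?nm_ge0//; lra.
move=> ca; split=> //.
have e1 : (0 : R[i]) < 1 by exact: ltr01.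
have /cvgrPdist_lt/(_ _ e1) := ca 0; rewrite lin0//.
move=> /nbhs_ballP[d]; rewrite /= ltcE /= => /andP[/eqP di d0] dP.
have dE : d = (complex.Re d)%:C by case: d di {d0 dP} => u v /= ->.
set D := complex.Re d in d0 dE.
have small x : nm x < D -> nm (a x) < 1.
  move=> xd; have /dP : ball 0 d x by rewrite -ball_normE /= sub0r normrN normE dE ltcR.
  by rewrite /= sub0r normrN normE (_ : 1 = 1%:C)// ltcR.
exists (2 / D) => [|x]; first by rewrite divr_ge0// ltW.
have [->|x0] := eqVneq x 0; first by rewrite lin0// nm0 mulr0.
have nx : 0 < nm x.
  by rewrite lt_neqAle nm_ge0 andbT eq_sym; apply: contraNneq x0 => /nm_eq0 ->.
have h : nm ((D / 2 / nm x)%:C *: x) < D.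
  rewrite nmZr ger0_norm; last by rewrite !divr_ge0// ltW.
  by rewrite mulfVK ?gt_eqF//; lra.
have := small _ h; rewrite linZ// nmZr ger0_norm; last by rewrite !divr_ge0// ltW.
rewrite mulrAC ltr_pdivrMr// mul1r => k.
by rewrite mulrAC ler_pdivlMr//; lra.
Unshelve. all: by end_near. Qed.

Lemma bop_linear a : bop a -> linear a. Proof. by case. Qed.

Lemma bop_bound a : bop a -> exists2 C, 0 <= C & forall x, nm (a x) <= C * nm x.
Proof. by move=> /bounded_operatorP[]. Qed.

Lemma bop_id : bop id.
Proof. by apply/bounded_operatorP; split=> //; exists 1 => // x; rewrite mul1r. Qed.

Lemma bop_comp a b : bop a -> bop b -> bop (a \o b).
Proof.
move=> /bounded_operatorP[la [C C0 aC]] /bounded_operatorP[lb [D D0 bD]].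
apply/bounded_operatorP; split=> [c x y|]; first by rewrite /= lb la.
exists (C * D) => [|x]; first exact: mulr_ge0.
by apply: le_trans (aC _) _; rewrite -mulrA ler_wpM2l.
Qed.

Lemma bop_add a b : bop a -> bop b -> bop (fun x => a x + b x).
Proof.
move=> /bounded_operatorP[la [C C0 aC]] /bounded_operatorP[lb [D D0 bD]].
apply/bounded_operatorP; split=> [c x y|]; first by rewrite lb la scalerDr addrACA.
exists (C + D) => [|x]; first exact: addr_ge0.
by apply: le_trans (nmD _ _) _; rewrite mulrDl lerD.
Qed.

Lemma bop_scale c a : bop a -> bop (fun x => c *: a x).
Proof.
move=> /bounded_operatorP[la [C C0 aC]].
have c0 : 0 <= complex.Re `|c| by rewrite -ler0c RRe_real ?normr_real// normr_ge0.
apply/bounded_operatorP; split=> [d x y|]; first by rewrite la scalerDr !scalerA mulrC.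
exists (complex.Re `|c| * C) => [|x]; first exact: mulr_ge0.
by rewrite nmZ -mulrA ler_wpM2l.
Qed.

(** ** Orthogonal projections *)

(** The value 0 is a dummy, for sets [K] without nearest points. *)
Definition orth_proj (K : set H) x : H :=
  xget 0 [set p | K p /\ forall y, K y -> rip (x - p) y = 0].

Section OrthProj.
Variable K : set H.
Hypothesis cK : closed_subspace K.
Local Notation P := (orth_proj K).

Lemma orth_projP x : K (P x) /\ forall y, K y -> rip (x - P x) y = 0.
Proof.
rewrite /orth_proj; have [p Kp pP] := projection_theorem K x cK.
by case: xgetP => [_ -> []|/(_ p)[]].
Qed.

Lemma orth_proj_uniq x p : K p -> (forall y, K y -> rip (x - p) y = 0) -> P x = p.
Proof.
move=> Kp pP; have [KP PP] := orth_projP x; have [sK _] := cK.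
have Kd := subspaceB _ _ _ sK KP Kp.
apply/eqP; rewrite -subr_eq0; apply/eqP/nm_eq0/eqP; rewrite -sqrf_eq0 -rip_nm.
rewrite -[X in rip X _]opprK opprB ripNl.
rewrite (_ : p - P x = (x - P x) - (x - p)); last first.
  by rewrite opprB [RHS]addrC addrA subrK.
by rewrite (ripBl (x - P x)) PP// pP// subrr oppr0.
Qed.

Lemma orth_proj_id x : K x -> P x = x.
Proof. by move=> Kx; apply: orth_proj_uniq => // y _; rewrite subrr rip0l. Qed.

Lemma orth_scale z : (forall y, K y -> rip z y = 0) ->
  forall c y, K y -> rip (c *: z) y = 0.
Proof.
have [[_ _ KZ] _] := cK => zK c y Ky.
by rewrite scale_reim ripDl !ripZl rip_iC !zK ?mulr0 ?oppr0 ?mulr0 ?addr0//; exact: KZ.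
Qed.

Lemma orth_proj_linear : linear P.
Proof.
move=> c x y; have [[K0 KD KZ] _] := cK.
have [Kx Px] := orth_projP x; have [Ky Py] := orth_projP y.
apply: orth_proj_uniq => [|z Kz]; first by apply: KD => //; exact: KZ.
by rewrite opprD addrACA -scalerBr ripDl (orth_scale _ Px)// Py// addr0.
Qed.

Lemma orth_proj_sym x y : rip (P x) y = rip x (P y).
Proof.
have [Kx Px] := orth_projP x; have [Ky Py] := orth_projP y.
transitivity (rip (P x) (P y)).
  by rewrite ripC -[y in LHS](subrK (P y)) ripDl Py// add0r ripC.
by rewrite -[x in RHS](subrK (P x)) ripDl Px// add0r.
Qed.

Lemma orth_proj_pyth x : nm x ^+ 2 = nm (P x) ^+ 2 + nm (x - P x) ^+ 2.
Proof.
have [Kx Px] := orth_projP x.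
have e : x = (x - P x) + P x by rewrite subrK.
by rewrite [in LHS]e (nm_sqD (x - P x)) Px// mulr0 addr0 addrC.
Qed.

Lemma orth_proj_le x : nm (P x) <= nm x.
Proof. by apply: nm_le_sq; rewrite (orth_proj_pyth x) lerDl sqr_ge0. Qed.

Lemma orth_proj_bop : bop P.
Proof.
apply/bounded_operatorP; split; first exact: orth_proj_linear.
by exists 1 => // x; rewrite mul1r orth_proj_le.
Qed.

Lemma orth_proj_idem : P \o P = P.
Proof. by apply/funext => x /=; apply: orth_proj_id; case: (orth_projP x). Qed.

End OrthProj.

(** ** Adjoints *)

Lemma ip_of_rip a b : linear a -> (forall x y, rip (a x) y = rip x (b y)) ->
  forall x y, ip (a x) y = ip x (b y).
Proof. by move=> la ab x y; apply: ip_eq; rewrite -?(linZ a la) ab. Qed.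

Lemma ip_inj x y : (forall z, ip z x = ip z y) -> x = y.
Proof. by move=> xy; apply: rip_inj => z; rewrite ripC [RHS]ripC /rip xy. Qed.

Lemma adj_eq a b : linear a -> (forall x y, rip (a x) y = rip x (b y)) -> adj ip a = b.
Proof.
move=> la /(ip_of_rip _ _ la) ab; rewrite /adj.
case: xgetP => [c -> ac|/(_ b)[]//]; apply/funext => y.
by apply: ip_inj => z; rewrite -ac ab.
Qed.

(** The functional [x |-> <a x, y>] is represented by a multiple of any vector
    orthogonal to its kernel. *)
Lemma riesz a y : bop a -> exists w, forall x, ip (a x) y = ip x w.
Proof.
move=> ba; have la := bop_linear _ ba; have [C C0 aC] := bop_bound _ ba.
pose K : set H := [set x | ip (a x) y = 0].
have cK : closed_subspace K.
  split; first split.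
  - by rewrite /K /= lin0// linear0l.
  - by move=> x z; rewrite /K /= linD// linearDl /= => -> ->; rewrite addr0.
  - by move=> c x; rewrite /K /= linZ// linearZl_LR /= => ->; rewrite mulr0.
  move=> x xK; have re0 c : rip (a (c *: x)) y = 0.
    apply/eqP; rewrite -normr_le0; apply/ler_addgt0Pr => e e0; rewrite add0r.
    pose L := complex.Re `|c| * C * nm y.
    have c0 : 0 <= complex.Re `|c| by rewrite -ler0c RRe_real ?normr_real// normr_ge0.
    have L0 : 0 <= L by rewrite !mulr_ge0// nm_ge0.
    have e1 : 0 < e / (L + 1) by rewrite divr_gt0//; lra.
    have [z Kz xz] := xK _ e1.
    have -> : rip (a (c *: x)) y = rip (a (c *: (x - z))) y.
      rewrite scalerBr linB// ripBl [X in _ - X](_ : _ = 0) ?subr0//.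
      by rewrite linZ// /rip linearZl_LR /= Kz mulr0.
    have bd w : nm w = nm (x - z) -> rip (a (c *: w)) y <= e.
      move=> wz; apply: le_trans (cauchy_schwarz _ _) _.
      apply: (@le_trans _ _ (L * nm w)).
        rewrite /L mulrAC ler_wpM2r ?nm_ge0//; apply: le_trans (aC _) _.
        by rewrite nmZ mulrCA mulrA.
      rewrite wz; rewrite ltr_pdivlMr in xz; last lra.
      by apply: ltW; apply: le_lt_trans xz; rewrite mulrC ler_wpM2l ?nm_ge0//; lra.
    rewrite ler_norml bd// andbT lerNl -ripNl -linN// -scalerN.
    by apply: bd; rewrite nmN.
  rewrite /K /= -(linear0l ip y); apply: ip_eq; rewrite ?scaler0 ?rip0l.
    by have := re0 1; rewrite scale1r.
  by rewrite -(linZ a la); exact: re0.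
have [allK|/existsNP[z Kz]] := pselect (forall x, K x).
  by exists 0 => x; rewrite linear0r; exact: allK.
have [KP PP] := orth_projP _ cK z; set w := z - _ in PP.
have orth k : K k -> ip k w = 0.
  move=> Kk; rewrite -(linear0l ip w); apply: ip_eq; rewrite ?scaler0 rip0l ripC.
    exact: PP.
  by rewrite PP//; have [[_ _ KZ] _] := cK; exact: KZ.
have fw : ip (a w) y = ip (a z) y by rewrite /w linB// linearBl /= KP subr0.
have fw0 : ip (a w) y != 0 by rewrite fw; apply/eqP.
have w0 : ip w w != 0.
  rewrite ip_norm expf_neq0// normr_eq0; apply: contra_neq fw0 => ->.
  by rewrite lin0// linear0l.
exists ((conjc (ip (a w) y / ip w w)) *: w) => x.
rewrite linearZr_LR -[RHS]/(conjc (conjc (ip (a w) y / ip w w)) * ip x w) conjcK.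
pose c := ip (a x) y / ip (a w) y.
have Kxc : K (x - c *: w).
  by rewrite /K /= linB// linZ// linearBl /= linearZl_LR /= /c divfK// subrr.
have -> : ip x w = c * ip w w.
  by rewrite -[x in LHS](subrK (c *: w)) linearDl /= orth// add0r linearZl_LR.
by rewrite /c; field; rewrite fw0 w0.
Qed.

Lemma adj_ip a : bop a -> forall x y, ip (a x) y = ip x (adj ip a y).
Proof.
move=> ba; have [b ab] : {b : H -> H & forall y x, ip (a x) y = ip x (b y)}.
  apply: (@choice _ _ (fun y w => forall x, ip (a x) y = ip x w)) => y.
  exact: riesz.
by rewrite /adj; case: xgetP => [c -> //|/(_ b)[]] x y.
Qed.

Lemma adj_rip a : bop a -> forall x y, rip (a x) y = rip x (adj ip a y).
Proof. by move=> ba x y; rewrite /rip adj_ip. Qed.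

Lemma adj_ripr a : bop a -> forall x y, rip x (a y) = rip (adj ip a x) y.
Proof. by move=> ba x y; rewrite ripC adj_rip// ripC. Qed.

Lemma adj_linear a : bop a -> linear (adj ip a).
Proof.
move=> ba c x y; apply: ip_inj => z; rewrite -adj_ip// !linearDr /=.
by rewrite !linearZr_LR /= !adj_ip.
Qed.

Lemma adj_bop a : bop a -> bop (adj ip a).
Proof.
move=> ba; apply/bounded_operatorP; split; first exact: adj_linear.
have [C C0 aC] := bop_bound _ ba; exists C => // x.
set b := adj ip a; have [->|b0] := eqVneq (nm (b x)) 0.
  by rewrite mulr_ge0 ?nm_ge0.
have bp : 0 < nm (b x) by rewrite lt_neqAle nm_ge0 andbT eq_sym.
rewrite -(ler_pM2l bp) -expr2 -rip_nm -adj_rip//.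
apply: le_trans (cauchy_schwarz _ _) _.
by rewrite mulrCA mulrA ler_wpM2r ?nm_ge0// mulrC; apply: le_trans (aC _) _; rewrite mulrC.
Qed.

Lemma adjK a : bop a -> adj ip (adj ip a) = a.
Proof.
move=> ba; apply: adj_eq; first exact: adj_linear.
by move=> x y; rewrite -adj_ripr.
Qed.

Lemma adj_comp a b : bop a -> bop b -> adj ip (a \o b) = adj ip b \o adj ip a.
Proof.
move=> ba bb; apply: adj_eq; first exact/bop_linear/bop_comp.
by move=> x y /=; rewrite adj_rip// adj_rip.
Qed.

Lemma adj_id : adj ip id = id.
Proof. by apply: adj_eq => // c x y. Qed.

Lemma orth_proj_projection K : closed_subspace K -> projection ip (orth_proj K).
Proof.
move=> cK; split; first exact: orth_proj_idem.
by apply: adj_eq; [exact: orth_proj_linear|exact: orth_proj_sym].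
Qed.

(** ** Strong limits along directed families *)

Section DirectedLimits.
Context (J : Type) (D : set J) (lej : J -> J -> Prop).
Hypothesis D0 : D !=set0.
Hypothesis Dtrans : forall i j k, lej i j -> lej j k -> lej i k.
Hypothesis Drefl : forall i, lej i i.
Hypothesis Ddir : forall i j, D i -> D j -> exists k, [/\ D k, lej i k & lej j k].

(** A family whose increments are controlled by the increments of a bounded
    monotone real function converges. *)
Lemma monotone_cauchy (f : J -> H) (N : J -> R) B :
  (forall j, D j -> N j <= B) ->
  (forall j k, D j -> D k -> lej j k -> nm (f k - f j) ^+ 2 <= N k - N j) ->
  exists x, forall e, 0 < e ->
    exists2 j, D j & forall k, D k -> lej j k -> nm (f k - x) < e.
Proof.
move=> NB fN; have supN : has_sup [set N j | j in D].
  by split; [case: D0 => j Dj; exists (N j); exists j|exists B => _ [j Dj <-]; exact: NB].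
pose A := sup [set N j | j in D].
have NA j : D j -> N j <= A by move=> Dj; apply: ub_le_sup; [case: supN|exists j].
have [u uP] : {u : nat -> J & forall n, D (u n) /\ A - n.+1%:R^-1 ^+ 2 < N (u n)}.
  apply: (@choice _ _ (fun n j => D j /\ A - n.+1%:R^-1 ^+ 2 < N j)) => n.
  have n0 : 0 < n.+1%:R^-1 ^+ 2 :> R by rewrite exprn_gt0// invr_gt0.
  by have [_ [j Dj <-] h] := sup_adherent n0 supN; exists j.
have near_u n k : D k -> lej (u n) k -> nm (f k - f (u n)) < n.+1%:R^-1.
  move=> Dk uk; have [Du hu] := uP n.
  rewrite -(@ltr_pXn2r _ 2)// ?nnegrE ?nm_ge0 ?invr_ge0//.
  apply: le_lt_trans (fN _ _ Du Dk uk) _.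
  by have := NA k Dk; move: (_ ^+ 2) hu => i; lra.
have small e : 0 < e -> exists n0, forall n, (n0 <= n)%N -> n.+1%:R^-1 < e.
  move=> e0; exists (Num.truncn e^-1) => k h.
  rewrite invf_plt ?posrE ?ltr0n//.
  by have := truncnS_gt e^-1; move=> /lt_le_trans; apply; rewrite ler_nat.
have [x ux] : exists x, tends (f \o u) x.
  apply: complete_seq => e e0; have e2 : 0 < e / 2 by rewrite divr_gt0.
  have [n0 hn] := small _ e2; exists n0 => n m /hn n1 /hn m1 /=.
  have [Dn _] := uP n; have [Dm _] := uP m.
  have [k [Dk nk mk]] := Ddir _ _ Dn Dm.
  apply: le_lt_trans (nm_triangle (f k) _ _) _; rewrite nmB.
  have := lt_trans (near_u _ _ Dk nk) n1; have := lt_trans (near_u _ _ Dk mk) m1.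
  clear n1 m1; lra.
exists x => e e0; have e2 : 0 < e / 2 by rewrite divr_gt0.
have [n0 hn] := small _ e2; have [n1 hn1] := ux _ e2.
pose n := maxn n0 n1; have a2 := hn n (leq_maxl _ _); have /= a1 := hn1 n (leq_maxr _ _).
exists (u n); first by case: (uP n).
move=> k Dk uk; apply: le_lt_trans (nm_triangle (f (u n)) _ _) _.
have := lt_trans (near_u _ _ Dk uk) a2.
clear a2; lra.
Qed.

(** Convergence in the strong operator topology along a directed set. *)
Definition slim (a : J -> H -> H) (s : H -> H) := forall x e, 0 < e ->
  exists2 j, D j & forall k, D k -> lej j k -> nm (a k x - s x) < e.

Lemma slim_exists (a : J -> H -> H) :
  (forall x, exists y, forall e, 0 < e ->
     exists2 j, D j & forall k, D k -> lej j k -> nm (a k x - y) < e) ->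
  exists s, slim a s.
Proof. by move=> /(@choice _ _ _)[s sP]; exists s => x; exact: sP. Qed.

Lemma eq_of_small x y : (forall e, 0 < e -> nm (x - y) <= e) -> x = y.
Proof.
move=> h; apply/eqP; rewrite -subr_eq0; apply/eqP/nm_eq0/eqP.
rewrite eq_le nm_ge0 andbT; apply/ler_addgt0Pr => e e0.
by rewrite add0r; exact: h.
Qed.

Lemma slim_common (a b : J -> H -> H) s t x y e : slim a s -> slim b t -> 0 < e ->
  exists k, [/\ D k, nm (a k x - s x) < e & nm (b k y - t y) < e].
Proof.
move=> sa sb e0; have [i Di hi] := sa x e e0; have [j Dj hj] := sb y e e0.
have [k [Dk ik jk]] := Ddir _ _ Di Dj.
by exists k; split=> //; [exact: hi|exact: hj].
Qed.

Lemma slim_uniq (a b : J -> H -> H) s t : (forall j, D j -> a j = b j) ->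
  slim a s -> slim b t -> s = t.
Proof.
move=> ab sa sb; apply/funext => x; apply: eq_of_small => e e0.
have e2 : 0 < e / 2 by rewrite divr_gt0.
have [k [Dk h1 h2]] := slim_common _ _ _ _ x x _ sa sb e2.
rewrite -(ab k Dk) in h2; apply: le_trans (nm_triangle (a k x) _ _) _.
by rewrite nmB; lra.
Qed.

(** Multiplication is strongly continuous only on bounded sets of left factors,
    whence the uniform bound [C]. *)
Lemma slim_comp (a b : J -> H -> H) s t (C : R) : 0 <= C ->
  (forall j, D j -> linear (a j)) ->
  (forall j x, D j -> nm (a j x) <= C * nm x) ->
  slim a s -> slim b t -> slim (fun j => a j \o b j) (s \o t).
Proof.
move=> C0 la aC sa sb x e e0; pose d := e / (C + 2).
have d0 : 0 < d by rewrite divr_gt0//; lra.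
have [i Di hi] := sa (t x) d d0; have [j Dj hj] := sb x d d0.
have [k [Dk ik jk]] := Ddir _ _ Di Dj.
exists k => // l Dl kl /=.
have h1 := hi l Dl (Dtrans _ _ _ ik kl); have h2 := hj l Dl (Dtrans _ _ _ jk kl).
apply: le_lt_trans (nm_triangle (a l (t x)) _ _) _.
have h3 : nm (a l (b l x) - a l (t x)) <= C * d.
  rewrite -linB; last exact: la.
  by apply: le_trans (aC _ _ Dl) _; rewrite ler_wpM2l// ltW.
have : C * d + 2 * d = e by rewrite -mulrDl mulrC divfK// gt_eqF//; lra.
by lra.
Qed.

Lemma slim_cst s : slim (fun=> s) s.
Proof. by move=> x e e0; case: D0 => j Dj; exists j => // k _ _; rewrite subrr nm0. Qed.

Lemma slim_bound (a : J -> H -> H) s (C : R) : 0 <= C -> (forall j, D j -> linear (a j)) ->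
  (forall j x, D j -> nm (a j x) <= C * nm x) -> slim a s -> bop s.
Proof.
move=> C0 la aC sa; have sC x : nm (s x) <= C * nm x.
  apply/ler_addgt0Pr => e e0; have [j Dj hj] := sa x e e0.
  apply: (@le_trans _ _ (nm (a j x) + nm (s x - a j x))).
    by apply: le_trans (nmD _ _); rewrite addrC subrK.
  by apply: lerD; [exact: aC|rewrite nmB; apply/ltW/hj].
apply/bounded_operatorP; split; last by exists C.
move=> c x y; apply: eq_of_small => e e0.
pose m := complex.Re `|c|; have m0 : 0 <= m by rewrite -ler0c RRe_real ?normr_real// normr_ge0.
have d0 : 0 < e / (m + 2) by rewrite divr_gt0//; lra.
have [i Di hi] := sa (c *: x + y) _ d0.
have [j Dj hj] := sa x _ d0; have [k Dk hk] := sa y _ d0.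
have [l1 [Dl1 il1 jl1]] := Ddir _ _ Di Dj.
have [l [Dl l1l kl]] := Ddir _ _ Dl1 Dk.
have h1 := hi l Dl (Dtrans _ _ _ il1 l1l); have h2 := hj l Dl (Dtrans _ _ _ jl1 l1l).
have h3 := hk l Dl kl.
apply: le_trans (nm_triangle (a l (c *: x + y)) _ _) _; rewrite nmB (la l Dl).
have h4 : nm (c *: a l x + a l y - (c *: s x + s y)) <=
    m * nm (a l x - s x) + nm (a l y - s y).
  by rewrite opprD addrACA -scalerBr; apply: le_trans (nmD _ _) _; rewrite nmZ.
have h5 : m * nm (a l x - s x) <= m * (e / (m + 2)) by rewrite ler_wpM2l// ltW.
rewrite (la l Dl) in h1.
have : m * (e / (m + 2)) + 2 * (e / (m + 2)) = e.
  by rewrite -mulrDl mulrC divfK// gt_eqF//; lra.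
by lra.
Qed.

(** Taking adjoints is not strongly continuous; but if the adjoints converge at
    all, they converge to the adjoint of the limit. *)
Lemma slim_adj (a b : J -> H -> H) s t (C : R) : 0 <= C -> (forall j, D j -> linear (a j)) ->
  (forall j x, D j -> nm (a j x) <= C * nm x) ->
  (forall j x y, D j -> rip (a j x) y = rip x (b j y)) ->
  slim a s -> slim b t -> adj ip s = t.
Proof.
move=> C0 la aC ab sa sb.
apply: adj_eq; first exact: bop_linear (slim_bound a s C C0 la aC sa).
move=> x y; apply/eqP; rewrite -subr_eq0 -normr_le0.
apply/ler_addgt0Pr => e e0; rewrite add0r.
pose L := nm x + nm y; have nx := nm_ge0 x; have ny := nm_ge0 y.
have L0 : 0 <= L by exact: addr_ge0.
have d0 : 0 < e / (L + 1) by rewrite divr_gt0//; lra.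
have [k [Dk h1 h2]] := slim_common _ _ _ _ x y _ sa sb d0.
have -> : rip (s x) y - rip x (t y) = rip (s x - a k x) y + rip x (b k y - t y).
  by rewrite ripBl ripBr ab//; ring.
have bd u v : `|rip u v| <= nm u * nm v.
  by rewrite ler_norml cauchy_schwarz andbT lerNl -ripNl -[nm u]nmN cauchy_schwarz.
apply: le_trans (ler_normD _ _) _.
have h3 : nm (s x - a k x) * nm y <= e / (L + 1) * nm y.
  by rewrite ler_wpM2r// nmB ltW.
have h4 : nm x * nm (b k y - t y) <= e / (L + 1) * nm x.
  by rewrite mulrC ler_wpM2r// ltW.
have h5 := bd (s x - a k x) y; have h6 := bd x (b k y - t y).
have h7 : e / (L + 1) * L <= e.
  rewrite mulrAC ler_pdivrMr; last by lra.
  by rewrite ler_wpM2l ?ltW//; lra.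
have : e / (L + 1) * L = e / (L + 1) * nm x + e / (L + 1) * nm y by rewrite mulrDr.
by lra.
Qed.

End DirectedLimits.

(** ** Von Neumann algebras *)

Section VN.
Variable M : set (H -> H).
Hypothesis vM : von_neumann_algebra ip M.

Lemma vN_bop a : M a -> bop a. Proof. by case: vM => + _ _; apply. Qed.
Lemma vN_adj a : M a -> M (adj ip a). Proof. by case: vM => _ + _; apply. Qed.

(** The double commutant condition, as a criterion for membership. *)
Lemma vN_mem a : bop a -> (forall b, commutant M b -> a \o b = b \o a) -> M a.
Proof.
move=> ba ab; case: vM => _ _ <-; split=> // b bM; symmetry; exact: ab.
Qed.

Lemma vN_commute a b : M a -> commutant M b -> a \o b = b \o a.
Proof. by move=> Ma [_ ->]. Qed.

Lemma commutant_adj b : commutant M b -> commutant M (adj ip b).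
Proof.
move=> [bb bM]; split=> [|a Ma]; first exact: adj_bop.
have ba := vN_bop _ Ma; rewrite -[in LHS](adjK a)// -[in RHS](adjK a)//.
rewrite -!adj_comp//; try exact: adj_bop.
by rewrite bM//; exact: vN_adj.
Qed.

Lemma vN_id : M id.
Proof. by apply: vN_mem => //; exact: bop_id. Qed.

Lemma vN_comp a b : M a -> M b -> M (a \o b).
Proof.
move=> Ma Mb; apply: vN_mem; first by apply: bop_comp; exact: vN_bop.
move=> c cM; rewrite -compA (vN_commute b c)// compA (vN_commute a c)//.
Qed.

Lemma vN_add a b : M a -> M b -> M (fun x => a x + b x).
Proof.
move=> Ma Mb; apply: vN_mem; first by apply: bop_add; exact: vN_bop.
move=> c cM; apply/funext => x /=; have [bc _] := cM.
rewrite -[a (c x)]/((a \o c) x) -[b (c x)]/((b \o c) x) !(vN_commute _ c)//=.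
by rewrite linD//; exact: bop_linear.
Qed.

Lemma vN_scale c a : M a -> M (fun x => c *: a x).
Proof.
move=> Ma; apply: vN_mem; first by apply: bop_scale; exact: vN_bop.
move=> b bM; apply/funext => x /=; have [bb _] := bM.
rewrite -[a (b x)]/((a \o b) x) (vN_commute _ b)//= linZ//; exact: bop_linear.
Qed.

Lemma vN_sub a b : M a -> M b -> M (fun x => a x - b x).
Proof.
move=> Ma Mb; rewrite (_ : (fun x => _) = (fun x => a x + -1 *: b x)); last first.
  by apply/funext => x; rewrite scaleN1r.
by apply: vN_add => //; exact: vN_scale.
Qed.

Lemma vN_zero : M (fun=> 0).
Proof.
rewrite (_ : (fun=> 0) = (fun x : H => 0 *: id x)); last by apply/funext => x; rewrite scale0r.
exact/vN_scale/vN_id.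
Qed.

(** The projection onto a closed subspace invariant under the commutant of [M]
    commutes with that commutant, hence lies in [M]. *)
Lemma vN_orth_proj K : closed_subspace K ->
  (forall b, commutant M b -> forall x, K x -> K (b x)) -> M (orth_proj K).
Proof.
move=> cK inv; apply: vN_mem; first exact: orth_proj_bop.
move=> b bM; apply/funext => x /=; have [bb _] := bM.
have [KP PP] := orth_projP K cK x.
apply: orth_proj_uniq => //; first exact: inv.
move=> y Ky; rewrite -linB; last exact: bop_linear.
by rewrite adj_rip// PP//; apply: inv => //; exact: commutant_adj.
Qed.

(** Commuting with a given bounded operator passes to strong limits. *)
Lemma vN_slim (J : Type) (D : set J) lej (a : J -> H -> H) s (C : R) :
  D !=set0 -> (forall i j k, lej i j -> lej j k -> lej i k) -> (forall i, lej i i) ->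
  (forall i j, D i -> D j -> exists k, [/\ D k, lej i k & lej j k]) ->
  0 <= C -> (forall j x, D j -> nm (a j x) <= C * nm x) ->
  (forall j, D j -> M (a j)) -> slim J D lej a s -> M s.
Proof.
move=> D0 Dt Dr Dd C0 aC aM sa.
have la j : D j -> linear (a j) by move=> Dj; apply/bop_linear/vN_bop/aM.
apply: vN_mem; first exact: (slim_bound J D lej Dt Dr Dd a s C C0 la aC sa).
move=> b bM; have [bb _] := bM; have [B B0 bB] := bop_bound _ bb.
have l1 : slim J D lej (fun j => a j \o b) (s \o b).
  exact: (slim_comp J D lej Dt Dd _ _ _ _ C C0 la aC sa (slim_cst J D lej D0 b)).
have l2 : slim J D lej (fun j => b \o a j) (b \o s).
  apply: (slim_comp J D lej Dt Dd _ _ _ _ B B0 _ _ (slim_cst J D lej D0 b) sa) => //.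
  by move=> _ _; exact: bop_linear.
apply: (slim_uniq J D lej Dd _ _ _ _ _ l1 l2) => j Dj.
by rewrite (vN_commute _ b)//; exact: aM.
Qed.

End VN.

Lemma abelian_comp_at (D : set (H -> H)) : abelian D ->
  forall d f x, D d -> D f -> d (f x) = f (d x).
Proof. by move=> abD d f x Dd Df; rewrite -[LHS]/((d \o f) x) abD. Qed.

Lemma proj_idem (p : H -> H) x : projection ip p -> p (p x) = p x.
Proof. by move=> [pp _]; rewrite -[LHS]/((p \o p) x) pp. Qed.

Lemma proj_sym (p : H -> H) x y : bop p -> projection ip p -> rip (p x) y = rip x (p y).
Proof. by move=> bp [_ pa]; rewrite adj_rip// pa. Qed.

Lemma proj_nm (p : H -> H) x : bop p -> projection ip p -> rip (p x) x = nm (p x) ^+ 2.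
Proof. by move=> bp pp; rewrite -rip_nm [RHS](proj_sym p)// (proj_idem p)// ripC. Qed.

Lemma proj_le (p : H -> H) x : bop p -> projection ip p -> nm (p x) <= nm x.
Proof.
move=> bp pp; have := cauchy_schwarz (p x) x; rewrite proj_nm//.
have [->|h] := eqVneq (nm (p x)) 0; first by rewrite nm_ge0.
by rewrite expr2 ler_pM2l// lt_neqAle nm_ge0 andbT eq_sym.
Qed.

(** * Projections generate an abelian von Neumann algebra *)

Section Spectral.
Variable D : set (H -> H).
Hypotheses (vD : von_neumann_algebra ip D) (abD : abelian D).
Implicit Types (s t p : H -> H).

Let Dbop := vN_bop D vD.
Let abelianE := abelian_comp_at D abD.

Definition self_adjoint a := forall x y, rip (a x) y = rip x (a y).
Definition positive a := forall x, 0 <= rip (a x) x.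

(** When [a] lies between 0 and 1, [a - a^2 = a (1 - a) a + (1 - a) a (1 - a)]
    is positive. *)
Lemma sa_nm_le a x : linear a -> self_adjoint a -> positive a ->
  (forall y, rip (a y) y <= nm y ^+ 2) -> nm (a x) ^+ 2 <= rip (a x) x.
Proof.
move=> la sa pa a1.
have h1 := a1 (a x); have h2 := pa (x - a x).
rewrite linB// !ripBl !ripBr in h2; rewrite -rip_nm in h1.
have e : rip (a (a x)) x = rip (a x) (a x) by rewrite sa.
by rewrite -rip_nm; lra.
Qed.

(** [sa_nm_le] for [(1 + a / c) / 2], which lies between 0 and 1. *)
Lemma sa_numerical_radius a (c : R) : linear a -> self_adjoint a -> 0 < c ->
  (forall y, `|rip (a y) y| <= c * nm y ^+ 2) -> forall x, nm (a x) <= c * nm x.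
Proof.
move=> la sa c0 a1 x.
pose h y := (2^-1)%:C *: (y + (c^-1)%:C *: a y).
have lh : linear h.
  move=> k y z; rewrite /h la (scalerDr (c^-1)%:C) addrACA scalerDr; congr (_ + _).
  by rewrite !scalerDr !scalerA; congr (_ *: _ + _ *: _); ring.
have c1 y : `|c^-1 * rip (a y) y| <= nm y ^+ 2.
  by rewrite normrM gtr0_norm ?invr_gt0// ler_pdivrMl.
have sh : self_adjoint h.
  by move=> y z; rewrite /h ripZl ripZr ripDl ripDr ripZl ripZr sa.
have hE y : rip (h y) y = 2^-1 * (nm y ^+ 2 + c^-1 * rip (a y) y).
  by rewrite /h ripZl ripDl ripZl rip_nm.
have := sa_nm_le h x lh sh.
have h0 : positive h by move=> y; rewrite hE; have := c1 y; rewrite ler_norml => /andP[]; lra.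
have h1 y : rip (h y) y <= nm y ^+ 2.
  by rewrite hE; have := c1 y; rewrite ler_norml => /andP[]; lra.
move=> /(_ h0 h1); rewrite hE /h nmZr exprMn real_normK ?num_real// nm_sqD nmZr ripZr.
rewrite (ripC x) exprMn real_normK ?num_real// => k.
have k2 : c^-1 ^+ 2 * nm (a x) ^+ 2 <= nm x ^+ 2 by rewrite expr2 in k *; lra.
rewrite -(@ler_pXn2r _ 2)// ?nnegrE ?nm_ge0//; last by rewrite mulr_ge0 ?nm_ge0// ltW.
by rewrite exprMn -ler_pdivrMl ?exprn_gt0// -exprVn.
Qed.

(** ** Square roots *)

Section SquareRoot.
Variable a : H -> H.
Hypotheses (Da : D a) (sa : self_adjoint a) (pa : positive a).
Hypothesis a1 : forall x, rip (a x) x <= nm x ^+ 2.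

Let la : linear a. Proof. exact/bop_linear/Dbop. Qed.

(** The polynomials in [a] with nonnegative real coefficients; they are positive
    because the powers of [a] are, and they are closed under products. *)
Inductive cone : (H -> H) -> Prop :=
| cone_pow n : cone (iter n a)
| cone_add s t : cone s -> cone t -> cone (fun x => s x + t x)
| cone_scale (r : R) s : 0 <= r -> cone s -> cone (fun x => r%:C *: s x).

Lemma iter_linear n : linear (iter n a).
Proof. by elim: n => [|n IH] c x y //=; rewrite IH la. Qed.

Lemma cone_linear s : cone s -> linear s.
Proof.
elim=> [n|s1 s2 _ l1 _ l2|r s1 r0 _ l1] c x y; first exact: iter_linear.
  by rewrite l1 l2 scalerDr addrACA.
by rewrite l1 scalerDr !scalerA mulrC.
Qed.

Lemma iter_sa n : self_adjoint (iter n a).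
Proof. by elim: n => [|n IH] x y //=; rewrite sa IH -iterSr. Qed.

Lemma cone_sa s : cone s -> self_adjoint s.
Proof.
elim=> [n|s1 s2 _ l1 _ l2|r s1 r0 _ l1] x y; first exact: iter_sa.
  by rewrite ripDl ripDr l1 l2.
by rewrite ripZl ripZr l1.
Qed.

Lemma cone_positive s : cone s -> positive s.
Proof.
elim=> [n|s1 s2 _ l1 _ l2|r s1 r0 _ l1] x; last 2 first.
- by rewrite ripDl addr_ge0.
- by rewrite ripZl mulr_ge0.
rewrite -(odd_double_half n) -addnn iterD; case: odd => /=.
  by rewrite iterD -iterS iterSr iter_sa; exact: pa.
by rewrite iterD iter_sa rip_ge0.
Qed.

Lemma cone_comp s t : cone s -> cone t -> cone (s \o t).
Proof.
move=> + ct; elim=> [n|s1 s2 _ l1 _ l2|r s1 r0 _ l1]; last 2 first.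
- exact: cone_add l1 l2.
- exact: cone_scale r0 l1.
elim: ct => [m|t1 t2 _ l1 _ l2|r t1 r0 _ l1].
- by rewrite (_ : _ \o _ = iter (n + m) a)//; [exact: cone_pow|apply/funext => x; rewrite iterD].
- rewrite (_ : _ \o _ = (fun x => (iter n a \o t1) x + (iter n a \o t2) x)).
    exact: cone_add.
  by apply/funext => x /=; rewrite linD//; exact: iter_linear.
- rewrite (_ : _ \o _ = (fun x => r%:C *: (iter n a \o t1) x)).
    exact: cone_scale.
  by apply/funext => x /=; rewrite linZ//; exact: iter_linear.
Qed.

Lemma cone_D s : cone s -> D s.
Proof.
elim=> [n|s1 s2 _ l1 _ l2|r s1 r0 _ l1]; last 2 first.
- exact: vN_add.
- exact: vN_scale.
elim: n => [|n IH]; first by rewrite (_ : iter 0 a = id)//; exact: vN_id.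
by rewrite (_ : iter n.+1 a = a \o iter n a)//; exact: vN_comp.
Qed.

Lemma cone_half s : cone s -> cone (fun x => (2^-1)%:C *: s x).
Proof. by apply: cone_scale; rewrite invr_ge0. Qed.

(** The iteration [y := (a + y^2) / 2] increases, within the cone of polynomials,
    to [1 - sqrt (1 - a)]. *)
Definition sqrt_iter n : H -> H :=
  iter n (fun (y : H -> H) x => (2^-1)%:C *: (a x + y (y x))) (fun=> 0).

Lemma sqrt_iterS n x :
  sqrt_iter n.+1 x = (2^-1)%:C *: (a x + sqrt_iter n (sqrt_iter n x)).
Proof. by []. Qed.

Lemma cone_zero : cone (fun=> 0).
Proof.
rewrite (_ : (fun=> 0) = (fun x => 0%:C *: iter 0 a x)); first exact/cone_scale/cone_pow.
by apply/funext => x; rewrite scale0r.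
Qed.

Lemma sqrt_iter_cone n : cone (sqrt_iter n).
Proof.
elim: n => [|n IH]; first exact: cone_zero.
exact: (cone_half (fun x => a x + sqrt_iter n (sqrt_iter n x))
  (cone_add a _ (cone_pow 1) (cone_comp _ _ IH IH))).
Qed.

(** The next increment is [((y + c)^2 - y^2) / 2], for [y] the current iterate and
    [c] the current increment. *)
Lemma sqrt_iter_step n : exists2 c, cone c & forall x, sqrt_iter n.+1 x = sqrt_iter n x + c x.
Proof.
elim: n => [|n [c cc cE]].
  by exists (sqrt_iter 1) => [|x]; [exact: sqrt_iter_cone|rewrite [sqrt_iter 0 x]/= add0r].
have cy := sqrt_iter_cone n; have ly := cone_linear _ cy; have lc := cone_linear _ cc.
exists (fun x => (2^-1)%:C *: (sqrt_iter n (c x) + (c (sqrt_iter n x) + c (c x)))).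
  apply: (cone_half (fun x => sqrt_iter n (c x) + (c (sqrt_iter n x) + c (c x)))).
  by apply: (cone_add (sqrt_iter n \o c) (fun x => c (sqrt_iter n x) + c (c x)));
    [exact: cone_comp|apply: (cone_add (c \o sqrt_iter n) (c \o c)); exact: cone_comp].
move=> x; rewrite sqrt_iterS [X in _ = X + _]sqrt_iterS -scalerDr; congr (_ *: _).
rewrite -addrA; congr (_ + _); rewrite !cE (linD _ ly) (linD _ lc).
by rewrite -!addrA.
Qed.

Lemma sqrt_iter_le n m : (n <= m)%N ->
  exists2 c, cone c & forall x, sqrt_iter m x = sqrt_iter n x + c x.
Proof.
move=> /subnKC <-; elim: (m - n)%N => [|k [c cc cE]].
  by exists (fun=> 0) => [|x]; [exact: cone_zero|rewrite addn0 addr0].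
have [c' cc' cE'] := sqrt_iter_step (n + k); exists (fun x => c x + c' x).
  exact: cone_add.
by move=> x; rewrite addnS cE' cE addrA.
Qed.

Lemma sqrt_iter1 n x : rip (sqrt_iter n x) x <= nm x ^+ 2.
Proof.
elim: n x => [|n IH] x; first by rewrite [sqrt_iter 0 x]/= rip0l sqr_ge0.
have cy := sqrt_iter_cone n.
have h := sa_nm_le _ x (cone_linear _ cy) (cone_sa _ cy) (cone_positive _ cy) IH.
have e : rip (sqrt_iter n (sqrt_iter n x)) x = nm (sqrt_iter n x) ^+ 2.
  by rewrite (cone_sa _ cy) rip_nm.
by rewrite sqrt_iterS ripZl ripDl e; have := a1 x; have := IH x; lra.
Qed.

(** The limit [y] of the iteration satisfies [y = (a + y^2) / 2], which means
    [(1 - y)^2 = 1 - a]. *)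
Lemma sqrt_one_sub : exists t, [/\ D t, self_adjoint t, positive t
  & forall x, t (t x) = x - a x].
Proof.
have D0 : [set: nat] !=set0 by exists 0%N.
have Dt i j k : (i <= j)%N -> (j <= k)%N -> (i <= k)%N by exact: leq_trans.
have Dd i j : [set: nat] i -> [set: nat] j ->
    exists k, [/\ [set: nat] k, (i <= k)%N & (j <= k)%N].
  by move=> _ _; exists (maxn i j); rewrite leq_maxl leq_maxr.
have cy := sqrt_iter_cone; have ly n := cone_linear _ (cy n).
have sy n := cone_sa _ (cy n); have py n := cone_positive _ (cy n).
have [y ylim] : exists y : H -> H, slim _ [set: nat] leq sqrt_iter y.
  apply: slim_exists => x.
  apply: (monotone_cauchy _ _ leq D0 Dd (fun n => sqrt_iter n x)
    (fun n => rip (sqrt_iter n x) x) (nm x ^+ 2)).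
    by move=> n _; exact: sqrt_iter1.
  move=> n m _ _ nm_; have [c cc cE] := sqrt_iter_le n m nm_.
  rewrite !cE addrC addKr ripDl addrC addKr.
  apply: sa_nm_le; [exact: cone_linear|exact: cone_sa|exact: cone_positive|move=> z].
  have := sqrt_iter1 m z; have := py n z; rewrite cE ripDl; lra.
have y1 n x : [set: nat] n -> nm (sqrt_iter n x) <= 1 * nm x.
  move=> _; apply: sa_numerical_radius => // z.
  by rewrite mul1r ger0_norm ?py// sqrt_iter1.
have Dy : D y.
  apply: (vN_slim D vD _ _ leq _ y 1 D0 Dt leqnn Dd ler01 y1 _ ylim).
  by move=> n _; exact: cone_D.
have ay : adj ip y = y.
  exact: (slim_adj _ _ leq Dt leqnn Dd sqrt_iter sqrt_iter y y 1 ler01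
    (fun n _ => ly n) y1 (fun n x z _ => sy n x z) ylim ylim).
have say : self_adjoint y by move=> x z; rewrite adj_rip ?ay//; exact: Dbop.
have ny x : nm (y x) <= nm x.
  apply/ler_addgt0Pr => e e0; have [j _ hj] := ylim x e e0.
  apply: (@le_trans _ _ (nm (sqrt_iter j x) + nm (y x - sqrt_iter j x))).
    by apply: le_trans (nmD _ _); rewrite addrC subrK.
  apply: lerD; first by have := y1 j x I; rewrite mul1r.
  by rewrite nmB; apply/ltW/hj.
have yE x : y x = (2^-1)%:C *: (a x + y (y x)).
  have yy := slim_comp _ _ leq Dt Dd _ _ _ _ 1 ler01 (fun n _ => ly n) y1 ylim ylim.
  apply: eq_of_small => e e0; have e2 : 0 < e / 2 by rewrite divr_gt0.
  have [i _ hi] := ylim x _ e2; have [j _ hj] := yy x _ e2.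
  pose n := maxn i j.
  have h1 := hi n.+1 I (leqW (leq_maxl _ _)); have h2 := hj n I (leq_maxr _ _).
  apply: le_trans (nm_triangle (sqrt_iter n.+1 x) _ _) _; rewrite nmB.
  have h3 : nm (sqrt_iter n.+1 x - (2^-1)%:C *: (a x + y (y x))) <= e / 2.
    rewrite sqrt_iterS -scalerBr opprD addrACA subrr add0r nmZr ger0_norm ?invr_ge0//.
    by have := nm_ge0 (sqrt_iter n (sqrt_iter n x) - y (y x)); rewrite /= in h2; lra.
  by lra.
have l_y := bop_linear _ (Dbop _ Dy).
exists (fun x => x - y x); split.
- by apply: (vN_sub D vD id) => //; exact: vN_id.
- by move=> x z; rewrite ripBl ripBr say.
- move=> x; rewrite ripBl rip_nm subr_ge0; apply: le_trans (cauchy_schwarz _ _) _.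
  by rewrite expr2 ler_wpM2r ?nm_ge0.
- move=> x; rewrite linB//; have := yE x.
  move=> /(congr1 (fun z => 2%:C *: z)); rewrite scalerA -rmorphM divff// scale1r.
  rewrite (_ : 2%:C = 1 + 1 :> R[i]); last by rewrite -rmorphD.
  rewrite scalerDl scale1r => h.
  have -> : y (y x) = y x + y x - a x by rewrite h addrC addKr.
  by rewrite opprB -(addrA (y x)) (addrC (y x + _)) addKr addrA subrK.
Qed.

End SquareRoot.

(** ** Spectral approximation *)

(** The projection onto [ker (t - a)], for [t = sqrt (a^2)], splits [a] into its
    positive and negative parts, because [(t - a) (t + a) = 0]. *)
Lemma sign_projection a : D a -> self_adjoint a ->
  (forall z, `|rip (a z) z| <= nm z ^+ 2) ->
  exists e : H -> H, [/\ D e, projection ip e, forall z, 0 <= rip (a (e z)) (e z)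
    & forall z, rip (a (z - e z)) (z - e z) <= 0].
Proof.
move=> Da sa a1; have la := bop_linear _ (Dbop _ Da).
have na z : nm (a z) <= nm z.
  by have := sa_numerical_radius a 1 la sa ltr01; rewrite -[nm z]mul1r; apply => y; rewrite mul1r.
have sq z : rip (a (a z)) z = nm (a z) ^+ 2 by rewrite sa rip_nm.
have [t [Dt st pt tE]] : exists t, [/\ D t, self_adjoint t, positive t
    & forall x, t (t x) = x - (x - a (a x))].
  apply: sqrt_one_sub.
  - by apply: (vN_sub D vD id (a \o a)); [exact: vN_id|exact: vN_comp].
  - by move=> x y; rewrite ripBl ripBr !sa.
  - by move=> x; rewrite ripBl sq rip_nm subr_ge0 ler_pXn2r ?nnegrE ?nm_ge0.
  - by move=> x; rewrite ripBl sq rip_nm gerBl sqr_ge0.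
have {}tE x : t (t x) = a (a x) by rewrite tE opprB addrC subrK.
have lt := bop_linear _ (Dbop _ Dt).
pose K : set H := [set z | t z = a z].
have cK : closed_subspace K.
  split; first split.
  - by rewrite /K /= (lin0 _ lt) (lin0 _ la).
  - by move=> x y; rewrite /K /= (linD _ lt) (linD _ la) => -> ->.
  - by move=> c x; rewrite /K /= (linZ _ lt) (linZ _ la) => ->.
  move=> x xK; apply: eq_of_small => d d0.
  have Dd : D (fun z => t z - a z) by exact: vN_sub.
  have ld := bop_linear _ (Dbop _ Dd).
  have [C C0 dC] := bop_bound _ (Dbop _ Dd).
  have d1 : 0 < d / (C + 1) by rewrite divr_gt0//; lra.
  have [z Kz xz] := xK _ d1.
  have -> : t x - a x = (fun z => t z - a z) (x - z).
    by rewrite (linB _ ld) /= Kz subrr subr0.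
  apply: le_trans (dC _) _; rewrite ltr_pdivlMr in xz; last lra.
  by apply: ltW; apply: le_lt_trans xz; rewrite mulrC ler_wpM2l ?nm_ge0//; lra.
have De : D (orth_proj K).
  apply: vN_orth_proj => // b bD x; rewrite /K /= => Kx.
  rewrite -[LHS]/((t \o b) x) -[RHS]/((a \o b) x).
  by rewrite (vN_commute _ t b Dt bD) (vN_commute _ a b Da bD) /= Kx.
exists (orth_proj K); split=> //; first exact: orth_proj_projection.
  by move=> z; have [Kz _] := orth_projP _ cK z; rewrite -Kz.
move=> z; set w := z - _.
have ew : orth_proj K w = 0.
  rewrite /w (linB _ (orth_proj_linear _ cK)) (orth_proj_id _ cK (orth_proj K z)) ?subrr//.
  by case: (orth_projP _ cK z).
have Kw : K (t w + a w).
  by rewrite /K /= (linD _ lt) (linD _ la) tE (abelianE t a) // addrC.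
have : t w + a w = 0.
  rewrite -(orth_proj_id _ cK _ Kw) (linD _ (orth_proj_linear _ cK)).
  by rewrite (abelianE _ t)// (abelianE _ a)// ew (lin0 _ lt) (lin0 _ la) addr0.
move=> /eqP; rewrite addrC addr_eq0 => /eqP ->.
by rewrite ripNl oppr_le0.
Qed.

Definition commutes_with_projections (x : H -> H) :=
  forall p, D p -> projection ip p -> x \o p = p \o x.

(** Replacing [a] by [2 a - (2 e - 1)], for the sign projection [e] of [a], keeps
    the numerical range in [[-1, 1]]; each such step halves the distance to a
    combination of projections. *)
Lemma spectral_approximation n a : D a -> self_adjoint a ->
  (forall z, `|rip (a z) z| <= nm z ^+ 2) ->
  exists s, [/\ D s, self_adjoint s, forall z, `|rip (a z - s z) z| <= 2^-1 ^+ n * nm z ^+ 2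
    & forall x : H -> H, linear x -> commutes_with_projections x -> x \o s = s \o x].
Proof.
elim: n a => [|n IH] a Da sa a1.
  exists (fun=> 0); split.
  - exact: vN_zero.
  - by move=> x y; rewrite rip0l rip0r.
  - by move=> z; rewrite subr0 mul1r.
  - by move=> x lx _; apply/funext => z /=; rewrite lin0.
have [e [De pe ep em]] := sign_projection a Da sa a1.
have se : self_adjoint e by move=> x y; apply: proj_sym => //; exact: Dbop.
have [ee _] := pe.
have la := bop_linear _ (Dbop _ Da); have le := bop_linear _ (Dbop _ De).
pose h (z : H) := e z - (z - e z).
have Dh : D h.
  apply: (vN_sub _ vD e (fun z => z - e z)) => //.
  by apply: (vN_sub _ vD id) => //; exact: vN_id.
have lh := bop_linear _ (Dbop _ Dh).
have sh : self_adjoint h by move=> x y; rewrite /h !(ripBl, ripBr) se.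
have [s [Ds ss s1 sc]] : exists s, [/\ D s, self_adjoint s,
    forall z, `|rip (a z + a z - h z - s z) z| <= 2^-1 ^+ n * nm z ^+ 2
    & forall x : H -> H, linear x -> commutes_with_projections x -> x \o s = s \o x].
  apply: (IH (fun z => a z + a z - h z)).
  - by apply: (vN_sub _ vD (fun z => a z + a z)) => //; exact: vN_add.
  - by move=> x y; rewrite ripBl ripBr ripDl ripDr sa sh.
  move=> z; set u := e z; set v := z - e z.
  have zE : z = u + v by rewrite addrC subrK.
  have eu : e u = u by rewrite -[LHS]/((e \o e) z) ee.
  have ev : e v = 0 by rewrite (linB _ le) eu subrr.
  have uv : rip u v = 0 by rewrite -eu se ev rip0r.
  have auv : rip (a u) v = 0 by rewrite -eu (abelianE a e)// se ev rip0r.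
  have avu : rip (a v) u = 0 by rewrite sa ripC.
  have hz : h z = u - v by [].
  have := a1 u; have := a1 v; have := ep z; have := em z; rewrite -/u -/v.
  rewrite ripBl ripDl hz zE; clear eu ev hz zE.
  clearbody u v; rewrite (linD _ la) !(ripDl, ripDr, ripBl) uv auv avu.
  rewrite !ripNl (ripC v) uv nm_sqD uv !rip_nm !ler_norml.
  by move=> h1 h2 /andP[h3 h4] /andP[h5 h6]; apply/andP; split; lra.
exists (fun z => (2^-1)%:C *: (h z + s z)); split.
- by apply: (vN_scale _ vD _ (fun z => h z + s z)); exact: vN_add.
- by move=> x y; rewrite ripZl ripZr ripDl ripDr sh ss.
- move=> z; have := s1 z; rewrite (ripBl (a z + a z - h z)) (ripBl (a z + a z)) ripDl (ripBl (a z)).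
  rewrite ripZl (ripDl (h z)) [2^-1 ^+ n.+1]exprS => k.
  have -> : rip (a z) z - 2^-1 * (rip (h z) z + rip (s z) z) =
    2^-1 * (rip (a z) z + rip (a z) z - rip (h z) z - rip (s z) z) by field.
  by rewrite normrM ger0_norm ?invr_ge0// -mulrA ler_wpM2l ?invr_ge0.
- move=> x lx cx; apply/funext => z /=.
  have sz := sc x lx cx; have ez := cx e De pe.
  rewrite (linZ _ lx) (linD _ lx) /h !(linB _ lx).
  rewrite -[x (s z)]/((x \o s) z) sz -[x (e z)]/((x \o e) z) ez.
  by [].
Qed.

(** Self-adjoint elements of [D] are norm limits of combinations of projections
    of [D], and they span [D]. *)
Lemma commutes_with_abelian (x : H -> H) : bop x -> commutes_with_projections x ->
  forall d, D d -> x \o d = d \o x.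
Proof.
move=> bx cx; have lx := bop_linear _ bx; have [X X0 xX] := bop_bound _ bx.
have small_sa a : D a -> self_adjoint a ->
    (forall z, `|rip (a z) z| <= nm z ^+ 2) -> x \o a = a \o x.
  move=> Da sa a1; apply/funext => z /=; apply: eq_of_small => e e0.
  pose L := 2 * X * nm z.
  have L0 : 0 <= L by rewrite !mulr_ge0 ?nm_ge0.
  have e1 : 0 < e / (L + 1) by rewrite divr_gt0//; lra.
  have [n hn] : exists n, 2^-1 ^+ n < e / (L + 1) :> R.
    exists (Num.truncn (e / (L + 1))^-1); set k := Num.truncn _.
    rewrite exprVn invf_plt ?posrE ?exprn_gt0//.
    apply: lt_le_trans (truncnS_gt _) _; rewrite -/k -natrX ler_nat; exact: ltn_expl.
  have [s [Ds ss sn sx]] := spectral_approximation n a Da sa a1.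
  have Dd : D (fun z => a z - s z) by exact: vN_sub.
  have sd : self_adjoint (fun z => a z - s z) by move=> y w; rewrite ripBl ripBr sa ss.
  have c0 : 0 < 2^-1 ^+ n :> R by rewrite exprn_gt0// invr_gt0.
  have dn := sa_numerical_radius _ _ (bop_linear _ (Dbop _ Dd)) sd c0 sn.
  have -> : x (a z) - a (x z) = x (a z - s z) - (a (x z) - s (x z)).
    rewrite (linB _ lx) -[x (s z)]/((x \o s) z) (sx x lx cx) /=.
    by rewrite opprB addrA subrK.
  apply: le_trans (nmD _ _) _; rewrite nmN.
  apply: (@le_trans _ _ (2^-1 ^+ n * L)); last first.
    rewrite ltr_pdivlMr in hn; last lra.
    by apply: ltW; apply: le_lt_trans hn; rewrite ler_wpM2l ?ltW//; lra.
  move: c0 dn; set c := 2^-1 ^+ n => c0 dn.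
  have h1 : nm (x (a z - s z)) <= X * (c * nm z).
    by apply: le_trans (xX _) _; rewrite ler_wpM2l.
  have h2 : nm (a (x z) - s (x z)) <= c * (X * nm z).
    by apply: le_trans (dn _) _; rewrite ler_wpM2l// ltW.
  have -> : c * L = X * (c * nm z) + c * (X * nm z) by rewrite /L; ring.
  exact: lerD.
have all_sa a : D a -> self_adjoint a -> x \o a = a \o x.
  move=> Da sa; have [C C0 aC] := bop_bound _ (Dbop _ Da).
  have c0 : 0 < C + 1 by lra.
  have h : x \o (fun z => ((C + 1)^-1)%:C *: a z) = (fun z => ((C + 1)^-1)%:C *: a z) \o x.
    apply: small_sa; first exact: vN_scale.
      by move=> y w; rewrite ripZl ripZr sa.
    move=> z; rewrite ripZl normrM gtr0_norm ?invr_gt0// ler_pdivrMl//.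
    apply: (@le_trans _ _ (nm (a z) * nm z)).
      rewrite ler_norml cauchy_schwarz andbT lerNl -ripNl -(nmN (a z)).
      exact: cauchy_schwarz.
    rewrite expr2 mulrA ler_wpM2r ?nm_ge0//; apply: le_trans (aC _) _.
    by rewrite ler_wpM2r ?nm_ge0//; lra.
  apply/funext => z; have := congr1 (fun f => f z) h; rewrite /= (linZ _ lx).
  move=> /(congr1 (fun y => (C + 1)%:C *: y)); rewrite !scalerA -rmorphM divff ?gt_eqF//.
  by rewrite !scale1r.
move=> d Dd; have Da := vN_adj _ vD _ Dd.
have bd := Dbop _ Dd; have ld := bop_linear _ bd.
have h1 : x \o (fun z => d z + adj ip d z) = (fun z => d z + adj ip d z) \o x.
  apply: all_sa; first exact: vN_add.
  by move=> y w; rewrite ripDl ripDr (adj_rip _ bd) (adj_ripr _ bd) addrC.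
have h2 : x \o (fun z => 'i *: (d z - adj ip d z)) = (fun z => 'i *: (d z - adj ip d z)) \o x.
  apply: all_sa; first by apply: vN_scale => //; exact: vN_sub.
  move=> y w; rewrite rip_iC ripBl (adj_rip _ bd) -(adj_ripr _ bd) -ripBr -ripNr opprB.
  by rewrite (linZ _ ld) (linZ _ (adj_linear _ bd)) -scalerBr.
apply/funext => z.
have k1 := congr1 (fun f => f z) h1; have k2 := congr1 (fun f => f z) h2.
move: k1 k2; rewrite /= (linZ _ lx) (linD _ lx) (linB _ lx) => k1.
move=> /(congr1 (fun y => - 'i *: y)); rewrite /= !scalerA mulNr -expr2 sqr_i opprK !scale1r => k2.
have := congr2 (fun y w : H => (2^-1)%:C *: (y + w)) k1 k2.
have half (y w : H) : (2^-1)%:C *: ((y + w) + (y - w)) = y.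
  rewrite addrACA subrr addr0 scalerDr -scalerDl -rmorphD.
  by rewrite (_ : 2^-1 + 2^-1 = 1 :> R) ?scale1r//; lra.
by rewrite !half.
Qed.

End Spectral.

(** * The groupoid normalizer *)

Section Normalizer.
Variables (M D : set (H -> H)).
Hypotheses (vM : von_neumann_algebra ip M) (vD : von_neumann_algebra ip D).
Hypotheses (DM : D `<=` M) (abD : abelian D).
Local Notation "a ^!" := (adj ip a).
Local Notation G := (GN_semigroup ip M D).
Local Notation proj_D := [set p | D p /\ projection ip p].
Implicit Types (u v w p q d f : H -> H).

Let Mbop := vN_bop M vM.
Let Dbop := vN_bop D vD.

Let abelianE := abelian_comp_at D abD.

Lemma pisomK v x : bop v -> partial_isometry ip v -> v ((v^!) (v x)) = v x.
Proof.
move=> bv [pp _]; have lv := bop_linear _ bv; have la := adj_linear _ bv.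
apply/eqP; rewrite -subr_eq0 -linB//; apply/eqP/nm_eq0/eqP; rewrite -sqrf_eq0 -rip_nm.
rewrite adj_rip// !(linB _ lv) (linB _ la).
have -> : (v^!) (v ((v^!) (v x))) = (v^!) (v x).
  by rewrite -[LHS]/(((v^! \o v) \o (v^! \o v)) x) pp.
by rewrite subrr rip0r.
Qed.

Lemma pisom_intro v : bop v -> (forall x, v ((v^!) (v x)) = v x) -> partial_isometry ip v.
Proof.
move=> bv vv; split; first by apply/funext => x /=; rewrite vv.
by rewrite adj_comp ?adjK//; exact: adj_bop.
Qed.

Lemma pisom_le v x : bop v -> partial_isometry ip v -> nm (v x) <= nm x.
Proof.
move=> bv pv; apply: nm_le_sq; rewrite -rip_nm adj_rip//.
have bb : bop (v^! \o v) by apply: bop_comp => //; exact: adj_bop.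
rewrite ripC -[(v^!) (v x)]/((v^! \o v) x) proj_nm//.
by rewrite ler_pXn2r ?nnegrE ?nm_ge0// proj_le.
Qed.

Lemma GN_M v : GN ip M D v -> M v. Proof. by case. Qed.
Lemma GN_bop v : GN ip M D v -> bop v. Proof. by move=> /GN_M/Mbop. Qed.
Lemma GN_pisom v : GN ip M D v -> partial_isometry ip v. Proof. by case. Qed.
Lemma GN_K v x : GN ip M D v -> v ((v^!) (v x)) = v x.
Proof. by move=> Gv; apply: pisomK; [exact: GN_bop|exact: GN_pisom]. Qed.

Lemma GN_conj v d : GN ip M D v -> D d -> D (v \o d \o v^!).
Proof. by move=> [_ _ h] Dd; case: (h d Dd). Qed.
Lemma GN_conjV v d : GN ip M D v -> D d -> D (v^! \o d \o v).
Proof. by move=> [_ _ h] Dd; case: (h d Dd). Qed.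
Lemma GN_dom v : GN ip M D v -> D (v^! \o v).
Proof. by move=> Gv; exact: (GN_conjV v id Gv (vN_id D vD)). Qed.
Lemma GN_ran v : GN ip M D v -> D (v \o v^!).
Proof. by move=> Gv; exact: (GN_conj v id Gv (vN_id D vD)). Qed.

Lemma GN_VK v x : GN ip M D v -> (v^!) (v ((v^!) x)) = (v^!) x.
Proof.
move=> Gv; have bv := GN_bop v Gv; apply: rip_inj => z.
rewrite ripC [RHS]ripC -(adj_rip v)// -(adj_rip v)// (adj_ripr v)// -(adj_rip v)//.
by rewrite GN_K.
Qed.

Lemma GN_adj v : GN ip M D v -> GN ip M D (v^!).
Proof.
move=> Gv; have bv := GN_bop v Gv; split.
- by apply: vN_adj => //; exact: GN_M.
- by apply: pisom_intro; [exact: adj_bop|move=> x; rewrite adjK//; exact: GN_VK].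
- by move=> d Dd; rewrite adjK//; split; [exact: GN_conj|exact: GN_conjV].
Qed.

(** The projections [v^! v] and [w w^!] lie in the abelian algebra [D], and it is
    their commuting that makes [v w] a partial isometry. *)
Lemma GN_comp v w : GN ip M D v -> GN ip M D w -> GN ip M D (v \o w).
Proof.
move=> Gv Gw; have bv := GN_bop v Gv; have bw := GN_bop w Gw.
have bvw := bop_comp _ _ bv bw; split.
- by apply: vN_comp => //; exact: GN_M.
- apply: pisom_intro => // x; rewrite adj_comp//=.
  have c y : (v^!) (v (w ((w^!) y))) = w ((w^!) ((v^!) (v y))).
    exact: (abelianE (v^! \o v) (w \o w^!) y (GN_dom v Gv) (GN_ran w Gw)).
  by rewrite -c !GN_K.
- move=> d Dd; rewrite adj_comp//; split.
    exact: (GN_conjV w (v^! \o d \o v) Gw (GN_conjV v d Gv Dd)).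
  exact: (GN_conj v (w \o d \o w^!) Gv (GN_conj w d Gw Dd)).
Qed.

Lemma proj_GN p : D p -> projection ip p -> GN ip M D p.
Proof.
move=> Dp pp; have [pp1 pa] := pp; split; first exact: DM.
  by rewrite /partial_isometry pa pp1.
by move=> d Dd; rewrite pa; split; apply: vN_comp => //; exact: vN_comp.
Qed.

Lemma GN_idempotents : idempotents G = proj_D.
Proof.
apply/seteqP; split=> e /=; last first.
  by move=> [De pe]; split; [exact: proj_GN|case: pe].
move=> [Ge ee]; have be := GN_bop e Ge; have le := bop_linear _ be.
have la := adj_linear _ be.
have eeE x : e (e x) = e x by rewrite -[LHS]/((e \o e) x) [e \o e]ee.
(* an idempotent partial isometry is its own initial projection *)
have eE : e = e^! \o e.
  apply/funext => x; apply/eqP; rewrite -subr_eq0; apply/eqP/nm_eq0/eqP.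
  rewrite -sqrf_eq0 -rip_nm ripBr; apply/eqP.
  have h1 y : rip y (((e^!) \o e) x) = rip (e y) (e x) by rewrite /= -adj_rip.
  rewrite h1 linB// eeE /=.
  rewrite GN_K// subrr rip0l subr0 ripBl rip_nm /= ripC adj_ripr ?adjK//.
    by rewrite eeE rip_nm subrr.
  exact: adj_bop.
split; first by rewrite eE; exact: GN_dom.
by split; [exact: ee|rewrite {1}eE adj_comp ?adjK -?eE//; exact: adj_bop].
Qed.

Lemma GN_inverse_semigroup : inverse_semigroup G.
Proof.
apply: inverse_semigroup_of_commuting_idempotents.
- exact: GN_comp.
- by [].
- move=> s Gs; split; first exact: GN_adj.
    by apply/funext => x /=; exact: GN_K.
  by apply/funext => x /=; exact: GN_VK.
- by rewrite GN_idempotents => e f [De _] [Df _]; exact: abD.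
Qed.

Lemma id_proj : projection ip id.
Proof. by split=> //; exact: adj_id. Qed.

Lemma GN_unit : is_unit G id.
Proof. by split=> // ; apply: proj_GN; [exact: vN_id|exact: id_proj]. Qed.

Lemma GN_inverse_monoid : inverse_monoid G.
Proof. by split; [exact: GN_inverse_semigroup|exists id; exact: GN_unit]. Qed.

Lemma adj0 : adj ip (fun=> 0) = (fun=> 0).
Proof. by apply: adj_eq => [c x y|x y]; rewrite ?scaler0 ?addr0// rip0l rip0r. Qed.

Lemma GN_zero : is_zero G (fun=> 0).
Proof.
split; first by apply: proj_GN; [exact: vN_zero|split=> //; exact: adj0].
move=> s Gs; split=> //; apply/funext => x /=; apply: lin0.
exact/bop_linear/GN_bop.
Qed.

Definition proj_co p : H -> H := fun x => x - p x.

Lemma proj_co_proj p : bop p -> projection ip p -> projection ip (proj_co p).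
Proof.
move=> bp pp; have lp := bop_linear _ bp.
have bi : bop (proj_co p).
  rewrite /proj_co (_ : (fun x => _) = (fun x => id x + -1 *: p x)).
    by apply: bop_add; [exact: bop_id|exact: bop_scale].
  by apply/funext => x; rewrite scaleN1r.
split; first by apply/funext => x; rewrite /proj_co /= linB// proj_idem// subrr subr0.
apply: adj_eq; first exact: bop_linear.
by move=> x y; rewrite /proj_co ripBl ripBr proj_sym.
Qed.

Lemma proj_co_idem p : idempotents G p -> idempotents G (proj_co p).
Proof.
rewrite GN_idempotents => -[Dp pp]; split; last by apply: proj_co_proj => //; exact: Dbop.
by apply: (vN_sub D vD id) => //; exact: vN_id.
Qed.

Lemma proj_coK p : proj_co (proj_co p) = p.
Proof. by apply/funext => x; rewrite /proj_co subKr. Qed.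

Lemma proj_co_le p q : idempotents G p -> idempotents G q ->
  smul G q p = (fun=> 0) <-> smul G q (proj_co p) = q.
Proof.
rewrite GN_idempotents => -[Dp _] [Dq _] /=; have lq := bop_linear _ (Dbop _ Dq).
split=> h; apply/funext => x.
  rewrite /proj_co /= linB// -[X in _ - X]/((q \o p) x) h subr0//.
have := congr1 (@^~ x) h; rewrite /proj_co /= linB// => /eqP.
by rewrite subr_eq addrC -subr_eq subrr => /eqP <-.
Qed.

Lemma proj_leP p q : idempotents G p -> idempotents G q ->
  natural_le G p q <-> forall x, q (p x) = p x.
Proof.
move=> Ep Eq; split.
  move=> /(idem_leP GN_inverse_semigroup _ _ Ep Eq) h x.
  by rewrite -[LHS]/(smul G q p x) h.
by move=> h; apply/(idem_leP GN_inverse_semigroup) => //; exact: funext.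
Qed.

(** The supremum of a set of projections of [D] projects onto the orthogonal
    complement of the intersection of their kernels. *)
Definition common_kernel (X : set (H -> H)) : set H := [set x | forall p, X p -> p x = 0].

Lemma common_kernel_closed X : X `<=` proj_D -> closed_subspace (common_kernel X).
Proof.
move=> XE; have lX p : X p -> linear p by move=> /XE[Dp _]; exact/bop_linear/Dbop.
split; first split.
- by move=> p Xp; rewrite lin0//; exact: lX.
- by move=> x y Kx Ky p Xp; rewrite linD ?Kx ?Ky ?addr0//; exact: lX.
- by move=> c x Kx p Xp; rewrite linZ ?Kx ?scaler0//; exact: lX.
move=> x xK p Xp; have [Dp pp] := XE p Xp.
apply: eq_of_small => e e0; have [y Ky xy] := xK e e0.
rewrite -(Ky p Xp) -linB; last exact: lX.
by apply: ltW; apply: le_lt_trans xy; apply: proj_le => //; exact: Dbop.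
Qed.

Definition proj_sup X := proj_co (orth_proj (common_kernel X)).

Lemma proj_sup_lub X : X `<=` idempotents G ->
  is_lub (idempotents G) (natural_le G) X (proj_sup X).
Proof.
move=> XE0; have XE : X `<=` proj_D by rewrite -GN_idempotents.
have cK := common_kernel_closed X XE; set K := common_kernel X in cK.
have EP : idempotents G (orth_proj K).
  rewrite GN_idempotents; split; last exact: orth_proj_projection.
  apply: vN_orth_proj => // b [bb bD] x Kx p Xp; have [Dp _] := XE p Xp.
  rewrite -[p (b x)]/((p \o b) x) bD//= Kx//; apply: lin0; exact: bop_linear.
have Es : idempotents G (proj_sup X) by exact: proj_co_idem.
have bP := orth_proj_bop K cK.
split=> // [p Xp|q Eq qub].
  have Ep := XE0 p Xp; have [Dp pp] := XE p Xp; have bp := Dbop _ Dp.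
  apply/proj_leP => // x; rewrite /proj_sup /proj_co.
  rewrite (_ : orth_proj K (p x) = 0) ?subr0//; apply: rip_inj => z.
  rewrite rip0l orth_proj_sym// proj_sym//.
  by have [/(_ p Xp) -> _] := orth_projP K cK z; rewrite rip0r.
have := Eq; rewrite GN_idempotents => -[Dq qq].
have bq := Dbop _ Dq; have lq := bop_linear _ bq.
apply/proj_leP => // x; rewrite /proj_sup /proj_co.
set y := x - _; apply/eqP; rewrite -subr_eq0 -oppr_eq0 opprB; apply/eqP.
(* y - q y lies in the common kernel, to which y is orthogonal *)
have Kyq : K (y - q y).
  move=> p Xp; have Ep := XE0 p Xp; have [Dp pp] := XE p Xp; have bp := Dbop _ Dp.
  have /proj_leP-/(_ Ep Eq) qp := qub p Xp.
  rewrite linB; last exact: bop_linear.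
  by rewrite (abelianE p q y Dp Dq) qp subrr.
apply/nm_eq0/eqP; rewrite -sqrf_eq0 -rip_nm ripBl.
have [_ PP] := orth_projP K cK x; rewrite (PP _ Kyq) sub0r oppr_eq0.
by rewrite proj_sym// linB// proj_idem// subrr rip0r.
Qed.

(** Vector functionals are order continuous on projections: along an upward
    directed set the vectors [p x] converge, and the limit is [e x]. *)
Lemma proj_sup_normal (X : set (H -> H)) (e : H -> H) x :
  X `<=` idempotents G -> X !=set0 ->
  (forall p q, X p -> X q ->
     exists r : H -> H, [/\ X r, natural_le G p r & natural_le G q r]) ->
  is_lub (idempotents G) (natural_le G) X e -> forall eps : R, 0 < eps ->
  exists2 p, X p & rip (e x) x <= rip (p x) x + eps.
Proof.
move=> XE0 X0 dirX lube eps eps0.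
have XE : X `<=` proj_D by rewrite -GN_idempotents.
pose le p q := forall y : H, q (p y) = p y.
have ledir p q : X p -> X q -> exists r : H -> H, [/\ X r, le p r & le q r].
  move=> Xp Xq; have [r [Xr pr qr]] := dirX p q Xp Xq; exists r.
  by split=> //; apply/proj_leP => //; exact: XE0.
have bX p : X p -> bop p by move=> /XE[Dp _]; exact: Dbop.
have pX p : X p -> projection ip p by move=> /XE[].
have cX p q y : X p -> X q -> p (q y) = q (p y).
  by move=> /XE[Dp _] /XE[Dq _]; exact: (abelianE p q y Dp Dq).
have lX p : X p -> linear p by move=> /bX/bop_linear.
have nX p y : X p -> rip (p y) y = nm (p y) ^+ 2.
  by move=> Xp; apply: proj_nm; [exact: bX|exact: pX].
have cX2 p q y : X p -> X q -> le p q -> rip (q y) (p y) = nm (p y) ^+ 2.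
  move=> Xp Xq pq; rewrite (proj_sym q) ?pq; [|exact: bX|exact: pX].
  by rewrite ripC nX.
have NB p : X p -> rip (p x) x <= nm x ^+ 2.
  move=> Xp; rewrite nX// ler_pXn2r ?nnegrE ?nm_ge0//.
  by apply: proj_le; [exact: bX|exact: pX].
have NI p q : X p -> X q -> le p q ->
    nm (q x - p x) ^+ 2 <= rip (q x) x - rip (p x) x.
  by move=> Xp Xq pq; rewrite (nX p)// (nX q)// nm_sqB cX2//; lra.
have [z zP] := monotone_cauchy _ X le X0 ledir (fun p => p x) _ _ NB NI.
have [Ee ub _] := lube; have := Ee; rewrite GN_idempotents => -[De ee].
have be := Dbop _ De; have le_ := bop_linear _ be.
have eX p y : X p -> e (p y) = p y.
  by move=> Xp; apply: (proj_leP _ _ _ _).1 => //; [exact: XE0|exact: ub].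
have ez : e z = z.
  apply: eq_of_small => d d0; have d2 : 0 < d / 2 by rewrite divr_gt0.
  have [j Xj hj] := zP _ d2; have jj : le j j by move=> y; apply: proj_idem; exact: pX.
  have h := hj j Xj jj; apply: le_trans (nm_triangle (j x) _ _) _.
  have : nm (e z - j x) <= nm (j x - z).
    by rewrite -{1}(eX j x Xj) -(linB e)// (nmB (j x)); exact: proj_le.
  by lra.
have pz p : X p -> p x = p z.
  move=> Xp; apply: eq_of_small => d d0; have [j Xj hj] := zP _ d0.
  have [k [Xk jk pk]] := ledir j p Xj Xp.
  have -> : p x = p (k x) by rewrite (cX p k x)// pk.
  rewrite -linB; last exact: lX.
  apply: ltW; apply: le_lt_trans (hj k Xk jk).
  by apply: proj_le; [exact: bX|exact: pX].
have ex : e x = z.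
  have eE : e = proj_sup X.
    apply: (lub_uniq GN_inverse_semigroup _ _ _ _ _ lube (proj_sup_lub X XE0)).
    by move=> f [].
  have : e (x - z) = 0.
    have cK := common_kernel_closed X XE.
    rewrite eE /proj_sup /proj_co orth_proj_id ?subrr// => p Xp.
    by rewrite linB ?pz ?subrr//; exact: lX.
  by rewrite linB// ez => /eqP; rewrite subr_eq0 => /eqP.
have nx := nm_ge0 x.
have d0 : 0 < eps / (nm x + 1) by rewrite divr_gt0//; lra.
have [j Xj hj] := zP _ d0; have jj : le j j by move=> y; apply: proj_idem; exact: pX.
exists j => //; rewrite ex -lerBlDl -ripBl; apply: le_trans (cauchy_schwarz _ _) _.
have h := hj j Xj jj; rewrite nmB.
apply: (@le_trans _ _ (eps / (nm x + 1) * (nm x + 1))); last by rewrite divfK ?gt_eqF//; lra.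
by apply: ler_pM; rewrite ?nm_ge0 ?ltW//; lra.
Qed.

Lemma adj_add u w : bop u -> bop w -> adj ip (fun x => u x + w x) = (fun x => (u^!) x + (w^!) x).
Proof.
move=> bu bw; apply: adj_eq; first exact/bop_linear/bop_add.
by move=> x y; rewrite ripDl ripDr !adj_rip.
Qed.

Lemma orth_adjoint u w : bop u -> bop w -> (forall x, (u^!) (w x) = 0) ->
  forall x, (w^!) (u x) = 0.
Proof.
move=> bu bw uw x; apply: rip_inj => z.
by rewrite rip0l -adj_ripr// adj_rip// uw rip0r.
Qed.

(** [d] commutes with the range projection [u u^!], which absorbs [u^!]. *)
Lemma GN_cross u w d x : GN ip M D u -> bop w -> (forall x, (u^!) (w x) = 0) -> D d ->
  (u^!) (d (w x)) = 0.
Proof.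
move=> Gu bw uw Dd; have bu := GN_bop u Gu.
have c y : d (u ((u^!) y)) = u ((u^!) (d y)).
  exact: (abelianE d (u \o u^!) y Dd (GN_ran u Gu)).
rewrite -GN_VK// -c uw !lin0//; [exact: adj_linear|exact/bop_linear/Dbop|exact: bop_linear].
Qed.

(** Orthogonality kills the cross terms [u^! d w] and [u d w^!]. *)
Lemma GN_orth_add u w : GN ip M D u -> GN ip M D w ->
  (forall x, (u^!) (w x) = 0) -> (forall x, u ((w^!) x) = 0) ->
  GN ip M D (fun x => u x + w x).
Proof.
move=> Gu Gw uw uw'; have bu := GN_bop u Gu; have bw := GN_bop w Gw.
have ba := adj_bop u bu; have bb := adj_bop w bw.
have lu := bop_linear _ bu; have lw := bop_linear _ bw.
have la := bop_linear _ ba; have lb := bop_linear _ bb.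
have buw := bop_add _ _ bu bw.
have wu x : (w^!) (u x) = 0 by exact: orth_adjoint.
have wu' x : w ((u^!) x) = 0.
  by rewrite -{1}(adjK w bw); apply: orth_adjoint => // y; rewrite adjK.
split.
- by apply: (vN_add M vM); exact: GN_M.
- apply: pisom_intro => // x; rewrite adj_add//.
  rewrite !(linD _ la) !(linD _ lb) uw wu addr0 add0r !(linD _ lu) !(linD _ lw).
  by rewrite uw' wu' addr0 add0r !GN_K.
move=> d Dd; have ld := bop_linear _ (Dbop _ Dd); rewrite adj_add//; split.
  rewrite (_ : _ \o _ = (fun x => (u^! \o d \o u) x + (w^! \o d \o w) x)).
    by apply: (vN_add D vD); exact: GN_conjV.
  apply/funext => x /=; rewrite !(linD _ ld) !(linD _ la) !(linD _ lb).
  by rewrite (GN_cross u w)// (GN_cross w u)// addr0 add0r.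
rewrite (_ : _ \o _ = (fun x => (u \o d \o u^!) x + (w \o d \o w^!) x)).
  by apply: (vN_add D vD); exact: GN_conj.
apply/funext => x /=; rewrite !(linD _ ld) !(linD _ lu) !(linD _ lw).
have c1 : u (d ((w^!) x)) = 0.
  rewrite -{1}(adjK u bu); apply: GN_cross => //; first exact: GN_adj.
  by move=> y; rewrite adjK.
have c2 : w (d ((u^!) x)) = 0.
  rewrite -{1}(adjK w bw); apply: GN_cross => //; first exact: GN_adj.
  by move=> y; rewrite adjK.
by rewrite c1 c2 addr0 add0r.
Qed.

(** The adjoints are made to converge as well, since taking adjoints is not
    strongly continuous. *)
Lemma GN_slim (J : Type) (S : set J) lej (a b : J -> H -> H) v w :
  S !=set0 -> (forall i j k, lej i j -> lej j k -> lej i k) -> (forall i, lej i i) ->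
  (forall i j, S i -> S j -> exists k, [/\ S k, lej i k & lej j k]) ->
  (forall j, S j -> GN ip M D (a j)) -> (forall j, S j -> b j = adj ip (a j)) ->
  slim J S lej a v -> slim J S lej b w -> GN ip M D v /\ v^! = w.
Proof.
move=> S0 St Sr Sd aG bE av bw.
have ab j : S j -> bop (a j) by move=> Sj; exact: GN_bop (aG j Sj).
have bG j : S j -> GN ip M D (b j) by move=> Sj; rewrite bE//; apply: GN_adj; exact: aG.
have bb j : S j -> bop (b j) by move=> Sj; exact: GN_bop (bG j Sj).
have la j : S j -> linear (a j) by move=> /ab/bop_linear.
have lb j : S j -> linear (b j) by move=> /bb/bop_linear.
have a1 j x : S j -> nm (a j x) <= 1 * nm x.
  by move=> Sj; rewrite mul1r; apply: pisom_le; [exact: ab|exact: GN_pisom (aG j Sj)].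
have b1 j x : S j -> nm (b j x) <= 1 * nm x.
  by move=> Sj; rewrite mul1r; apply: pisom_le; [exact: bb|exact: GN_pisom (bG j Sj)].
have vw : v^! = w.
  apply: (slim_adj J S lej St Sr Sd a b v w 1 ler01 la a1 _ av bw).
  by move=> j x y Sj; rewrite bE// adj_rip//; exact: ab.
have Mv : M v.
  by apply: (vN_slim M vM J S lej a v 1 S0 St Sr Sd ler01 a1 _ av) => j /aG/GN_M.
have ba_s := slim_comp J S lej St Sd _ _ _ _ 1 ler01 lb b1 bw av.
have aba_s := slim_comp J S lej St Sd _ _ _ _ 1 ler01 la a1 av ba_s.
split=> //; split=> //.
  apply: pisom_intro; first exact: Mbop.
  rewrite vw => x; rewrite -[LHS]/((v \o (w \o v)) x); congr (_ x).
  apply: (slim_uniq J S lej Sd _ _ _ _ _ aba_s av) => j Sj.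
  by apply/funext => y /=; rewrite bE// GN_K//; exact: aG.
move=> d Dd; have bd := Dbop _ Dd; have ld := bop_linear _ bd.
have [C C0 dC] := bop_bound _ bd.
have sd := slim_cst J S lej S0 d.
have dS j : S j -> linear d by [].
have dC' (j : J) x : S j -> nm (d x) <= C * nm x by [].
have da_s := slim_comp J S lej St Sd _ _ _ _ C C0 dS dC' sd av.
have db_s := slim_comp J S lej St Sd _ _ _ _ C C0 dS dC' sd bw.
have bda_s := slim_comp J S lej St Sd _ _ _ _ 1 ler01 lb b1 bw da_s.
have adb_s := slim_comp J S lej St Sd _ _ _ _ 1 ler01 la a1 av db_s.
rewrite vw; split.
  apply: (vN_slim D vD J S lej _ _ C S0 St Sr Sd C0 _ _ bda_s).
    move=> j x Sj /=; apply: le_trans (b1 j _ Sj) _; rewrite mul1r.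
    by apply: le_trans (dC _) _; rewrite ler_wpM2l//; have := a1 j x Sj; rewrite mul1r.
  by move=> j Sj; rewrite bE//; exact: (GN_conjV (a j) d (aG j Sj) Dd).
apply: (vN_slim D vD J S lej _ _ C S0 St Sr Sd C0 _ _ adb_s).
  move=> j x Sj /=; apply: le_trans (a1 j _ Sj) _; rewrite mul1r.
  by apply: le_trans (dC _) _; rewrite ler_wpM2l//; have := b1 j x Sj; rewrite mul1r.
by move=> j Sj; rewrite bE//; exact: (GN_conj (a j) d (aG j Sj) Dd).
Qed.

Section OrthogonalJoin.
Variable V : set (H -> H).
Hypothesis VG : V `<=` GN ip M D.
Hypothesis orthV : forall v w, V v -> V w -> v <> w ->
  Defs.orthogonal G (fun=> 0) v w.
(** Finite sums are indexed by operators, which needs decidable equality. *)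
Let I := {classic (H -> H)}.
Implicit Types (l m : seq I).

Let orth1 v w x : V v -> V w -> v <> w -> (v^!) (w x) = 0.
Proof. by move=> Vv Vw vw; case: (orthV v w Vv Vw vw) => /(congr1 (@^~ x)). Qed.
Let orth2 v w x : V v -> V w -> v <> w -> v ((w^!) x) = 0.
Proof. by move=> Vv Vw vw; case: (orthV v w Vv Vw vw) => _ /(congr1 (@^~ x)). Qed.

Definition fsum l x : H := \sum_(v <- l) (v : H -> H) x.
Definition fsum_adj l x : H := \sum_(v <- l) ((v : H -> H)^!) x.
Definition finite_part : set (seq I) := [set l | uniq l /\ forall v, v \in l -> V v].
Definition sub_part l m : Prop := {subset l <= m}.

Let bV v : V v -> bop v. Proof. by move=> /VG/GN_bop. Qed.

Lemma finite_part_cons (v : I) l : finite_part (v :: l) -> [/\ V v, v \notin l & finite_part l].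
Proof.
move=> [/andP[vl ul] lV]; split=> //; first by apply: lV; rewrite inE eqxx.
by split=> // w wl; apply: lV; rewrite inE wl orbT.
Qed.

Lemma fsum_orth l w x : finite_part l -> V w -> w \notin (l : seq I) ->
  [/\ (w^!) (fsum l x) = 0, w (fsum_adj l x) = 0, fsum l ((w^!) x) = 0
    & fsum_adj l (w x) = 0].
Proof.
move=> + Vw; have bw := bV w Vw.
elim: l => [|v l IH].
  by move=> _ _; rewrite /fsum /fsum_adj !big_nil !lin0//; [exact: bop_linear|exact: adj_linear].
move=> /finite_part_cons[Vv vl Fl]; rewrite inE negb_or => /andP[wv wl].
have [h1 h2 h3 h4] := IH Fl wl; have nwv : w <> v by apply/eqP.
have nvw : v <> w by move=> e; apply: nwv.
rewrite /fsum /fsum_adj !big_cons -!/(fsum l _) -!/(fsum_adj l _).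
rewrite h3 h4 !linD ?h1 ?h2; [|exact: bop_linear|exact: adj_linear].
by rewrite !(orth1 _ _ _ Vw Vv)// !(orth2 _ _ _ Vw Vv)// !(orth1 _ _ _ Vv Vw)// !(orth2 _ _ _ Vv Vw)// !addr0.
Qed.

Lemma fsum_GN l : finite_part l -> GN ip M D (fsum l) /\ (fsum l)^! = fsum_adj l.
Proof.
elim: l => [_|v l IH /finite_part_cons[Vv vl Fl]].
  have -> : fsum [::] = (fun=> 0) by apply/funext => x; rewrite /fsum big_nil.
  have -> : fsum_adj [::] = (fun=> 0) by apply/funext => x; rewrite /fsum_adj big_nil.
  by split; [case: GN_zero|exact: adj0].
have [GF FE] := IH Fl; have Gv := VG v Vv.
have -> : fsum (v :: l) = (fun x => (v : H -> H) x + fsum l x).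
  by apply/funext => x; rewrite /fsum big_cons.
have -> : fsum_adj (v :: l) = (fun x => ((v : H -> H)^!) x + fsum_adj l x).
  by apply/funext => x; rewrite /fsum_adj big_cons.
split; last by rewrite adj_add ?FE//; [exact: bV|exact: GN_bop GF].
apply: GN_orth_add => // x; first by have [] := fsum_orth l v x Fl Vv vl.
by rewrite FE; have [] := fsum_orth l v x Fl Vv vl.
Qed.

Lemma finite_part_split l m : finite_part l -> finite_part m -> sub_part l m ->
  exists k, [/\ finite_part k, forall v, v \in k -> v \notin (l : seq I),
    forall x, fsum m x = fsum l x + fsum k x
  & forall x, fsum_adj m x = fsum_adj l x + fsum_adj k x].
Proof.
move=> [ul lV] [um mV] lm; exists [seq v <- m | v \notin l].
have pm : perm_eq m (l ++ [seq v <- m | v \notin l]).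
  apply: uniq_perm => //.
    rewrite cat_uniq ul filter_uniq// andbT; apply/hasPn => v.
    by rewrite mem_filter => /andP[].
  move=> v; rewrite mem_cat mem_filter; case: (boolP (v \in l)) => //= vl.
  exact: lm.
split.
- split; first exact: filter_uniq.
  by move=> v; rewrite mem_filter => /andP[_ /mV].
- by move=> v; rewrite mem_filter => /andP[].
- by move=> x; rewrite /fsum (perm_big _ pm) big_cat.
- by move=> x; rewrite /fsum_adj (perm_big _ pm) big_cat.
Qed.

Lemma finite_part_dir l m : finite_part l -> finite_part m ->
  exists k, [/\ finite_part k, sub_part l k & sub_part m k].
Proof.
move=> [ul lV] [um mV]; exists (undup (l ++ m)); split.
- split; first exact: undup_uniq.
  by move=> v; rewrite mem_undup mem_cat => /orP[/lV|/mV].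
- by move=> v vl; rewrite mem_undup mem_cat vl.
- by move=> v vl; rewrite mem_undup mem_cat vl orbT.
Qed.

(** The finite partial sums of an orthogonal family converge strongly, since their
    squared norms at a vector increase by Pythagoras and stay bounded. *)
Lemma fsum_slim : exists v w, [/\ GN ip M D v, v^! = w,
  slim _ finite_part sub_part fsum v & slim _ finite_part sub_part fsum_adj w].
Proof.
have F0 : finite_part !=set0 by exists [::]; split.
have Ft l m k : sub_part l m -> sub_part m k -> sub_part l k by move=> lm mk v /lm/mk.
have Fr l : sub_part l l by [].
have rip_fsum k x y : (forall v, v \in (k : seq I) -> rip y ((v : H -> H) x) = 0) ->
    rip y (fsum k x) = 0.
  rewrite /fsum; elim: k => [|v k IH] h; first by rewrite big_nil rip0r.
  rewrite big_cons ripDr h ?inE ?eqxx// add0r IH// => w wk.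
  by apply: h; rewrite inE wk orbT.
have rip_fsum_adj k x y : (forall v, v \in (k : seq I) -> rip y (((v : H -> H)^!) x) = 0) ->
    rip y (fsum_adj k x) = 0.
  rewrite /fsum_adj; elim: k => [|v k IH] h; first by rewrite big_nil rip0r.
  rewrite big_cons ripDr h ?inE ?eqxx// add0r IH// => w wk.
  by apply: h; rewrite inE wk orbT.
have incr l m x : finite_part l -> finite_part m -> sub_part l m ->
    nm (fsum m x - fsum l x) ^+ 2 <= nm (fsum m x) ^+ 2 - nm (fsum l x) ^+ 2.
  move=> Fl Fm lm; have [k [Fk kl kE _]] := finite_part_split l m Fl Fm lm.
  rewrite kE addrC addKr nm_sqD (rip_fsum k); first by rewrite mulr0 addr0; lra.
  move=> v vk; have Vv := Fk.2 v vk; rewrite adj_ripr; last exact: bV.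
  by have [-> _ _ _] := fsum_orth l v x Fl Vv (kl v vk); rewrite rip0l.
have incr_adj l m x : finite_part l -> finite_part m -> sub_part l m ->
    nm (fsum_adj m x - fsum_adj l x) ^+ 2 <= nm (fsum_adj m x) ^+ 2 - nm (fsum_adj l x) ^+ 2.
  move=> Fl Fm lm; have [k [Fk kl _ kE]] := finite_part_split l m Fl Fm lm.
  rewrite kE addrC addKr nm_sqD (rip_fsum_adj k); first by rewrite mulr0 addr0; lra.
  move=> v vk; have Vv := Fk.2 v vk; rewrite -adj_rip; last exact: bV.
  by have [_ -> _ _] := fsum_orth l v x Fl Vv (kl v vk); rewrite rip0l.
have [v fv] : exists v, slim _ finite_part sub_part fsum v.
  apply: slim_exists => x.
  apply: (monotone_cauchy _ _ _ F0 finite_part_dir (fun l => fsum l x)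
    (fun l => nm (fsum l x) ^+ 2) (nm x ^+ 2)) => [l Fl|l m Fl Fm lm]; last exact: incr.
  have [GF _] := fsum_GN l Fl; rewrite ler_pXn2r ?nnegrE ?nm_ge0//.
  by apply: pisom_le; [exact: GN_bop GF|exact: GN_pisom GF].
have [w fw] : exists w, slim _ finite_part sub_part fsum_adj w.
  apply: slim_exists => x.
  apply: (monotone_cauchy _ _ _ F0 finite_part_dir (fun l => fsum_adj l x)
    (fun l => nm (fsum_adj l x) ^+ 2) (nm x ^+ 2)) => [l Fl|l m Fl Fm lm]; last exact: incr_adj.
  have [/GN_adj + FE] := fsum_GN l Fl; rewrite FE => GF.
  rewrite ler_pXn2r ?nnegrE ?nm_ge0//.
  by apply: pisom_le; [exact: GN_bop GF|exact: GN_pisom GF].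
exists v, w; have [] // := GN_slim _ finite_part sub_part fsum fsum_adj v w F0 Ft Fr
  finite_part_dir _ _ fv fw.
- by move=> l /fsum_GN[].
- by move=> l /fsum_GN[].
Qed.

(** An upper bound [y] satisfies [f = y f^! f] for each finite partial sum [f],
    and this passes to the strong sum. *)
Lemma GN_orthogonal_join : has_join G V.
Proof.
have invG := GN_inverse_semigroup.
have F0 : finite_part !=set0 by exists [::]; split.
have Ft l m k : sub_part l m -> sub_part m k -> sub_part l k by move=> lm mk v /lm/mk.
have [v [w [Gv vw fv fw]]] := fsum_slim; exists v; split=> //.
  move=> u Vu; have Gu := VG u Vu; apply/(natural_leP invG) => //.
  apply/funext => x /=; apply: eq_of_small => e e0.
  have [j Fj hj] := fv ((u^!) (u x)) e e0.
  have Fu : finite_part [:: u] by split=> // z; rewrite inE => /eqP ->.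
  have [k [Fk jk uk]] := finite_part_dir j [:: u] Fj Fu.
  have := hj k Fk jk; have [r [Fr rl rE _]] := finite_part_split [:: u] k Fu Fk uk.
  have ur : u \notin (r : seq I).
    by apply/negP => /rl; rewrite inE eqxx.
  rewrite rE; have [_ _ -> _] := fsum_orth r u (u x) Fr Vu ur.
  by rewrite /fsum big_seq1 addr0 GN_K// => /ltW.
move=> y Gy yub; apply/(natural_leP invG) => //.
have ly := bop_linear _ (GN_bop y Gy).
have part l x : finite_part l -> fsum l x = y (fsum_adj l (fsum l x)).
  elim: l => [_|u l IH /finite_part_cons[Vu ul Fl]].
    by rewrite /fsum /fsum_adj !big_nil lin0.
  have Gu := VG u Vu; have lu := adj_linear _ (bV u Vu).
  have /(natural_leP invG)-/(_ Gu Gy)/(congr1 (@^~ x)) /= uy := yub u Vu.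
  have [GF FE] := fsum_GN l Fl; have [h1 _ _ h4] := fsum_orth l u x Fl Vu ul.
  have lF : linear (fsum_adj l) by rewrite -FE; apply: adj_linear; exact: GN_bop GF.
  rewrite [fsum (u :: l) x]/fsum big_cons -/(fsum l x).
  rewrite /fsum_adj big_cons -/(fsum_adj l _) (linD _ lu) (linD _ lF) h1 h4.
  by rewrite addr0 add0r (linD _ ly) -uy -IH.
have l1 x j : finite_part j -> nm (fsum_adj j x) <= 1 * nm x.
  move=> Fj; have [/GN_adj + FE] := fsum_GN j Fj; rewrite FE => GF; rewrite mul1r.
  by apply: pisom_le; [exact: GN_bop GF|exact: GN_pisom GF].
have lF j : finite_part j -> linear (fsum_adj j).
  by move=> Fj; have [GF FE] := fsum_GN j Fj; rewrite -FE; apply: adj_linear; exact: GN_bop GF.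
have s1 := slim_comp _ _ _ Ft finite_part_dir _ _ _ _ 1 ler01 lF (fun j x => l1 x j) fw fv.
have y1 (j : seq I) x : finite_part j -> nm (y x) <= 1 * nm x.
  by move=> _; rewrite mul1r; apply: pisom_le; [exact: GN_bop Gy|exact: GN_pisom Gy].
have s2 := slim_comp _ _ _ Ft finite_part_dir _ _ _ _ 1 ler01 (fun _ _ => ly) y1
  (slim_cst _ _ _ F0 y) s1.
rewrite /= vw; symmetry.
apply: (slim_uniq _ _ _ finite_part_dir _ _ _ _ _ s2 fv) => j Fj.
by apply/funext => x /=; rewrite -part.
Qed.

End OrthogonalJoin.

(** Orthogonal projections [a] and [b] of [D] have supremum [a + b], whence
    additivity; order continuity is [proj_sup_normal]. *)
Lemma vector_weight_normal x :
  normal_weight (idempotents G) (natural_le G) R (fun p => rip (p x) x).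
Proof.
split=> [p|a b o j Ea Eb lo go lj|X e XE X0 dirX lub eps eps0]; last first.
- exact: (proj_sup_normal X e x XE X0 dirX lub eps eps0).
- have [Eo _ o_least] := lo; have [_ o_lower o_greatest] := go; have [Ej j_ub j_least] := lj.
  have Ez : idempotents G (fun=> 0) by split; [case: GN_zero|].
  have o0 y : o y = 0.
    have /(proj_leP o _ Eo Ez)/(_ y) <- // : natural_le G o (fun=> 0) by exact: o_least.
  have := Ea; have := Eb; rewrite GN_idempotents => -[Db pb] [Da pa].
  have := Ej; rewrite GN_idempotents => -[Dj pj].
  have ab y : a (b y) = 0.
    have Eab : idempotents G (a \o b).
      exact: (idem_mul GN_inverse_semigroup a b Ea Eb).
    have : natural_le G (a \o b) o.
      apply: o_greatest => // c [->|->]; apply/proj_leP => // z /=.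
        by rewrite (proj_idem a).
      by rewrite (abelianE b a _ Db Da) (proj_idem b).
    by move=> /(proj_leP _ _ Eab Eo)/(_ y); rewrite o0.
  have ba y : b (a y) = 0 by rewrite (abelianE b a _ Db Da).
  have la := bop_linear _ (Dbop _ Da); have lb := bop_linear _ (Dbop _ Db).
  pose r (y : H) := a y + b y.
  have Dr : D r by exact: vN_add.
  have Er : idempotents G r.
    rewrite GN_idempotents; split=> //; split.
      apply/funext => y; rewrite /r /= (linD _ la) (linD _ lb) ab ba addr0 add0r.
      by rewrite (proj_idem a)// (proj_idem b).
    apply: adj_eq; first exact/bop_linear/Dbop.
    move=> y z; rewrite /r ripDl ripDr (proj_sym a)//; last exact: Dbop.
    by rewrite (proj_sym b)//; exact: Dbop.
  have jr : natural_le G j r.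
    apply: j_least => // c [->|->]; apply/proj_leP => // y; rewrite /r.
      by rewrite (proj_idem a)// ba addr0.
    by rewrite (proj_idem b)// ab add0r.
  have aj y : a (j y) = a y.
    rewrite (abelianE a j _ Da Dj).
    by apply: (proj_leP _ _ Ea Ej).1; apply: j_ub; left.
  have bj y : b (j y) = b y.
    rewrite (abelianE b j _ Db Dj).
    by apply: (proj_leP _ _ Eb Ej).1; apply: j_ub; right.
  have /(_ x) := (proj_leP _ _ Ej Er).1 jr.
  by rewrite /r aj bj => <-; rewrite ripDl.
- by rewrite GN_idempotents => -[Dp pp]; rewrite proj_nm ?sqr_ge0//; exact: Dbop.
Qed.

Lemma munn_quotient_cartan : cartan_inverse_monoid (quotient G (munn G)) R.
Proof.
have invG := GN_inverse_semigroup.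
have complete X : X `<=` idempotents G ->
    exists e : H -> H, is_lub (idempotents G) (natural_le G) X e.
  by move=> XE; exists (proj_sup X); exact: proj_sup_lub.
have coK (e : H -> H) : idempotents G e -> proj_co (proj_co e) = e by move=> _; exact: proj_coK.
split.
- apply: (quotient_complete_boolean_inverse_monoid invG id (fun=> 0) proj_co) => //.
  + exact: GN_unit.
  + exact: GN_zero.
  + exact: proj_co_idem.
  + exact: proj_co_le.
  + exact: GN_orthogonal_join.
- exact: quotient_fundamental.
- apply: (quotient_hyperstonean _ G id (fun=> 0) proj_co) => //.
  + exact: GN_unit.
  + exact: GN_zero.
  + exact: proj_co_idem.
  + exact: proj_co_le.
  move=> e Ee e0; have [x ex] : exists x, e x <> 0.
    by apply/existsNP => h; apply: e0; apply/funext => y; exact: h.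
  exists (fun p => rip (p x) x); first exact: vector_weight_normal.
  move: Ee; rewrite GN_idempotents => -[De pe].
  rewrite proj_nm//; last exact: Dbop.
  rewrite exprn_gt0// lt_neqAle nm_ge0 andbT eq_sym.
  by apply/eqP => /nm_eq0.
Qed.

End Normalizer.

(** * Cartan triples *)

Section CartanTriple.
Variables (M N D : set (H -> H)).
Hypothesis MND : cartan_triple ip M N D.
Local Notation G := (GN_semigroup ip M D).
Local Notation P := (GN_semigroup ip N D).

Let vM : von_neumann_algebra ip M. Proof. by case: MND => -[]. Qed.
Let vN : von_neumann_algebra ip N. Proof. by case: MND => -[]. Qed.
Let vD : von_neumann_algebra ip D. Proof. by case: MND => -[_ _ []]. Qed.
Let DM : D `<=` M. Proof. by case: MND => -[_ _ []]. Qed.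
Let abD : abelian D. Proof. by case: MND => _ []. Qed.
Let NE : N = M `&` commutant D. Proof. by case: MND. Qed.

Lemma cartan_sub : D `<=` N.
Proof.
rewrite NE => d Dd; split; first exact: DM.
by split; [exact: (vN_bop D vD)|move=> x Dx; exact: abD].
Qed.

Lemma cartan_clifford : clifford_inverse_monoid ip N P.
Proof.
split; first exact: (GN_inverse_monoid N D vN vD cartan_sub abD).
exists D => //; split=> // d Dd; split; first exact: cartan_sub.
split; first exact: (vN_bop D vD).
by move=> x; rewrite NE => -[_ [_ xD]]; rewrite xD.
Qed.

Lemma cartan_normalizer_sub : carrier P `<=` carrier G.
Proof. by move=> v [+ pv vD']; rewrite NE => -[Mv _]; split. Qed.

Lemma cartan_idempotents : idempotents P = idempotents G.
Proof.
by rewrite (GN_idempotents M D vM vD DM) (GN_idempotents N D vN vD cartan_sub).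
Qed.

(** Both sides say that [v] commutes with the projections of [D]. *)
Lemma cartan_munn_kernel : carrier P =
  [set v | carrier G v /\ exists2 e : H -> H, idempotents G e & munn G v e].
Proof.
have invG := GN_inverse_semigroup M D vM vD DM abD.
have GE := GN_idempotents M D vM vD DM.
apply/seteqP; split=> v /=.
  move=> Pv; have Gv := cartan_normalizer_sub v Pv; split=> //.
  apply/(munn_idemP invG v Gv) => f; rewrite GE => -[Df _] /=.
  by case: Pv; rewrite NE => -[_ [_ ->]].
move=> [Gv /(munn_idemP invG v Gv) comm]; have [Mv pv vDv] := Gv; split=> //.
rewrite NE; split=> //; split; first exact: (vN_bop M vM).
move=> d Dd; rewrite -(commutes_with_abelian D vD abD v)//; first exact: (vN_bop M vM).
by move=> p Dp pp; apply: comm; rewrite GE.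
Qed.

End CartanTriple.

End Hilbert.

Theorem proposition2p13 (R : realType) (H : completeNormedModType R[i])
    (ip : {dot H for (@Num.conj R[i])})
    (ip_norm : forall x : H, ip x x = `|x| ^+ 2)
    (M N D : set (H -> H)) (MND : cartan_triple ip M N D) :
  let G := GN_semigroup ip M D in
  let P := GN_semigroup ip N D in
  [/\ inverse_semigroup G, inverse_semigroup P, carrier P `<=` carrier G,
      idempotents P = idempotents G
    & idempotents G = [set p | D p /\ projection ip p]] /\
  [/\ clifford_inverse_monoid ip N P,
      carrier P =
        [set v | carrier G v /\ exists2 e, idempotents G e & munn G v e]
    & cartan_inverse_monoid (quotient G (munn G)) R].
Proof.
move=> G P; have [[vM vN [vD DM]] [abD _] _ _] := MND.
have clP := cartan_clifford R H ip ip_norm M N D MND.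
split; split.
- exact: GN_inverse_semigroup.
- by have [[]] := clP.
- exact: cartan_normalizer_sub.
- exact: cartan_idempotents.
- exact: GN_idempotents.
- exact: clP.
- exact: cartan_munn_kernel.
- exact: munn_quotient_cartan.
Qed.
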